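(* (i) Let $1\le N\le 3$. If $W\in\mathcal{M}_{2,2}(\mathbb{R}^N)\cap\mathcal{M}_{3,3}(\mathbb{R}^N)$, then $W$ satisfies condition $(\mathcal{W}_N)$ (defined in the context). Furthermore, if $W$ satisfies $(\mathcal{W}_N)$ with exponents such that $p_i=q_i$ for $1\le i\le 3$, then $W\in\mathcal{M}_{2,2}(\mathbb{R}^N)\cap\mathcal{M}_{3,3}(\mathbb{R}^N)$. (ii) Let $N\ge 4$. Assume that $W\in\mathcal{M}_{r,r}(\mathbb{R}^N)$ for every $1<r<\infty$. Also suppose that there exists $\bar r>\frac N4$ such that $W\in\mathcal{M}_{p,q}(\mathbb{R}^N)$ for every $p$ with $1-\frac1{\bar r}<\frac1p<1$, where $q$ is given by $\frac1q=\frac1p+\frac1{\bar r}-1$. Then $W$ satisfies $(\mathcal{W}_N)$.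
   Context: $\mathcal{M}_{p,q}(\mathbb{R}^N)$ is the set of tempered distributions $W$ such that $f\mapsto W*f$ is bounded from $L^p(\mathbb{R}^N)$ to $L^q(\mathbb{R}^N)$. Condition $(\mathcal{W}_N)$ on a tempered distribution $W$ on $\mathbb{R}^N$: there exist $p_1,p_2,p_3,p_4,q_1,q_2,q_3,q_4,s_1,s_2\in[1,\infty)$ such that - if $N\ge 3$: $p_4<\frac{N}{N-2}$, $\ 2\le p_2,p_3,s_1,s_2<\frac{2N}{N-2}$, $\ \frac{2N}{N+2}<q_1\le 2$, $\ q_3,q_4>\frac N2$; - if $N\in\{1,2\}$: $p_2,p_3,s_1,s_2\ge 2$ and $1<q_1\le 2$; - $W\in\mathcal{M}_{2,2}(\mathbb{R}^N)\cap\bigcap_{i=1}^4\mathcal{M}_{p_i,q_i}(\mathbb{R}^N)$; - $\frac1{p_3}+\frac1{q_2}=\frac1{q_1}$, $\ \frac1{p_1}-\frac1{p_3}=\frac1{s_1}$, $\ \frac1{q_1}-\frac1{q_3}=\frac1{s_2}$. *)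

(* Defs.v *)
From HB Require Import structures.
From mathcomp Require Import all_boot all_order all_algebra.
From mathcomp Require Import all_classical all_reals all_analysis.
From mathcomp Require Import complex lra.

Set Implicit Arguments.
Unset Strict Implicit.
Unset Printing Implicit Defensive.
Import Order.TTheory GRing.Theory Num.Theory.
Import numFieldNormedType.Exports.
Local Open Scope classical_set_scope.
Local Open Scope ring_scope.

(* Lebesgue measure on R^n is built on n-tuples as the n-fold product of the
   one-dimensional one. *)
Section lebesgue_tuple.
Variable R : realType.
Local Notation mR := (measurableTypeR R).

Definition cons_pair n (x : mR * n.-tuple mR) : n.+1.-tuple mR :=
  [tuple of x.1 :: x.2].

Lemma measurable_cons_pair n : measurable_fun setT (@cons_pair n).
Proof.
exact: (measurable_cons measurable_fst measurable_snd).
Qed.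

Section step.
Variables (n : nat) (mu : {sigma_finite_measure set (n.-tuple mR) -> \bar R}).

Definition cons_measure : set (n.+1.-tuple mR) -> \bar R :=
  pushforward (lebesgue_measure \x mu)%E (@cons_pair n).

HB.instance Definition _ := Measure.copy cons_measure
  (measure_function_pushforward__canonical__measure_function_Measure
     (lebesgue_measure \x mu)%E (@measurable_cons_pair n)).

Let cons_measure_sigma_finite : sigma_finite setT cons_measure.
Proof.
have /sigma_finiteP[F [TF ndF Foo]] := sigma_finiteT (@lebesgue_measure R).
have /sigma_finiteP[G [TG ndG Goo]] := sigma_finiteT mu.
pose u (t : n.+1.-tuple mR) : mR * n.-tuple mR :=
  (thead t, [tuple of behead t]).
have mf : measurable_fun setT u.
  apply: measurable_fun_pair; first exact: measurable_tnth.
  exact: measurable_behead.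
have uK : u \o @cons_pair n = id.
  by apply/funext => -[x t]; rewrite /u /=; congr pair; exact/val_inj.
exists (fun k => u @^-1` (F k `*` G k)).
  apply/seteqP; split => // t _.
  have [i _ Fi] : (\bigcup_k F k) (u t).1 by rewrite -TF.
  have [j _ Gj] : (\bigcup_k G k) (u t).2 by rewrite -TG.
  exists (maxn i j) => //; split.
  - by move: Fi; exact/subsetPset/ndF/leq_maxl.
  - by move: Gj; exact/subsetPset/ndG/leq_maxr.
move=> k; have [mF Fk] := Foo k; have [mG Gk] := Goo k; split.
  by rewrite -[X in measurable X]setTI; apply: mf => //; exact: measurableX.
rewrite /cons_measure /pushforward -comp_preimage uK preimage_id.
by rewrite product_measure1E// lte_mul_pinfty// ge0_fin_numE.
Qed.

HB.instance Definition _ := Measure_isSigmaFinite.Build _ _ _ cons_measure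
  cons_measure_sigma_finite.

End step.

Fixpoint lebesgue_tuple n : {sigma_finite_measure set (n.-tuple mR) -> \bar R} :=
  if n is n'.+1 then cons_measure (lebesgue_tuple n') else \d_[tuple].

Lemma lebesgue_tuple_box n (A : 'I_n -> set mR) :
  (forall i, measurable (A i)) ->
  lebesgue_tuple n [set t | forall i, A i (tnth t i)] =
  (\prod_(i < n) lebesgue_measure (A i))%E.
Proof.
elim: n A => [|n IH] A mA.
  rewrite big_ord0 /= diracE mem_set//=; by case.
rewrite big_ord_recl -IH//= /cons_measure /pushforward.
have mB : measurable
    [set t : n.-tuple mR | forall i : 'I_n, A (lift ord0 i) (tnth t i)].
  rewrite (_ : [set _ | _] =
    \bigcap_(i in [set: 'I_n]) (fun t => tnth t i) @^-1` A (lift ord0 i)).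
    apply: fin_bigcap_measurable => // i _.
    by rewrite -[X in measurable X]setTI; apply: measurable_tnth.
  by apply/seteqP; split => t /= h i; [move=> _|]; exact: h.
rewrite -product_measure1E//; congr product_measure1.
apply/seteqP; split => -[x t] /= h.
  split; first exact: (h ord0).
  by move=> i; have := h (lift ord0 i); rewrite /= tnthS.
by move=> i; case: (unliftP ord0 i) => [j ->|->];
  rewrite ?tnthS; [exact: h.2|exact: h.1].
Qed.

End lebesgue_tuple.

Section schwartz.
Variables (R : realType) (N : nat).
Local Notation RN := 'rV[R]_N.
Local Notation C := R[i]^o.
Local Notation normc := ComplexField.Normc.normc.

Fixpoint partial (s : seq 'I_N) (f : RN -> R) : RN -> R :=
  if s is i :: s' then 'D_(delta_mx 0 i) (partial s' f) else f.

(* Frechet differentiability of all iterated partial derivatives, i.e. f is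
   C^oo; mere existence of the partial derivatives would not suffice. *)
Definition smooth (f : RN -> R) := forall s x, differentiable (partial s f) x.

Definition cpartial (s : seq 'I_N) (f : RN -> C) (x : RN) : C :=
  (partial s (@complex.Re R \o f) x +i* partial s (@complex.Im R \o f) x)%C.

Definition csmooth (f : RN -> C) :=
  smooth (@complex.Re R \o f) /\ smooth (@complex.Im R \o f).

(* `|x| is the sup norm on R^N; as it is equivalent to the Euclidean one, the
   choice affects neither the space nor its topology. *)
Definition schwartz_fun (f : RN -> C) := csmooth f /\
  forall k s, exists M : R, forall x,
    (1 + `|x|) ^+ k * normc (cpartial s f x) <= M.

Lemma derivable_partial f s i x : smooth f ->
  derivable (partial s f) x (delta_mx 0 i).
Proof. by move=> sf; exact/diff_derivable/sf. Qed.

Lemma partialD f g s : smooth f -> smooth g ->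
  partial s (f + g) = partial s f + partial s g.
Proof.
move=> sf sg; elim: s => //= i s ->; apply/funext => x.
by rewrite deriveD//; exact: derivable_partial.
Qed.

Lemma partialZ f s (c : R) : smooth f ->
  partial s (c \*: f) = c \*: partial s f.
Proof.
move=> sf; elim: s => //= i s ->; apply/funext => x.
by rewrite deriveZ//; exact: derivable_partial.
Qed.

Lemma smoothD f g : smooth f -> smooth g -> smooth (f + g).
Proof. by move=> sf sg s x; rewrite partialD//; exact: differentiableD. Qed.

Lemma smoothZ f (c : R) : smooth f -> smooth (c \*: f).
Proof. by move=> sf s x; rewrite partialZ//; exact: differentiableZ. Qed.

Lemma is_diff_reflect (x y : RN) : is_diff y (fun z : RN => x - z) -%R.
Proof.
have H : is_diff y ((cst x : RN -> RN) - id) (0 - id) by exact: is_diffB.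
apply: (@is_diff_eq _ _ _ _ _ _ _ H).
by apply/funext => z; rewrite !fctE add0r.
Qed.

Lemma differentiable_reflect (f : RN -> R) (x y : RN) :
  differentiable f (x - y) -> differentiable (fun z => f (x - z)) y.
Proof.
by move=> df; apply: (@differentiable_comp _ _ _ _ (fun z => x - z) f).
Qed.

Lemma derive_reflect (f : RN -> R) (x y v : RN) :
  differentiable f (x - y) ->
  'D_v (fun z => f (x - z)) y = - 'D_v f (x - y).
Proof.
move=> df; have [dr er] := is_diff_reflect x y.
rewrite deriveE; last exact: differentiable_reflect.
rewrite (_ : (fun z => _) = f \o (fun z => x - z))//.
by rewrite diff_comp//= er linearN deriveE.
Qed.

Lemma partial_reflect f s (x : RN) : smooth f ->
  partial s (fun y => f (x - y)) =
  (-1) ^+ size s \*: (fun y => partial s f (x - y)).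
Proof.
move=> sf; elim: s => [|i s IH] /=; first by apply/funext => y /=; rewrite scale1r.
rewrite IH; apply/funext => y /=.
rewrite deriveZ; last exact/diff_derivable/differentiable_reflect/sf.
by rewrite derive_reflect//= exprS mulN1r scaleNr scalerN.
Qed.

Lemma smooth_reflect f (x : RN) : smooth f -> smooth (fun y => f (x - y)).
Proof.
move=> sf s y; rewrite partial_reflect//.
exact/differentiableZ/differentiable_reflect/sf.
Qed.

Lemma normc_ge0 (z : R[i]) : 0 <= normc z.
Proof. by case: z => a b; exact: sqrtr_ge0. Qed.

Lemma normcD (z w : R[i]) : normc (z + w) <= normc z + normc w.
Proof. by have := ler_normD z w; rewrite -rmorphD/= lecR. Qed.

Lemma Re_add (f g : RN -> C) : @complex.Re R \o (f + g) =
  (@complex.Re R \o f) + (@complex.Re R \o g).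
Proof. by apply/funext => x /=; rewrite !fctE; case: (f x) (g x) => ? ? []. Qed.

Lemma Im_add (f g : RN -> C) : @complex.Im R \o (f + g) =
  (@complex.Im R \o f) + (@complex.Im R \o g).
Proof. by apply/funext => x /=; rewrite !fctE; case: (f x) (g x) => ? ? []. Qed.

Lemma Re_scale (c : R[i]) (f : RN -> C) : @complex.Re R \o (c *: f) =
  (complex.Re c \*: (@complex.Re R \o f)) +
  ((- complex.Im c) \*: (@complex.Im R \o f)).
Proof.
apply/funext => x /=; rewrite !fctE/=; case: c (f x) => a b [u v] /=.
by rewrite scaleNr.
Qed.

Lemma Im_scale (c : R[i]) (f : RN -> C) : @complex.Im R \o (c *: f) =
  (complex.Re c \*: (@complex.Im R \o f)) +
  (complex.Im c \*: (@complex.Re R \o f)).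
Proof. by apply/funext => x /=; rewrite !fctE/=; case: c (f x) => a b [u v]. Qed.

Lemma csmoothD f g : csmooth f -> csmooth g -> csmooth (f + g).
Proof.
by move=> [f1 f2] [g1 g2]; split; rewrite ?Re_add ?Im_add; exact: smoothD.
Qed.

Lemma csmoothZ c f : csmooth f -> csmooth (c *: f).
Proof.
by move=> [f1 f2]; split; rewrite ?Re_scale ?Im_scale;
  apply: smoothD; exact: smoothZ.
Qed.

Lemma cpartialD f g s x : csmooth f -> csmooth g ->
  cpartial s (f + g) x = cpartial s f x + cpartial s g x.
Proof. by move=> [? ?] [? ?]; rewrite /cpartial Re_add Im_add !partialD. Qed.

Lemma cpartialZ c f s x : csmooth f ->
  cpartial s (c *: f) x = c * cpartial s f x.
Proof.
move=> [? ?]; rewrite /cpartial Re_scale Im_scale.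
rewrite !partialD; try exact: smoothZ.
by rewrite !partialZ// !fctE/=; case: c => a b /=; rewrite scaleNr.
Qed.

Lemma cpartial_reflect f s x y : csmooth f ->
  cpartial s (fun z => f (x - z)) y = (-1) ^+ size s * cpartial s f (x - y).
Proof.
move=> [sf1 sf2]; rewrite /cpartial.
have := partial_reflect s x sf1; rewrite /comp => ->.
have := partial_reflect s x sf2; rewrite /comp => -> /=.
rewrite -[(-1) ^+ _ : R[i]]signr_odd -[(-1) ^+ _ : R]signr_odd.
by case: (odd _); rewrite ?expr1 ?expr0 ?scaleN1r ?scale1r ?mulN1r ?mul1r.
Qed.

Lemma csmooth0 : csmooth 0.
Proof.
suff s0 : smooth (cst 0) by [].
have p0 s : partial s (cst 0) = cst 0.
  by elim: s => //= i s ->; apply/funext => x; rewrite derive_cst.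
by move=> s x; rewrite p0.
Qed.

Lemma schwartz_fun0 : schwartz_fun 0.
Proof.
split=> [|k s]; first exact: csmooth0.
exists 0 => x; rewrite -(scale0r 0) cpartialZ; last exact: csmooth0.
by rewrite mul0r ComplexField.Normc.normc0 mulr0.
Qed.

Lemma schwartz_funD f g :
  schwartz_fun f -> schwartz_fun g -> schwartz_fun (f + g).
Proof.
move=> [sf bf] [sg bg]; split=> [|k s]; first exact: csmoothD.
have [M fM] := bf k s; have [M' gM'] := bg k s.
exists (M + M') => x; rewrite cpartialD//.
apply: le_trans (lerD (fM x) (gM' x)).
by rewrite -mulrDr ler_wpM2l ?exprn_ge0 ?addr_ge0// normcD.
Qed.

Lemma schwartz_funZ c f : schwartz_fun f -> schwartz_fun (c *: f).
Proof.
move=> [sf bf]; split=> [|k s]; first exact: csmoothZ.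
have [M fM] := bf k s; exists (normc c * M) => x.
rewrite cpartialZ// ComplexField.Normc.normcM mulrCA.
by rewrite ler_wpM2l ?normc_ge0.
Qed.

Lemma schwartz_fun_reflect f (x : RN) :
  schwartz_fun f -> schwartz_fun (fun y => f (x - y)).
Proof.
move=> [[sf1 sf2] bf]; split=> [|k s].
  by split; [exact: (smooth_reflect (f := @complex.Re R \o f) x)
            |exact: (smooth_reflect (f := @complex.Im R \o f) x)].
have [M fM] := bf k s; exists ((1 + `|x|) ^+ k * M) => y.
rewrite cpartial_reflect; last by split.
rewrite ComplexField.Normc.normcM.
have -> : normc ((-1) ^+ size s : R[i]) = 1.
  rewrite -signr_odd; case: (odd _); rewrite ?expr0 ?expr1.
    by rewrite /= oppr0 expr0n addr0 sqrrN expr1n sqrtr1.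
  exact: ComplexField.Normc.normc1.
rewrite mul1r.
have h0 (z : RN) : 0 <= 1 + `|z| by rewrite addr_ge0.
apply: (@le_trans _ _ ((1 + `|x|) ^+ k *
    ((1 + `|x - y|) ^+ k * normc (cpartial s f (x - y))))); last first.
  by rewrite ler_wpM2l ?exprn_ge0.
rewrite mulrA -exprMn ler_wpM2r ?normc_ge0// lerXn2r ?nnegrE ?mulr_ge0//.
have : `|y| <= `|x - y| + `|x|.
  by rewrite -{1}(subKr x y) (le_trans (ler_normB _ _))// addrC.
have : 0 <= `|x| * `|x - y| by rewrite mulr_ge0.
by move=> *; lra.
Qed.

Definition schwartz_pred : {pred RN -> C} := fun f => `[< schwartz_fun f >].

Lemma schwartz_submod_closed : submod_closed schwartz_pred.
Proof.
split=> [|c f g /asboolP sf /asboolP sg]; apply/asboolP.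
  exact: schwartz_fun0.
by apply: schwartz_funD => //; exact: schwartz_funZ.
Qed.

HB.instance Definition _ := GRing.isSubmodClosed.Build _ _ schwartz_pred
  (GRing.submod_closed_semi schwartz_submod_closed).

Record schwartz := Schwartz {
  schwartz_val : RN -> C ; schwartz_valP : schwartz_val \in schwartz_pred }.

HB.instance Definition _ := [isSub for schwartz_val].
HB.instance Definition _ := [Choice of schwartz by <:].
HB.instance Definition _ := [SubChoice_isSubLmodule of schwartz by <:].

Coercion schwartz_val : schwartz >-> Funclass.

Definition schwartz_seminorm (k : nat) (s : seq 'I_N) (f : schwartz) : R :=
  sup [set (1 + `|x|) ^+ k * normc (cpartial s f x) | x in [set: RN]].

Definition schwartz_ball (g : schwartz) k s (e : R) : set schwartz :=
  [set f | schwartz_seminorm k s (f - g) < e].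

(* The locally convex topology of the Schwartz space: the coarsest one in which
   all open balls of all the seminorms are open. *)
HB.instance Definition _ := isSubBaseTopological.Build schwartz
  [set B | exists g k s e, 0 < e /\ B = schwartz_ball g k s e] id.

Record tempered_distribution := TemperedDistribution {
  tdist_val :> {linear schwartz -> C} ;
  tdist_continuous : continuous tdist_val }.

Lemma schwartz_reflect_subproof (f : schwartz) (x : RN) :
  (fun y => f (x - y)) \in schwartz_pred.
Proof.
by apply/asboolP/schwartz_fun_reflect; have /asboolP := schwartz_valP f.
Qed.

Definition schwartz_reflect (f : schwartz) (x : RN) : schwartz :=
  Schwartz (schwartz_reflect_subproof f x).

Definition convolution (W : tempered_distribution) (f : schwartz) : RN -> C :=
  fun x => W (schwartz_reflect f x).

Definition Lp_norm (p : R) (f : RN -> C) : \bar R :=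
  Lnorm (lebesgue_tuple R N) p%:E
    (fun t => (normc (f (\row_i tnth t i)))%:E).

(* For finite p, Schwartz functions are dense in L^p, so an L^p - L^q bound on
   them is the same as W * _ extending to a bounded operator L^p -> L^q. *)
Definition multipliers (p q : R) : set tempered_distribution :=
  [set W | exists M : R, forall f : schwartz,
     (Lp_norm q (convolution W f) <= M%:E * Lp_norm p f)%E].

Record W_exponents := WExponents {
  wp1 : R; wp2 : R; wp3 : R; wp4 : R;
  wq1 : R; wq2 : R; wq3 : R; wq4 : R;
  ws1 : R; ws2 : R }.

Definition W_condition_with (W : tempered_distribution) (e : W_exponents) :=
  let n : R := N%:R in
  [/\ [/\ [/\ 1 <= wp1 e, 1 <= wp2 e, 1 <= wp3 e & 1 <= wp4 e],
          [/\ 1 <= wq1 e, 1 <= wq2 e, 1 <= wq3 e & 1 <= wq4 e] &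
          1 <= ws1 e /\ 1 <= ws2 e],
      ((3 <= N)%N ->
        [/\ wp4 e < n / (n - 2),
            [/\ 2 <= wp2 e < 2 * n / (n - 2),
                2 <= wp3 e < 2 * n / (n - 2),
                2 <= ws1 e < 2 * n / (n - 2) &
                2 <= ws2 e < 2 * n / (n - 2)],
            2 * n / (n + 2) < wq1 e <= 2 &
            n / 2 < wq3 e /\ n / 2 < wq4 e]),
      (N = 1%N \/ N = 2%N ->
        [/\ 2 <= wp2 e, 2 <= wp3 e, 2 <= ws1 e & 2 <= ws2 e] /\
        1 < wq1 e <= 2),
      multipliers 2 2 W /\
      [/\ multipliers (wp1 e) (wq1 e) W, multipliers (wp2 e) (wq2 e) W,
          multipliers (wp3 e) (wq3 e) W & multipliers (wp4 e) (wq4 e) W] &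
      [/\ (wp3 e)^-1 + (wq2 e)^-1 = (wq1 e)^-1,
          (wp1 e)^-1 - (wp3 e)^-1 = (ws1 e)^-1 &
          (wq1 e)^-1 - (wq3 e)^-1 = (ws2 e)^-1]].

Definition W_condition (W : tempered_distribution) :=
  exists e, W_condition_with W e.

End schwartz.

(* Main.v *)
(* The point is that L^p - L^q multipliers can be handled without complex
   interpolation.  Taking real and imaginary parts reduces everything to real
   functionals on real Schwartz functions.

   Duality M_{p,q} = M_{q',p'}: the function h = W * f is smooth of moderate
   growth, hence |h|^(p'-2) h, smoothed at the zeros of h and multiplied by a
   Gaussian, is a Schwartz function g; testing against it and passing to the
   limit bounds h in L^{p'}, once \int (W * f) g = \int (W * g(-.)) f(-.) is
   known.  This symmetry holds because both sides are W applied to one and the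
   same convolution: W commutes with the convolution integral, a limit of
   Riemann sums in every seminorm of the Schwartz space.

   Interpolation of M_{2,2} and M_{p,p} (p > 3) at 3 is Marcinkiewicz' argument
   with the truncation f / (1 + (f/l)^2) at height l, which maps Schwartz
   functions to Schwartz functions; the sum over dyadic heights telescopes.

   With these two tools only elementary choices of exponents are left.  In (i)
   the exponents 3/2, 2 and 3 suffice.  In (ii), for fixed p, Hoelder in the
   target space fills the whole segment between the two lines of the hypothesis;
   with c = 1/rbar one takes 1/p1 = 1 - 2x, 1/q1 = 1/2 and
   (1/p2, 1/q2) = (1/p3, 1/q3) = (1/2 - x, x), the dual of (1 - x, 1/2 + x),
   for some x < 1/N with c - 1/2 <= 2x < c. *)
From HB Require Import structures.
Require Import Defs.
From mathcomp Require Import all_boot all_order all_algebra finmap.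
From mathcomp Require Import all_classical all_reals all_analysis.
From mathcomp Require Import measurable_realfun complex lra ring.
Set Implicit Arguments.
Unset Strict Implicit.
Unset Printing Implicit Defensive.
Import Order.TTheory GRing.Theory Num.Theory.
Import numFieldNormedType.Exports.
Local Open Scope classical_set_scope.
Local Open Scope ring_scope.

(** * Slowly increasing and rapidly decreasing smooth functions *)

(** Two obstacles shape the development. [multipliers] tests W on Schwartz functions only, so every
    truncation and every dual test function has to be proved Schwartz; this is the reason for
    treating powers, Gaussians and cutoffs as smooth classes with growth control. Moreover the L^q
    mass of W * f may a priori be infinite, so it can never be divided out: the estimates are made
    on quantities known to be finite, or between extended nonnegative integrals, and Fatou's lemma
    reaches the limit. The bound rbar > N/4 enters (ii) through the fourth pair of exponents, placed
    on the lower line as (1/p4, 1/q4) = (u, u + c - 1): p4 < N/(N-2) means u > 1 - 2/N, q4 > N/2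
    means u + c - 1 < 2/N, and these are compatible exactly when c < 4/N. The condition x < 1/N
    keeps 1/p2, 1/p3, 1/s1 and 1/s2 above 1/2 - 1/N, the inverse of 2N/(N-2). *)

Section smooth_classes.
Variables (R : realType) (N : nat).
Local Notation RN := 'rV[R]_N.
Implicit Types (f g : RN -> R) (B : (RN -> R) -> Prop).

Definition pderive (i : 'I_N) f : RN -> R := 'D_(delta_mx 0 i) f.

Lemma partial_rcons s i f : partial (rcons s i) f = partial s (pderive i f).
Proof. by elim: s => //= j s ->. Qed.

(** The bound [B] is a parameter so that one Leibniz argument serves both polynomial growth and
    rapid decay. *)
Definition smooth_class B f :=
  forall s, (forall x, differentiable (partial s f) x) /\ B (partial s f).

Definition moderate f := exists k M, forall x, `|f x| <= M * (1 + `|x|) ^+ k.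
Definition rapid f := forall k, exists M, forall x, (1 + `|x|) ^+ k * `|f x| <= M.

Definition slow := smooth_class moderate.
Definition rschwartz := smooth_class rapid.

Lemma smooth_class_diff B f x : smooth_class B f -> differentiable f x.
Proof. by move=> /(_ [::])[]. Qed.

Lemma smooth_class_bound B f : smooth_class B f -> B f.
Proof. by move=> /(_ [::])[]. Qed.

Lemma smooth_class_pderive B f i : smooth_class B f ->
  smooth_class B (pderive i f).
Proof. by move=> Bf s; rewrite -partial_rcons; exact: Bf. Qed.

Lemma smooth_class_partial B f s : smooth_class B f ->
  smooth_class B (partial s f).
Proof.
elim/last_ind: s f => // s i IH f Bf; rewrite partial_rcons.
exact/IH/smooth_class_pderive.
Qed.

Lemma smooth_class_smooth B f : smooth_class B f -> smooth f.
Proof. by move=> Bf s x; case: (Bf s). Qed.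

Lemma smooth_class_sub B B' f : (forall g, B g -> B' g) ->
  smooth_class B f -> smooth_class B' f.
Proof. by move=> BB' Bf s; case: (Bf s) => ? /BB'. Qed.

Inductive span (Q : (RN -> R) -> Prop) : (RN -> R) -> Prop :=
| span_in f : Q f -> span Q f
| span_add f g : span Q f -> span Q g -> span Q (f + g).

(** Differentiating a member of a natural family, such as products or powers, gives a sum of
    members. Since derivation is additive, the span of [Q] is stable under it. The induction peels
    [s] from its end, where the innermost derivative sits, so that the hypothesis on first
    derivatives applies directly. *)
Lemma smooth_class_coind B (Q : (RN -> R) -> Prop) :
  (forall f g, B f -> B g -> B (f + g)) ->
  (forall f, Q f -> [/\ forall x, differentiable f x, B f &
                        forall i, span Q (pderive i f)]) ->
  forall f, Q f -> smooth_class B f.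
Proof.
move=> BD HQ f Qf s.
have {HQ} HQ g : span Q g -> [/\ forall x, differentiable g x, B g &
                        forall i, span Q (pderive i g)].
  elim=> [|g1 g2 _ [d1 b1 s1] _ [d2 b2 s2]]; first exact: HQ.
  split=> [x||i]; [exact: differentiableD|exact: BD|].
  suff -> : pderive i (g1 + g2) = pderive i g1 + pderive i g2 by exact: span_add.
  by apply/funext => x; rewrite /pderive deriveD//; exact: diff_derivable.
elim/last_ind: s f {Qf}(span_in Qf) => [|s i IH] f Qf; first by case: (HQ _ Qf).
by rewrite partial_rcons; apply: IH; case: (HQ _ Qf).
Qed.

Lemma pderiveM i f g x : differentiable f x -> differentiable g x ->
  pderive i (f * g) x = pderive i f x * g x + f x * pderive i g x.
Proof.
move=> df dg; rewrite /pderive deriveM; try exact: diff_derivable.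
by rewrite addrC; congr (_ + _); rewrite mulrC.
Qed.

Lemma smooth_classM B1 B2 B3 :
  (forall f g, B3 f -> B3 g -> B3 (f + g)) ->
  (forall f g, B1 f -> B2 g -> B3 (f * g)) ->
  forall f g, smooth_class B1 f -> smooth_class B2 g -> smooth_class B3 (f * g).
Proof.
move=> BD BM f g Bf Bg.
apply: (@smooth_class_coind B3 (fun h => exists f g,
  [/\ smooth_class B1 f, smooth_class B2 g & h = f * g])) => //; last first.
  by exists f, g.
move=> {f g Bf Bg} _ [f [g [Bf Bg ->]]].
have df x := smooth_class_diff x Bf; have dg x := smooth_class_diff x Bg.
split=> [x||i]; first exact: differentiableM.
  by apply: BM; apply: smooth_class_bound.
have -> : pderive i (f * g) = pderive i f * g + f * pderive i g.
  by apply/funext => x; rewrite pderiveM.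
apply: span_add; apply: span_in.
  by exists (pderive i f), g; split=> //; exact: smooth_class_pderive.
by exists f, (pderive i g); split=> //; exact: smooth_class_pderive.
Qed.

Lemma smooth_classD B : (forall f g, B f -> B g -> B (f + g)) ->
  forall f g, smooth_class B f -> smooth_class B g -> smooth_class B (f + g).
Proof.
move=> BD f g Bf Bg s; rewrite partialD; try exact: smooth_class_smooth.
case: (Bf s) => df bf; case: (Bg s) => dg bg.
by split=> [x|]; [exact: differentiableD|exact: BD].
Qed.

Lemma one_norm_ge1 (x : RN) : 1 <= 1 + `|x|.
Proof. by rewrite lerDl. Qed.

Lemma one_norm_gt0 (x : RN) : 0 < 1 + `|x|.
Proof. exact: lt_le_trans (one_norm_ge1 x). Qed.

Lemma moderateP f : moderate f ->
  exists k M, 0 <= M /\ forall x, `|f x| <= M * (1 + `|x|) ^+ k.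
Proof.
move=> [k [M fM]]; exists k, `|M|; split=> // x.
by rewrite (le_trans (fM x))// ler_wpM2r ?ler_norm// exprn_ge0// ltW ?one_norm_gt0.
Qed.

Lemma moderate_wide f k : (exists M, 0 <= M /\ forall x, `|f x| <= M * (1 + `|x|) ^+ k) ->
  forall k', (k <= k')%N ->
  exists M, 0 <= M /\ forall x, `|f x| <= M * (1 + `|x|) ^+ k'.
Proof.
move=> [M [M0 fM]] k' kk'; exists M; split=> // x; rewrite (le_trans (fM x))//.
by rewrite ler_wpM2l// ler_weXn2l ?one_norm_ge1.
Qed.

Lemma moderateD f g : moderate f -> moderate g -> moderate (f + g).
Proof.
move=> /moderateP[k [M HM]] /moderateP[k' [M' HM']].
have [A [A0 fA]] := @moderate_wide f k (ex_intro _ M HM) (k + k')%N (leq_addr _ _).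
have [A' [A'0 gA']] := @moderate_wide g k' (ex_intro _ M' HM') (k + k')%N (leq_addl _ _).
exists (k + k')%N, (A + A') => x; rewrite mulrDl.
by rewrite (le_trans (ler_normD _ _))// lerD.
Qed.

Lemma moderateM f g : moderate f -> moderate g -> moderate (f * g).
Proof.
move=> /moderateP[k [M [M0 fM]]] /moderateP[k' [M' [M'0 gM']]].
exists (k + k')%N, (M * M') => x; rewrite !fctE normrM exprD mulrACA.
by rewrite ler_pM.
Qed.

Lemma rapidD f g : rapid f -> rapid g -> rapid (f + g).
Proof.
move=> Hf Hg k; have [M fM] := Hf k; have [M' gM'] := Hg k.
exists (M + M') => x; apply: le_trans (lerD (fM x) (gM' x)).
by rewrite -mulrDr ler_wpM2l ?ler_normD// exprn_ge0// ltW ?one_norm_gt0.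
Qed.

Lemma rapid_moderateM f g : rapid f -> moderate g -> rapid (f * g).
Proof.
move=> Hf /moderateP[k' [M' [M'0 gM']]] k; have [M fM] := Hf (k + k')%N.
exists (M * M') => x; rewrite !fctE normrM mulrA.
apply: (@le_trans _ _ ((1 + `|x|) ^+ k * `|f x| * (M' * (1 + `|x|) ^+ k'))).
  by rewrite ler_wpM2l// mulr_ge0// exprn_ge0// ltW ?one_norm_gt0.
rewrite mulrCA [M * _]mulrC ler_wpM2l// mulrAC -exprD; exact: fM.
Qed.

Lemma rapid_moderate f : rapid f -> moderate f.
Proof.
by move=> /(_ 0%N)[M fM]; exists 0%N, M => x; have := fM x; rewrite expr0 mulr1 mul1r.
Qed.

Lemma rschwartz_slow f : rschwartz f -> slow f.
Proof. exact/smooth_class_sub/rapid_moderate. Qed.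

Lemma slowD f g : slow f -> slow g -> slow (f + g).
Proof. exact/smooth_classD/moderateD. Qed.

Lemma slowM f g : slow f -> slow g -> slow (f * g).
Proof. exact: (smooth_classM moderateD moderateM). Qed.

Lemma rschwartzD f g : rschwartz f -> rschwartz g -> rschwartz (f + g).
Proof. exact/smooth_classD/rapidD. Qed.

Lemma rschwartzM f g : rschwartz f -> slow g -> rschwartz (f * g).
Proof. exact: (smooth_classM rapidD rapid_moderateM). Qed.

Lemma slow_cst c : slow (cst c).
Proof.
have p0 s : exists c', partial s (cst c) = cst c' :> (RN -> R).
  elim: s => /= [|i s [c' ->]]; first by exists c.
  by exists 0; apply/funext => x; rewrite derive_cst.
move=> s; have [c' ->] := p0 s; split=> [x|]; first exact: differentiable_cst.
by exists 0%N, `|c'| => x; rewrite expr0 mulr1.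
Qed.

Lemma rschwartzZ c f : rschwartz f -> rschwartz (cst c * f).
Proof. by move=> Sf; rewrite mulrC; apply: rschwartzM => //; exact: slow_cst. Qed.

Lemma rschwartzN f : rschwartz f -> rschwartz (- f).
Proof.
move=> Sf; have -> : - f = cst (-1) * f by apply/funext => x; rewrite !fctE mulN1r.
exact: rschwartzZ.
Qed.

Lemma rschwartzB f g : rschwartz f -> rschwartz g -> rschwartz (f - g).
Proof. by move=> Sf Sg; apply: rschwartzD => //; exact: rschwartzN. Qed.

Lemma rschwartz0 : rschwartz 0.
Proof.
move=> s; rewrite (_ : partial s 0 = 0).
  split=> [x|k]; first exact: differentiable_cst.
  by exists 0 => x; rewrite normr0 mulr0.
by elim: s => //= i s ->; apply/funext => x; exact: derive_cst.
Qed.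

Lemma rschwartz_sum (I : Type) (r : seq I) (P : pred I) (F : I -> RN -> R) :
  (forall i, P i -> rschwartz (F i)) -> rschwartz (\sum_(i <- r | P i) F i).
Proof. by move=> HF; elim/big_ind: _ => //; [exact: rschwartz0|exact: rschwartzD]. Qed.

(** * Real powers of functions bounded away from zero *)

Lemma is_derive_comp1 (phi : R -> R) (dphi : R) (u : RN -> R) (x v : RN) :
  differentiable u x -> is_derive (u x) 1 phi dphi ->
  differentiable (phi \o u) x /\ 'D_v (phi \o u) x = dphi * 'D_v u x.
Proof.
move=> du [dp ep].
have dp' : differentiable phi (u x) by exact/derivable1_diffP.
split; first exact: differentiable_comp.
rewrite deriveE; last exact: differentiable_comp.
rewrite diff_comp//= deriveE//.
by rewrite deriv1E// derive1E ep /= mulrC.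
Qed.

(** For a < 0 the lower bound [d] makes the power bounded. For a >= 0 the base is majorised by a
    quantity that is at least 1, on which the exponent may be raised to a natural number [m]. *)
Lemma moderate_powR u d a : 0 < d -> (forall x, d <= u x) -> moderate u ->
  moderate (fun x => u x `^ a).
Proof.
move=> d0 du /moderateP[k [M [M0 uM]]].
have u0 x : 0 < u x by exact: lt_le_trans (du x).
have [a0|a0] := leP 0 a; last first.
  exists 0%N, (d `^ a) => x; rewrite expr0 mulr1 ger0_norm ?powR_ge0//.
  rewrite -[a]opprK (powRN (u x) (- a)) (powRN d (- a)) lef_pV2 ?posrE ?powR_gt0//.
  by rewrite ge0_ler_powR// ?nnegrE ?ltW// oppr_gt0.
have [m am] : exists m : nat, a <= m%:R.
  by exists (Num.truncn a).+1; rewrite ltW// truncnS_gt.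
exists (k * m)%N, ((1 + M) ^+ m) => x; rewrite ger0_norm ?powR_ge0//.
have := uM x; rewrite gtr0_norm// => ux.
have h : u x <= (1 + M) * (1 + `|x|) ^+ k.
  rewrite (le_trans ux)// ler_wpM2r ?lerDr// exprn_ge0// ltW ?one_norm_gt0//.
have h1 : 1 <= (1 + M) * (1 + `|x|) ^+ k.
  by rewrite mulr_ege1// ?lerDl// exprn_ege1// one_norm_ge1.
rewrite exprM -exprMn -powR_mulrn ?(le_trans ler01)//.
apply: (@le_trans _ _ (((1 + M) * (1 + `|x|) ^+ k) `^ a)).
  by rewrite ge0_ler_powR// ?nnegrE ?ltW// (lt_le_trans ltr01).
exact: ler_powR.
Qed.

(** The stable family is b u^a with [b] slow and the exponent free, because each derivative lowers
    the exponent by one: d(b u^a) = (db) u^a + (a b du) u^(a-1). *)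
Lemma slow_powR u d a : 0 < d -> (forall x, d <= u x) -> slow u ->
  slow (fun x => u x `^ a).
Proof.
move=> d0 du su.
pose Q h := exists b a, slow b /\ h = b * (fun x => u x `^ a).
have : Q (fun x => u x `^ a).
  exists (cst 1), a; split; first exact: slow_cst.
  by apply/funext => x; rewrite !fctE mul1r.
apply: smooth_class_coind; first exact: moderateD.
move=> _ [b [{}a [sb ->]]].
have u0 x : 0 < u x by exact: lt_le_trans (du x).
have dux x := smooth_class_diff x su; have db x := smooth_class_diff x sb.
have H x i := is_derive_comp1 (delta_mx 0 i) (dux x) (@is_derive1_powR _ a _ (u0 x)).
have dp x : differentiable (fun x => u x `^ a) x.
  apply: (@differentiable_comp _ _ _ _ u (fun y : R => y `^ a)) => //.
  by apply/derivable1_diffP; have [] := @is_derive1_powR _ a _ (u0 x).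
split=> [x||i]; first exact: differentiableM.
  apply: moderateM; first exact: smooth_class_bound.
  exact: (moderate_powR _ d0 du (smooth_class_bound su)).
have -> : pderive i (b * (fun x => u x `^ a)) =
    (pderive i b) * (fun x => u x `^ a) +
    (cst a * b * pderive i u) * (fun x => u x `^ (a - 1)).
  apply/funext => x; rewrite pderiveM// !fctE; congr (_ + _).
  rewrite /pderive; have /= [_ /= ->] := H x i; ring.
apply: span_add; apply: span_in.
  by exists (pderive i b), a; split=> //; exact: smooth_class_pderive.
exists (cst a * b * pderive i u), (a - 1); split=> //.
apply: slowM; last exact: smooth_class_pderive.
by apply: slowM => //; exact: slow_cst.
Qed.


(** * Differentials given by coordinates *)

Definition lin_form (c : 'I_N -> R) (v : RN) : R := \sum_i v 0 i * c i.

Lemma lin_form_linear c : linear (lin_form c).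
Proof.
move=> a u v; rewrite /lin_form scaler_sumr -big_split/=; apply: eq_bigr => i _.
by rewrite !mxE mulrDl -mulrA.
Qed.

Lemma lin_form_delta c i : lin_form c (delta_mx 0 i) = c i.
Proof.
rewrite /lin_form (bigD1 i)//= mxE !eqxx mul1r big1 ?addr0// => j ji.
by rewrite mxE (negbTE ji) mul0r.
Qed.

Lemma ler_coord_norm (x : RN) i : `|x 0 i| <= `|x|.
Proof.
rewrite [leRHS]mx_normrE.
exact: (le_trans _ (le_bigmax _ (fun ij => `|x ij.1 ij.2|) (0, i))).
Qed.

Lemma lin_form_le c v : `|lin_form c v| <= (\sum_i `|c i|) * `|v|.
Proof.
rewrite (le_trans (ler_norm_sum _ _ _))// mulr_suml ler_sum// => i _.
by rewrite normrM mulrC ler_wpM2l// ler_coord_norm.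
Qed.

Lemma lin_form_continuous c : continuous (lin_form c).
Proof.
move=> x; apply/(@cvgrPdist_lt _ _ _ (nbhs (x : RN))) => e e0.
set S := (\sum_i `|c i|); have S0 : 0 <= S by exact: sumr_ge0.
have S1 : 0 < 1 + S by rewrite ltr_pwDl.
apply/nbhs_ballP; exists (e / (1 + S)); rewrite /= ?divr_gt0// => y.
rewrite -ball_normE/= ltr_pdivlMr// mulrC => xy.
have -> : lin_form c x - lin_form c y = lin_form c (x - y).
  by rewrite /lin_form -sumrB; apply: eq_bigr => i _; rewrite !mxE mulrBl.
rewrite (le_lt_trans (lin_form_le _ _))// (le_lt_trans _ xy)//.
by rewrite ler_wpM2r// lerDr.
Qed.

(** A quadratic remainder is a little-o, so the differential is identified by uniqueness. This is
    how Frechet differentiability is obtained for functions known only through an expansion, in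
    particular for convolutions with a functional. *)
Lemma differentiable_quadratic f (x : RN) c C :
  (forall v, `|v| <= 1 -> `|f (x + v) - f x - lin_form c v| <= C * `|v| ^+ 2) ->
  differentiable f x /\ forall v, 'D_v f x = lin_form c v.
Proof.
move=> H.
pose lM := GRing.isLinear.Build _ _ _ _ _ (lin_form_linear c).
pose L : {linear RN -> R} := HB.pack (lin_form c) lM.
have cL : continuous L by exact: lin_form_continuous.
have dE := @diff_unique _ _ _ f L x cL.
(* Reads the little-o premise off the type of [diff_unique] and makes it the next goal. *)
match type of dE with ?X -> _ => have E : X end.
  apply/eqaddoP => e e0; apply/nbhs_ballP.
  (* Radius at most 1 puts [v] in the range of [H]; the other bound turns C |v|^2 into at most e
     |v|, whatever the sign of [C]. *)
  exists (Num.min 1 ((1 + `|C|)^-1 * e)) => /=.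
    by rewrite lt_min ltr01 mulr_gt0// invr_gt0 ltr_pwDl.
  move=> v; rewrite -ball_normE/= sub0r normrN lt_min => /andP[v1 ve].
  have -> : ((f \o shift x) - (cst (f x) + L)) v = f (x + v) - f x - lin_form c v.
    transitivity (f (v + x) - (f x + lin_form c v)); first by [].
    by rewrite [v + x]addrC opprD addrA.
  rewrite (le_trans (H _ (ltW v1)))//.
  rewrite expr2 mulrA ler_wpM2r// (@le_trans _ _ ((1 + `|C|) * `|v|))//.
    by rewrite ler_wpM2r// (le_trans (ler_norm C))// lerDr.
  by rewrite -ler_pdivlMl ?ltr_pwDl// ltW.
have {}dE := dE E.
have df : differentiable f x by apply/diff_locallyP; rewrite dE.
by split=> // v; rewrite deriveE// dE.
Qed.

Lemma derive_lin_form f (x v : RN) : differentiable f x ->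
  'D_v f x = lin_form (fun i => pderive i f x) v.
Proof.
move=> df; rewrite deriveE// {1}[v]row_sum_delta linear_sum/=.
by apply: eq_bigr => i _; rewrite linearZ/= /pderive deriveE.
Qed.

Lemma slow_coord i : slow (fun x : RN => x 0 i).
Proof.
(* The derivative of a coordinate is constant, hence already slow; only the coordinate itself has to
   be adjoined. *)
pose Q h := h = (fun x : RN => x 0 i) \/ slow h.
have : Q (fun x => x 0 i) by left.
apply: smooth_class_coind; first exact: moderateD.
move=> h [->|sh]; last first.
  split=> [x||j]; [exact: smooth_class_diff sh|exact: smooth_class_bound sh|].
  by apply: span_in; right; exact: smooth_class_pderive.
have H x : differentiable (fun x : RN => x 0 i) x /\
    forall v, 'D_v (fun x : RN => x 0 i) x = lin_form (fun j => (i == j)%:R) v.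
  apply: (@differentiable_quadratic _ _ _ 0) => v _.
  rewrite mul0r mxE [x 0 i + _]addrC addrK.
  rewrite /lin_form (bigD1 i)//= eqxx mulr1 big1 ?addr0 ?subrr ?normr0// => j.
  by rewrite eq_sym => /negbTE ->; rewrite mulr0.
split=> [x||j]; first by case: (H x).
  exists 1%N, 1 => x; rewrite mul1r expr1.
  by rewrite (le_trans (ler_coord_norm _ _))// lerDr.
apply: span_in; right.
rewrite (_ : pderive j _ = cst (i == j)%:R); first exact: slow_cst.
by apply/funext => x; rewrite /pderive (H x).2 lin_form_delta.
Qed.

(** * Gaussians *)

Definition sqnorm (x : RN) : R := \sum_i (x 0 i) ^+ 2.

Lemma slow_sqnorm : slow sqnorm.
Proof.
have -> : sqnorm = \sum_i (fun x : RN => x 0 i) * (fun x : RN => x 0 i).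
  by apply/funext => x; rewrite /sqnorm fct_sumE; apply: eq_bigr => i _; rewrite expr2.
apply: (big_ind slow); [exact: slow_cst|exact: slowD|move=> i _].
by apply: slowM; exact: slow_coord.
Qed.

Lemma sqnorm_ge0 x : 0 <= sqnorm x.
Proof. by apply: sumr_ge0 => i _; rewrite sqr_ge0. Qed.

Lemma norm_le_sqnorm (x : RN) : `|x| ^+ 2 <= sqnorm x.
Proof.
have [->|x0] := eqVneq x 0; first by rewrite normr0 expr0n/= sqnorm_ge0.
have /mx_norm_neq0[[a i] /= E] : `|x| != 0 by rewrite normr_eq0.
have {E} -> : `|x| = `|x a i| by exact: E.
rewrite real_normK ?num_real// /sqnorm (bigD1 i)//= [a]ord1 lerDl.
by apply: sumr_ge0 => j _; rewrite sqr_ge0.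
Qed.

(** This is s/k <= exp(s/k) raised to the power k. *)
Lemma exprn_le_expR k (s : R) : 0 <= s -> s ^+ k <= k%:R ^+ k * expR s.
Proof.
move=> s0; case: k => [|k]; first by rewrite !expr0 mul1r -expR0 ler_expR.
have k0 : 0 < k.+1%:R :> R by [].
have -> : expR s = expR (s / k.+1%:R) ^+ k.+1.
  by rewrite -expRM_natl mulrC divfK// gt_eqF.
rewrite -exprMn lerXn2r ?nnegrE ?mulr_ge0 ?expR_ge0//.
rewrite -ler_pdivrMl// mulrC (le_trans _ (expR_ge1Dx _))// lerDr.
exact: ler01.
Qed.

(** The polynomial weight is absorbed by exp(1 + |x|), and completing the square gives |x| - c |x|^2
    <= 1/(4c). *)
Lemma rapid_gauss c : 0 < c -> rapid (fun x => expR (- c * sqnorm x)).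
Proof.
move=> c0 k; exists (k%:R ^+ k * expR (1 + (4 * c)^-1)) => x.
rewrite ger0_norm ?expR_ge0//.
rewrite (@le_trans _ _ (k%:R ^+ k * expR (1 + `|x|) * expR (- c * sqnorm x)))//.
  by rewrite ler_wpM2r ?expR_ge0// exprn_le_expR// ltW// one_norm_gt0.
rewrite -mulrA ler_wpM2l ?exprn_ge0// -expRD ler_expR -addrA lerD2l.
have h := norm_le_sqnorm x.
have h1 : - c * sqnorm x <= - c * `|x| ^+ 2 by rewrite ler_wnM2l// oppr_le0 ltW.
have h2 : 0 <= c * (`|x| - (2 * c)^-1) ^+ 2 by rewrite mulr_ge0 ?sqr_ge0// ltW.
have -> : (4 * c)^-1 = `|x| - c * `|x| ^+ 2 + c * (`|x| - (2 * c)^-1) ^+ 2.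
  by field; rewrite gt_eqF.
by rewrite (le_trans (lerD (lexx _) h1))// mulNr lerDl.
Qed.

Lemma rschwartz_gauss c a : 0 < c -> slow a ->
  rschwartz (a * (fun x => expR (- c * sqnorm x))).
Proof.
move=> c0 sa.
pose Q h := exists b, slow b /\ h = b * (fun x => expR (- c * sqnorm x)).
have : Q (a * (fun x => expR (- c * sqnorm x))) by exists a.
apply: smooth_class_coind; first exact: rapidD.
move=> _ [b [sb ->]]; have db x := smooth_class_diff x sb.
have su : slow (cst (- c) * sqnorm).
  by apply: slowM; [exact: slow_cst|exact: slow_sqnorm].
have du x := smooth_class_diff x su.
have H x v := is_derive_comp1 v (du x) (is_derive_expR _).
have dg x : differentiable (fun x => expR (- c * sqnorm x)) x by case: (H x 0).
split=> [x||i]; first exact: differentiableM.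
  rewrite mulrC; apply: rapid_moderateM; first exact: rapid_gauss.
  exact: smooth_class_bound.
apply: span_in; exists (pderive i b + b * pderive i (cst (- c) * sqnorm)); split.
  apply: slowD; first exact: smooth_class_pderive.
  by apply: slowM => //; exact: smooth_class_pderive.
apply/funext => x; rewrite pderiveM// !fctE mulrDl -mulrA; congr (_ + _ * _).
have [_ E] := H x (delta_mx 0 i).
by rewrite mulrC; exact: E.
Qed.

(** * Mean value, Taylor and Clairaut theorems *)

Lemma line_is_derive f (x v : RN) (t : R) : (forall y, differentiable f y) ->
  is_derive t 1 (fun s : R => f (x + s *: v)) ('D_v f (x + t *: v)).
Proof.
move=> df; have := derivable1P f (x + t *: v) v.
have dl : differentiable (fun s : R => x + s *: v) t.
  apply: differentiableD; first exact: differentiable_cst.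
  by apply: differentiableZl; exact: ex_diff.
have dc : differentiable (fun s : R => f (x + s *: v)) t.
  exact: (@differentiable_comp _ _ _ _ (fun s : R => x + s *: v) f).
move=> _; split; first exact/derivable1_diffP.
rewrite deriveE// (_ : (fun s => _) = f \o (fun s : R => x + s *: v))//.
rewrite diff_comp//= deriveE//; congr ('d _ _ _).
have e1 : 'd (fun s : R => x + s *: v) t = (0 + *:%R ^~ v) :> (R -> RN).
  by apply: diff_val.
by rewrite e1 !fctE/= add0r scale1r.
Qed.

Lemma line_MVT f (x v : RN) : (forall y, differentiable f y) ->
  exists2 t : R, 0 <= t <= 1 & f (x + v) - f x = 'D_v f (x + t *: v).
Proof.
move=> df.
have [||t t01 H] := @MVT_segment R (fun s => f (x + s *: v))
    (fun s => 'D_v f (x + s *: v)) 0 1 ler01.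
- by move=> s _; exact: line_is_derive.
- apply: continuous_subspaceT => s.
  have [ds _] := line_is_derive x v s df.
  by apply: differentiable_continuous; exact/derivable1_diffP.
exists t; first by move: t01; rewrite in_itv.
by move: H; rewrite scale1r scale0r addr0 subr0 mulr1.
Qed.

Lemma norm_le_seg (t : R) (v : RN) : 0 <= t <= 1 -> `|t *: v| <= `|v|.
Proof.
by move=> /andP[t0 t1]; rewrite normrZ ger0_norm// ler_piMl.
Qed.

Lemma lipschitz_of_pderive f (x v : RN) M : (forall y, differentiable f y) ->
  (forall i y, `|y - x| <= `|v| -> `|pderive i f y| <= M) ->
  `|f (x + v) - f x| <= N%:R * M * `|v|.
Proof.
move=> df HM; have [t t01 ->] := line_MVT x v df.
rewrite derive_lin_form// (le_trans (lin_form_le _ _))// ler_wpM2r//.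
apply: (@le_trans _ _ (\sum_(i < N) M)); last first.
  by rewrite sumr_const card_ord mulr_natl.
by apply: ler_sum => i _; apply: HM; rewrite addrC addKr norm_le_seg.
Qed.

(** The mean value theorem along the segment, then the Lipschitz bound for the first derivatives.
    Second derivatives are bounded only within |v| of [x], so [M] may depend on [x]; the weighted
    estimate of [taylor_seminorm] relies on this. *)
Lemma taylor2 f (x v : RN) M : smooth f ->
  (forall i j y, `|y - x| <= `|v| -> `|pderive i (pderive j f) y| <= M) ->
  `|f (x + v) - f x - lin_form (fun i => pderive i f x) v| <=
   N%:R * (N%:R * M) * `|v| ^+ 2.
Proof.
move=> sf HM; have df y : differentiable f y by exact: (sf [::]).
have [t t01 ->] := line_MVT x v df.
rewrite derive_lin_form// /lin_form -sumrB.
rewrite (le_trans (ler_norm_sum _ _ _))//.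
apply: (@le_trans _ _ (\sum_(i < N) `|v| * (N%:R * M * `|v|))); last first.
  rewrite sumr_const card_ord -[_ *+ N]mulr_natl expr2 le_eqVlt.
  by apply/orP; left; apply/eqP; ring.
apply: ler_sum => i _; rewrite -mulrBr normrM ler_pM ?ler_coord_norm//.
have M0 : 0 <= M by apply: le_trans (HM i i x _); rewrite ?subrr ?normr0.
apply: (@le_trans _ _ (N%:R * M * `|t *: v|)); last first.
  by rewrite ler_wpM2l ?norm_le_seg// mulr_ge0.
apply: lipschitz_of_pderive => [y|j y yx]; first exact: (sf [:: i]).
by apply: HM; rewrite (le_trans yx)// norm_le_seg.
Qed.

Lemma derive_translate f (a z v : RN) :
  'D_v (fun y => f (y + a)) z = 'D_v f (z + a).
Proof.
rewrite /derive.
rewrite (_ : (fun h : R => h^-1 *: ((f \o shift (z + a)) (h *: v) - f (z + a))) =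
  (fun h : R => h^-1 *: (((fun y => f (y + a)) \o shift z) (h *: v) - f (z + a))))//.
by apply/funext => h /=; rewrite addrA.
Qed.

Lemma continuous_ball f (x : RN) e : {for x, continuous f} -> 0 < e ->
  exists2 d, 0 < d & forall y, `|y - x| < d -> `|f x - f y| < e.
Proof.
move=> cf e0.
have /(@cvgrPdist_lt _ _ _ (nbhs (x : RN))) /(_ _ e0) /nbhs_ballP[d /= d0 H] := cf.
by exists d => // y yx; apply: H; rewrite -ball_normE/= distrC.
Qed.

(** The second difference over a square of side h is symmetric in the two directions, and two mean
    value theorems write it as h^2 times either mixed derivative at a point within 2h of [x];
    continuity concludes. Since [partial] nests derivatives in list order, this is what allows an
    outer derivative to be moved inside. *)
Lemma clairaut f i j : smooth f -> pderive i (pderive j f) = pderive j (pderive i f).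
Proof.
move=> sf; apply/funext => x.
pose d k : RN := delta_mx 0 k.
have dZ (k : 'I_N) (h : R) g y : (forall z, differentiable g z) ->
    'D_(h *: d k) g y = h * pderive k g y.
  by move=> dg; rewrite /pderive !deriveE// linearZ.
have key k l h : 0 <= h -> exists2 z, `|z - x| <= h + h &
    f (x + h *: d k + h *: d l) - f (x + h *: d k) - (f (x + h *: d l) - f x) =
    h ^+ 2 * pderive l (pderive k f) z.
  move=> h0; pose ek := d k; pose el := d l; pose g y := f (y + h *: el) - f y.
  have df z : differentiable f z by exact: (sf [::]).
  have dfl z : differentiable (fun y => f (y + h *: el)) z.
    by apply: (@differentiable_comp _ _ _ _ (fun y => y + h *: el) f) => //.
  have dg z : differentiable g z by exact: differentiableB.
  have [s s01 E] := line_MVT x (h *: ek) dg.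
  have Eg z : pderive k g z = pderive k f (z + h *: el) - pderive k f z.
    rewrite /pderive deriveB; [|exact: diff_derivable|exact: diff_derivable].
    by rewrite derive_translate.
  have [t t01 E'] := line_MVT (x + s *: (h *: ek)) (h *: el)
    (fun z => sf [:: k] z).
  exists (x + s *: (h *: ek) + t *: (h *: el)).
    rewrite -(addrA x) [x + _]addrC addrK (le_trans (ler_normD _ _))//.
    have nd m : `|h *: d m| <= h.
      rewrite normrZ ger0_norm// ler_piMr// [leLHS]mx_normrE.
      apply/bigmax_leP; split=> // -[a b] _ /=; rewrite mxE.
      by case: (_ && _); rewrite ?normr1 ?normr0.
    by apply: lerD; apply: le_trans (nd _); exact: norm_le_seg.
  rewrite -/(g (x + h *: ek)) -/(g x) E dZ// Eg E' dZ; last exact: (sf [:: k]).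
  by rewrite expr2 mulrA.
have c1 := differentiable_continuous (sf [:: i; j] x).
have c2 := differentiable_continuous (sf [:: j; i] x).
apply/eqP; rewrite -subr_eq0 -normr_le0; apply/ler_addgt0Pr => e e0; rewrite add0r.
have e20 : 0 < e / 2 by rewrite divr_gt0.
have [d1 d10 H1] := continuous_ball (differentiable_continuous (sf [:: i; j] x)) e20.
have [d2 d20 H2] := continuous_ball (differentiable_continuous (sf [:: j; i] x)) e20.
have [h h0 [h1 h2]] : exists2 h : R, 0 < h & h + h < d1 /\ h + h < d2.
  move: d10 d20 {H1 H2} => d10 d20; have m0 : 0 < Num.min d1 d2 by rewrite lt_min d10.
  have m1 : Num.min d1 d2 <= d1 by rewrite ge_min lexx.
  have m2 : Num.min d1 d2 <= d2 by rewrite ge_min lexx orbT.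
  by exists (Num.min d1 d2 / 3); last split; lra.
have [z1 z1x E1] := key i j h (ltW h0); have [z2 z2x E2] := key j i h (ltW h0).
have E : pderive j (pderive i f) z1 = pderive i (pderive j f) z2.
  apply: (@mulfI _ (h ^+ 2)); first by rewrite expf_neq0// gt_eqF.
  have alg (a b c e' : R) : a - b - (c - e') = a - c - (b - e') by ring.
  apply: (etrans (esym E1)); apply: (etrans _ E2).
  rewrite (congr1 f (addrAC x (h *: d j) (h *: d i))); exact: alg.
have A1 : `|pderive i (pderive j f) x - pderive i (pderive j f) z2| < e / 2.
  exact: H1 _ (le_lt_trans z2x h1).
have A2 : `|pderive j (pderive i f) x - pderive j (pderive i f) z1| < e / 2.
  exact: H2 _ (le_lt_trans z1x h2).
have -> : pderive i (pderive j f) x - pderive j (pderive i f) x =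
  (pderive i (pderive j f) x - pderive i (pderive j f) z2) -
  (pderive j (pderive i f) x - pderive j (pderive i f) z1).
  by rewrite E opprB addrA subrK.
apply: (le_trans (ler_normB _ _)); rewrite [leRHS]splitr.
exact: (lerD (ltW A1) (ltW A2)).
Qed.
End smooth_classes.

(** * Real tempered functionals *)

Section tempered.
Variables (R : realType) (N : nat).
Local Notation RN := 'rV[R]_N.
Implicit Types (f g h : RN -> R) (w : (RN -> R) -> R).

(** Peetre's inequality: the triangle inequality with the nonnegative cross term |x| |x - y|. It is
    the price of carrying a polynomial weight through a reflection or a translation. *)
Lemma peetre (x y : RN) k :
  (1 + `|y|) ^+ k <= (1 + `|x|) ^+ k * (1 + `|x - y|) ^+ k.
Proof.
rewrite -exprMn lerXn2r ?nnegrE ?mulr_ge0 ?addr_ge0//.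
have : `|y| <= `|x - y| + `|x|.
  by rewrite -{1}(subKr x y) (le_trans (ler_normB _ _))// addrC.
have : 0 <= `|x| * `|x - y| by rewrite mulr_ge0.
by move=> *; lra.
Qed.

Lemma weight_near (z y : RN) k : `|y - z| <= 1 ->
  (1 + `|z|) ^+ k <= 2 ^+ k * (1 + `|y|) ^+ k.
Proof.
move=> yz; rewrite -exprMn lerXn2r ?nnegrE ?mulr_ge0 ?addr_ge0//.
have : `|z| <= `|y| + `|y - z| by rewrite -{1}(subKr y z) ler_normB.
have := normr_ge0 y; lra.
Qed.

Lemma partial_cat s s' f : partial (s ++ s') f = partial s (partial s' f).
Proof. by elim: s => //= i s ->. Qed.

Lemma smooth_partial s f : smooth f -> smooth (partial s f).
Proof. by move=> sf s' x; rewrite -partial_cat; exact: sf. Qed.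

Lemma pderive_partial s i f : smooth f ->
  pderive i (partial s f) = partial s (pderive i f).
Proof.
move=> sf; elim: s => //= j s <-.
by rewrite -[LHS]/(pderive i (pderive j _)) clairaut//; exact: smooth_partial.
Qed.

Lemma partial_translate s f (a : RN) :
  partial s (fun z => f (z + a)) = (fun z => partial s f (z + a)).
Proof.
by elim: s => //= i s ->; apply/funext => z; rewrite derive_translate.
Qed.

Lemma partial_cstM s c f : smooth f -> partial s (cst c * f) = cst c * partial s f.
Proof. exact: partialZ. Qed.

Lemma smooth_cstM c f : smooth f -> smooth (cst c * f).
Proof. exact: smoothZ. Qed.

Lemma smooth_sum (I : Type) (r : seq I) (F : I -> RN -> R) :
  (forall i, smooth (F i)) -> smooth (\sum_(i <- r) F i).
Proof.
move=> HF; apply: (big_ind (@smooth _ _)) => //; last by move=> *; exact: smoothD.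
by have := @smooth_class_smooth _ _ _ _ (@rschwartz0 R N).
Qed.

Lemma partial_sum s (I : Type) (r : seq I) (F : I -> RN -> R) :
  (forall i, smooth (F i)) ->
  partial s (\sum_(i <- r) F i) = \sum_(i <- r) partial s (F i).
Proof.
move=> HF; elim: r => [|i r IH].
  rewrite !big_nil; elim: s => //= j s ->.
  by apply/funext => x; exact: derive_cst.
by rewrite !big_cons partialD// ?IH//; exact: smooth_sum.
Qed.

Lemma rschwartz_reflect f (x : RN) : rschwartz f -> rschwartz (fun y => f (x - y)).
Proof.
move=> Sf s; have sf := smooth_class_smooth Sf; have [df rf] := Sf s.
split=> [y|k]; first exact: smooth_reflect.
rewrite partial_reflect//; have [M HM] := rf k.
exists ((1 + `|x|) ^+ k * M) => y /=.
rewrite normrZ normrX normrN1 expr1n mul1r.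
apply: le_trans (ler_wpM2l _ (HM (x - y))); last first.
  by rewrite exprn_ge0// ltW// one_norm_gt0.
by rewrite mulrA ler_wpM2r// peetre.
Qed.

Lemma rschwartz_opp f : rschwartz f -> rschwartz (fun x => f (- x)).
Proof.
by move=> /(rschwartz_reflect 0); congr rschwartz; apply/funext => x; rewrite sub0r.
Qed.

Lemma rschwartz_translate f (a : RN) : rschwartz f -> rschwartz (fun z => f (z + a)).
Proof.
move=> Sf; have := rschwartz_reflect 0 (rschwartz_reflect a Sf).
by congr rschwartz; apply/funext => z; rewrite sub0r opprK addrC.
Qed.

(** A common bound for finitely many Schwartz seminorms, stated as a relation so that no supremum
    has to be handled. *)
Definition seminorm_le (m : seq (nat * seq 'I_N)) f (B : R) :=
  forall k s, (k, s) \in m -> forall x, (1 + `|x|) ^+ k * `|partial s f x| <= B.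

Lemma rschwartz_seminorm_le m f : rschwartz f ->
  exists B, 0 <= B /\ seminorm_le m f B.
Proof.
move=> Sf; elim: m => [|[k s] m [B [B0 HB]]]; first by exists 0.
have [_ /(_ k)[M HM]] := Sf s; exists (B + `|M|); split; first exact: addr_ge0.
move=> k' s'; rewrite inE => /orP[/eqP[-> ->] x|/HB {}HB x].
  by rewrite (le_trans (HM x))// (le_trans (ler_norm M))// lerDr.
by rewrite (le_trans (HB x))// lerDl.
Qed.

(** The functional is defined on all functions and constrained on Schwartz ones only, which avoids a
    subtype. The last field is continuity, as a bound by finitely many seminorms. *)
Record tempered w : Prop := Tempered {
  temperedD : forall f g, rschwartz f -> rschwartz g -> w (f + g) = w f + w g ;
  temperedZ : forall c f, rschwartz f -> w (cst c * f) = c * w f ;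
  tempered_bound : exists m C, 0 <= C /\ forall f B, rschwartz f -> 0 <= B ->
    seminorm_le m f B -> `|w f| <= C * B }.

Definition rconv w f (x : RN) : R := w (fun y => f (x - y)).

Section one_functional.
Variable w : (RN -> R) -> R.
Hypothesis tw : tempered w.

Lemma tempered0 : w 0 = 0.
Proof.
have -> : 0 = cst 0 * 0 :> (RN -> R) by apply/funext => x; rewrite fctE mul0r.
by rewrite temperedZ ?mul0r//; exact: rschwartz0.
Qed.

Lemma temperedB f g : rschwartz f -> rschwartz g -> w (f - g) = w f - w g.
Proof.
move=> Sf Sg; rewrite temperedD//; last exact: rschwartzN.
have -> : - g = cst (-1) * g by apply/funext => x; rewrite !fctE mulN1r.
by rewrite temperedZ// mulN1r.
Qed.

Lemma tempered_sum (I : Type) (r : seq I) (F : I -> RN -> R) :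
  (forall i, rschwartz (F i)) -> w (\sum_(i <- r) F i) = \sum_(i <- r) w (F i).
Proof.
move=> HF; elim: r => [|i r IH]; first by rewrite !big_nil tempered0.
by rewrite !big_cons temperedD// ?IH//; exact: rschwartz_sum.
Qed.

Lemma rconvD f g x : rschwartz f -> rschwartz g ->
  rconv w (f + g) x = rconv w f x + rconv w g x.
Proof. by move=> Sf Sg; rewrite -temperedD//; exact: rschwartz_reflect. Qed.

Lemma rconvB f g x : rschwartz f -> rschwartz g ->
  rconv w (f - g) x = rconv w f x - rconv w g x.
Proof. by move=> Sf Sg; rewrite -temperedB//; exact: rschwartz_reflect. Qed.

Lemma rconvZ c f x : rschwartz f -> rconv w (cst c * f) x = c * rconv w f x.
Proof. by move=> Sf; rewrite -temperedZ//; exact: rschwartz_reflect. Qed.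

Lemma rconv_sum (I : Type) (r : seq I) (F : I -> RN -> R) x :
  (forall i, rschwartz (F i)) ->
  rconv w (\sum_(i <- r) F i) x = \sum_(i <- r) rconv w (F i) x.
Proof.
move=> HF; rewrite -tempered_sum; last by move=> i; exact: rschwartz_reflect.
by congr w; apply/funext => y; rewrite !fct_sumE.
Qed.

Lemma rconv_translate f a x : rconv w (fun z => f (z + a)) x = rconv w f (x + a).
Proof. by congr w; apply/funext => y; rewrite addrAC. Qed.

(** Reflection at [x] multiplies a seminorm of weight k by at most (1 + |x|)^k, by [peetre]; [K],
    the sum of the weights occurring in [m], dominates each of them. *)
Lemma rconv_bound : exists m C K, 0 <= C /\ forall f B x, rschwartz f -> 0 <= B ->
  seminorm_le m f B -> `|rconv w f x| <= C * B * (1 + `|x|) ^+ K.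
Proof.
have [m [C [C0 H]]] := tempered_bound tw.
pose K := (\sum_(ks <- m) ks.1)%N.
exists m, C, K; split=> // f B x Sf B0 HB; rewrite -mulrA.
apply: H; first exact: rschwartz_reflect.
  by rewrite mulr_ge0// exprn_ge0// ltW// one_norm_gt0.
move=> k s ksm y; rewrite partial_reflect; last exact: smooth_class_smooth Sf.
rewrite /= normrZ normrX normrN1 expr1n mul1r.
have kK : (k <= K)%N.
  by rewrite /K (perm_big _ (perm_to_rem ksm)) big_cons leq_addr.
apply: (@le_trans _ _ ((1 + `|x|) ^+ k * ((1 + `|x - y|) ^+ k * `|partial s f (x - y)|))).
  by rewrite mulrA ler_wpM2r// peetre.
rewrite mulrC ler_pM ?mulr_ge0 ?exprn_ge0 ?addr_ge0//; first exact: HB.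
by rewrite ler_weXn2l// one_norm_ge1.
Qed.

Lemma rconv_moderate f : rschwartz f -> moderate (rconv w f).
Proof.
move=> Sf; have [m [C [K [C0 H]]]] := rconv_bound.
have [B [B0 HB]] := rschwartz_seminorm_le m Sf.
by exists K, (C * B) => x; exact: H.
Qed.

(** The second-order estimate holds in the topology of the Schwartz space, not just pointwise, so a
    continuous functional can be applied to the remainder; [rconv_diff] follows from it. *)
Lemma taylor_seminorm m f : rschwartz f -> exists B, 0 <= B /\ forall v : RN, `|v| <= 1 ->
  seminorm_le m ((fun z => f (z + v)) - f - \sum_i (cst (v 0 i) * pderive i f))
    (B * `|v| ^+ 2).
Proof.
move=> Sf; have sf := smooth_class_smooth Sf.
(* The seminorms of [m] with two more derivatives in front: these control the Taylor remainder. *)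
pose m' := [seq (ks.1, [:: ij.1, ij.2 & ks.2]) | ks <- m,
  ij <- [seq (i, j) | i <- enum 'I_N, j <- enum 'I_N]].
have [B [B0 HB]] := rschwartz_seminorm_le m' Sf.
pose Kk := (\sum_(ks <- m) ks.1)%N.
exists (2 ^+ Kk * (N%:R * (N%:R * B))); split; first by rewrite !mulr_ge0// exprn_ge0.
move=> v v1 k s ksm z.
have Sd i : smooth (cst (v 0 i) * pderive i f).
  exact/smooth_cstM/(smooth_class_smooth (smooth_class_pderive i Sf)).
have -> : partial s ((fun z0 => f (z0 + v)) - f - \sum_i (cst (v 0 i) * pderive i f)) z =
    partial s f (z + v) - partial s f z - lin_form (fun i => pderive i (partial s f) z) v.
  have -> : (fun z0 => f (z0 + v)) - f - \sum_i (cst (v 0 i) * pderive i f) =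
      (fun z0 => f (z0 + v)) + cst (-1) * f + cst (-1) * \sum_i (cst (v 0 i) * pderive i f).
    by apply/funext => y; rewrite !fctE !mulN1r.
  have s1 : smooth (fun z0 => f (z0 + v)).
    exact/smooth_class_smooth/rschwartz_translate/Sf.
  have s2 : smooth (cst (-1) * f) by exact: smooth_cstM.
  have s3 : smooth (\sum_i (cst (v 0 i) * pderive i f)) by exact: smooth_sum.
  rewrite partialD; [|exact: smoothD|exact: smooth_cstM].
  rewrite partialD// !partial_cstM// partial_translate partial_sum// !fctE !mulN1r.
  congr (_ - _); rewrite fct_sumE /lin_form; apply: eq_bigr => i _.
  rewrite partial_cstM ?pderive_partial//.
  exact: (smooth_class_smooth (smooth_class_pderive i Sf)).
have kK : (k <= Kk)%N.
  by rewrite /Kk (perm_big _ (perm_to_rem ksm)) big_cons leq_addr.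
have w0 : 0 < (1 + `|z|) ^+ k by rewrite exprn_gt0// one_norm_gt0.
rewrite -ler_pdivlMl//.
(* On the ball of radius |v| <= 1 around [z] the weights at [y] and [z] differ by a factor of at
   most 2^k, whence this local bound on second derivatives. *)
apply: le_trans (_ : N%:R * (N%:R * (2 ^+ k * B / (1 + `|z|) ^+ k)) * `|v| ^+ 2 <= _).
  apply: taylor2; first exact: smooth_partial.
  move=> i j y yz; rewrite ler_pdivlMr// mulrC.
  apply: le_trans (ler_wpM2r _ (weight_near k (le_trans yz v1))) _ => //.
  rewrite -mulrA ler_wpM2l ?exprn_ge0//.
  apply: (HB k [:: i, j & s]).
  apply/allpairsP; exists ((k, s), (i, j)); split=> //=.
  by apply/allpairsP; exists (i, j); rewrite !mem_enum.
rewrite [leRHS]mulrA ler_wpM2r ?exprn_ge0//.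
rewrite [leRHS]mulrC -!mulrA.
rewrite [leRHS](_ : _ = N%:R * (N%:R * (2 ^+ Kk * (B / (1 + `|z|) ^+ k)))); last by ring.
rewrite !ler_wpM2l// ler_wpM2r ?divr_ge0 ?exprn_ge0 ?addr_ge0//.
by rewrite ler_weXn2l// ler1n.
Qed.

Lemma rconv_diff f (x : RN) : rschwartz f ->
  differentiable (rconv w f) x /\
  forall v, 'D_v (rconv w f) x = lin_form (fun i => rconv w (pderive i f) x) v.
Proof.
move=> Sf; have [m [C [K [C0 H]]]] := rconv_bound.
have [B [B0 HB]] := taylor_seminorm m Sf.
apply: (@differentiable_quadratic _ _ _ _ _ (C * B * (1 + `|x|) ^+ K)) => v v1.
have Sp i : rschwartz (pderive i f) by exact: smooth_class_pderive.
have S1 := rschwartz_translate v Sf.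
have S3 : rschwartz (\sum_i (cst (v 0 i) * pderive i f)).
  by apply: rschwartz_sum => i _; exact: rschwartzZ.
have -> : rconv w f (x + v) - rconv w f x -
    lin_form (fun i => rconv w (pderive i f) x) v =
    rconv w ((fun z => f (z + v)) - f - \sum_i (cst (v 0 i) * pderive i f)) x.
  rewrite !rconvB//; last exact: rschwartzB.
  rewrite rconv_translate; congr (_ - _); rewrite rconv_sum; last first.
    by move=> i; exact: rschwartzZ.
  by rewrite /lin_form; apply: eq_bigr => i _; rewrite rconvZ.
apply: le_trans (H _ _ x _ _ (HB _ v1)) _.
- by apply: rschwartzB => //; exact: rschwartzB.
- by rewrite mulr_ge0// exprn_ge0.
- by rewrite mulrA mulrAC.
Qed.

Lemma rconv_pderive f i : rschwartz f ->
  pderive i (rconv w f) = rconv w (pderive i f).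
Proof.
move=> Sf; apply/funext => x.
by rewrite /pderive (rconv_diff x Sf).2 lin_form_delta.
Qed.

Lemma rconv_partial f s : rschwartz f ->
  partial s (rconv w f) = rconv w (partial s f).
Proof.
move=> Sf; elim: s => //= i s ->.
by rewrite -[LHS]/(pderive i _) rconv_pderive//; exact: smooth_class_partial.
Qed.

Lemma rconv_slow f : rschwartz f -> slow (rconv w f).
Proof.
move=> Sf s; rewrite rconv_partial//.
have Ss : rschwartz (partial s f) by exact: smooth_class_partial.
by split=> [x|]; [case: (rconv_diff x Ss)|exact: rconv_moderate].
Qed.

End one_functional.
End tempered.

(** * Integrals over tuples *)

Section lebesgue_tuple_integral.
Variable R : realType.
Local Notation mR := (measurableTypeR R).
Local Notation mu n := (lebesgue_tuple R n).
Local Notation leb := (@lebesgue_measure R).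
Local Open Scope ereal_scope.

(** The pushforward of Lebesgue measure by r -> c - r gives an interval from a to b the length of
    the one from c - b to c - a; uniqueness of Lebesgue measure identifies the two. *)
Lemma ge0_integral_reflect1 (f : R -> \bar R) (c : R) :
  measurable_fun setT f -> (forall r, 0 <= f r) ->
  \int[leb]_r f (c - r)%R = \int[leb]_r f r.
Proof.
move=> mf f0; pose phi : mR -> mR := fun r => (c - r)%R.
have mphi : @measurable_fun _ _ mR mR setT phi by exact: measurable_funB.
have E A : measurable A -> pushforward leb phi A = leb A.
  move=> mA; apply/esym/(@lebesgue_measure_unique _
    (measure_function_pushforward__canonical__measure_function_Measure
     leb mphi)) => //= _ [[a b]] _ <-.
  rewrite /pushforward (_ : phi @^-1` _ = `[c - b, c - a[%classic)%R.
    rewrite !lebesgue_measure_itv/= !lte_fin ltrD2l ltrN2; case: ifP => // _.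
    by rewrite -!EFinB; congr (_%:E); ring.
  apply/seteqP; split => r /=; rewrite !in_itv/= /phi => /andP[h1 h2]; lra.
have -> : \int[leb]_r f (c - r)%R =
    \int[pushforward leb phi]_r f r.
  have H := @ge0_integral_pushforward _ _ mR mR R phi mphi leb setT f measurableT mf
    (fun y _ => f0 y).
  by rewrite preimage_setT in H; exact/esym/H.
by apply: eq_measure_integral => A mA _; exact: E.
Qed.

Lemma ge0_integral_tupleS n (f : n.+1.-tuple mR -> \bar R) :
  measurable_fun setT f -> (forall t, 0 <= f t) ->
  \int[mu n.+1]_t f t =
  \int[leb]_x \int[mu n]_t f [tuple of x :: t].
Proof.
move=> mf f0.
have -> : \int[mu n.+1]_t f t =
    \int[(leb \x mu n)]_z (f \o @cons_pair R n) z.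
  rewrite -[LHS]/(\int[pushforward (leb \x mu n) (@cons_pair R n)]_t f t).
  have H := @ge0_integral_pushforward _ _ _ _ R _ (@measurable_cons_pair R n)
    (leb \x mu n) setT f measurableT mf (fun y _ => f0 y).
  by rewrite preimage_setT in H; exact: H.
rewrite fubini_tonelli1//; last by move=> z; exact: f0.
by apply: measurableT_comp => //; exact: measurable_cons_pair.
Qed.

Lemma measurable_tuple_cons n (f : n.+1.-tuple mR -> \bar R) x :
  measurable_fun setT f -> measurable_fun setT (fun t : n.-tuple mR => f [tuple of x :: t]).
Proof.
move=> mf; apply: (@measurableT_comp _ _ _ _ _ _ f) => //.
by apply: measurable_cons => //; exact: measurable_cst.
Qed.

Definition tuple_reflect n (s t : n.-tuple mR) : n.-tuple mR :=
  [tuple (tnth s i - tnth t i)%R | i < n].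

Lemma measurable_tuple_reflect n (s : n.-tuple mR) :
  measurable_fun setT (tuple_reflect s).
Proof.
apply/measurable_fun_tnthP => i.
rewrite (_ : _ \o _ = fun t => (tnth s i - tnth t i)%R).
  by apply: measurable_funB => //; exact: measurable_tnth.
by apply/funext => t /=; rewrite tnth_mktuple.
Qed.

Lemma ge0_integral_reflect n (f : n.-tuple mR -> \bar R) s :
  measurable_fun setT f -> (forall t, 0 <= f t) ->
  \int[mu n]_t f (tuple_reflect s t) = \int[mu n]_t f t.
Proof.
elim: n f s => [|n IH] f s mf f0.
  by apply: eq_integral => t _; congr f; rewrite [LHS]tuple0 [RHS]tuple0.
have mfr : measurable_fun setT (fun t => f (tuple_reflect s t)).
  by apply: measurableT_comp => //; exact: measurable_tuple_reflect.
rewrite (ge0_integral_tupleS mfr (fun t => f0 _)) (ge0_integral_tupleS mf f0).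
have E x (t : n.-tuple mR) : tuple_reflect s [tuple of x :: t] =
    [tuple of (thead s - x)%R :: tuple_reflect [tuple of behead s] t].
  apply: eq_from_tnth => i; rewrite tnth_mktuple.
  case: (unliftP ord0 i) => [j ->|->]; last by rewrite !tnth0.
  by rewrite !tnthS tnth_mktuple; congr (_ - _)%R; rewrite [in LHS](tuple_eta s) tnthS.
under eq_integral => x _.
  under eq_integral do rewrite E.
  rewrite (IH (fun t => f [tuple of (thead s - x)%R :: t])) //; last first.
    exact: measurable_tuple_cons.
  over.
rewrite /= (@ge0_integral_reflect1 (fun x => \int[mu n]_t f [tuple of x :: t])) //.
  pose g := f \o @cons_pair R n.
  have mg : measurable_fun setT g.
    by apply: measurableT_comp => //; exact: measurable_cons_pair.
  by apply: (@measurable_fun_fubini_tonelli_F _ _ _ _ _ _ _ mg) => z; exact: f0.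
by move=> r; exact: integral_ge0.
Qed.

Lemma integral_oneDsqr_fin :
  \int[leb]_x ((1 + x ^+ 2)^-1)%:E < +oo.
Proof.
rewrite (@ge0_symfun_integralT _ (fun x : R => (1 + x ^+ 2)^-1)%R).
- rewrite -set_itvcy (integral0y_oneDsqr R) -EFinM ltry//.
- by move=> x; rewrite invr_ge0 addr_ge0// sqr_ge0.
- exact: continuous_oneDsqrV.
- by move=> x /=; rewrite sqrrN.
Qed.

Lemma integral_prod_oneDsqr_fin n :
  \int[mu n]_t (\prod_(i < n) (1 + (tnth t i) ^+ 2)^-1)%:E < +oo.
Proof.
have m1 : measurable_fun [set: R] (fun x : R => (1 + x ^+ 2)^-1)%R.
  by apply: continuous_measurable_fun; exact: continuous_oneDsqrV.
have p0 m (t : m.-tuple mR) : (0 <= \prod_(i < m) (1 + (tnth t i) ^+ 2)^-1 :> R)%R.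
  by apply: prodr_ge0 => i _; rewrite invr_ge0 addr_ge0// sqr_ge0.
have mp m : measurable_fun setT (fun t : m.-tuple mR =>
    (\prod_(i < m) (1 + (tnth t i) ^+ 2)^-1)%:E).
  apply/measurable_EFinP; apply: measurable_prod => i _.
  by apply: (measurableT_comp m1); exact: measurable_tnth.
elim: n => [|n IH].
  rewrite integral_dirac//; last exact: mp.
  rewrite [X in (X * _)%E](_ : _ = 1); last exact: diracT.
  by rewrite mul1e ltry.
rewrite ge0_integral_tupleS//; last by move=> t; rewrite lee_fin.
set J := \int[mu n]_t _ in IH.
have q0 (x : R) : (0 <= (1 + x ^+ 2)^-1)%R by rewrite invr_ge0 addr_ge0// sqr_ge0.
have E (x : R) : \int[mu n]_t (\prod_(i < n.+1)
    (1 + tnth [tuple of x :: t] i ^+ 2)^-1)%:E = ((1 + x ^+ 2)^-1)%:E * J.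
  rewrite -ge0_integralZl//; [|exact: mp|by move=> t _; rewrite lee_fin p0|by rewrite lee_fin].
  apply: eq_integral => t _; rewrite big_ord_recl tnth0 -EFinM.
  by congr (_ * _)%:E; apply: eq_bigr => i _; rewrite tnthS.
under eq_integral do rewrite E.
have J0 : 0 <= J by apply: integral_ge0 => t _; rewrite lee_fin.
rewrite ge0_integralZr//; [|exact/measurable_EFinP|by move=> x _; rewrite lee_fin].
rewrite lte_mul_pinfty//.
- by apply: integral_ge0 => x _; rewrite lee_fin.
- rewrite ge0_fin_numE ?integral_oneDsqr_fin//.
  by apply: integral_ge0 => x _; rewrite lee_fin.
Qed.

End lebesgue_tuple_integral.

(** * Grids and weights *)

Section integration.
Variables (R : realType) (N : nat).
Local Notation mR := (measurableTypeR R).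
Local Notation T := (N.-tuple mR).
Local Notation mu := (lebesgue_tuple R N).
Local Notation RN := 'rV[R]_N.
Implicit Types (f g h : RN -> R).

Definition rV_of_tuple (t : T) : RN := \row_i tnth t i.
Local Notation rw := rV_of_tuple.

Section grid.
Variable n : nat.

(** Cells of side 1/(n+1) tiling the cube with sides [-(n+1), n+1): there are 2 (n+1)^2 of them
    along each axis. *)
Definition grid := {ffun 'I_N -> 'I_((n.+1 * n.+1).*2)}.

Definition grid_point (j : grid) : RN :=
  \row_i ((j i)%:R / n.+1%:R - n.+1%:R).

Definition grid_cell (j : grid) : set T :=
  [set t | forall i, (j i)%:R <= (tnth t i + n.+1%:R) * n.+1%:R < (j i).+1%:R].

Lemma measurable_grid_cell j : measurable (grid_cell j).
Proof.
rewrite (_ : grid_cell j = \bigcap_(i in [set: 'I_N])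
    ((fun t : T => (tnth t i + n.+1%:R) * n.+1%:R) @^-1` `[(j i)%:R, (j i).+1%:R[)).
  apply: fin_bigcap_measurable => // i _.
  rewrite -[X in measurable X]setTI.
  have m : measurable_fun [set: T] (fun t : T => (tnth t i + n.+1%:R) * n.+1%:R : R).
    apply: measurable_funM => //; apply: measurable_funD => //.
    exact: measurable_tnth.
  by apply: m => //; exact: measurable_itv.
apply/seteqP; split => t /= H i; first by move=> _ /=; rewrite in_itv; exact: H.
by have /= := H i Logic.I; rewrite in_itv.
Qed.

Definition step f (t : T) : R :=
  \sum_(j : grid) f (grid_point j) * \1_(grid_cell j) t.

Lemma measurable_step f : measurable_fun [set: T] (step f).
Proof.
apply: measurable_sum => j; apply: measurable_funM => //.
by apply: measurable_indic; exact: measurable_grid_cell.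
Qed.

(** Inside the cube [step] evaluates at a nearby grid point, the same one for every [f]; outside it
    vanishes, and then |t| is large. All estimates on step functions go through this dichotomy. *)
Lemma stepP t :
  (exists2 x, `|rw t - x| <= n.+1%:R^-1 & forall f, step f t = f x) \/
  (n%:R <= `|rw t| /\ forall f, step f t = 0).
Proof.
pose a i : R := (tnth t i + n.+1%:R) * n.+1%:R.
have n0 : 0 < n.+1%:R :> R by [].
have [box|] := pselect (forall i, 0 <= a i < ((n.+1 * n.+1).*2)%:R); last first.
  move=> /existsNP[i Hi]; right; split.
    have : n.+1%:R <= `|rw t 0 i|.
      rewrite mxE leNgt; apply/negP => ti; apply: Hi; rewrite /a.
      have /andP[h1 h2] : - n.+1%:R < tnth t i < n.+1%:R by rewrite -ltr_norml.
      apply/andP; split; first by rewrite mulr_ge0// addrC -(opprK (tnth t i)) subr_ge0 lerNl ltW.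
      rewrite -addnn natrD natrM -mulrDl ltr_pM2r// ltrD2r//.
    move=> h; rewrite (le_trans _ (ler_coord_norm _ i))//.
    by rewrite (le_trans _ h)// ler_nat.
  move=> f; apply: big1 => j _; rewrite indicE memNset ?mulr0// => /(_ i) jt.
  apply: Hi; rewrite -/(a i) in jt; case/andP: jt => j1 j2.
  rewrite (le_trans _ j1)//= (lt_le_trans j2)// ler_nat.
  exact: ltn_ord.
have ub i : (Num.truncn (a i) < (n.+1 * n.+1).*2)%N.
  have /andP[a0 aK] := box i.
  by rewrite -(ltr_nat R) (le_lt_trans _ aK)// truncn_le.
(* The cell of [t]: integer parts of the rescaled coordinates. *)
pose j : grid := [ffun i => Ordinal (ub i)].
left; exists (grid_point j).
  rewrite [leLHS]mx_normrE; apply/bigmax_leP; split => [|[z i] _ /=].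
    by rewrite invr_ge0.
  rewrite !mxE ffunE /=; have /andP[a0 aK] := box i.
  have := truncn_itv a0.
  have -> : tnth t i - ((Num.truncn (a i))%:R / n.+1%:R - n.+1%:R) =
      (a i - (Num.truncn (a i))%:R) / n.+1%:R.
    by rewrite /a; field; rewrite gt_eqF.
  move=> /andP[h1 h2]; rewrite normrM ger0_norm ?subr_ge0//.
  rewrite (ger0_norm (_ : 0 <= n.+1%:R^-1)) ?invr_ge0// ler_piMl ?invr_ge0//.
  by move: h2; rewrite -natr1 => h2; lra.
move=> f; rewrite /step (bigD1 j)//= big1 ?addr0 => [|j' jj'].
  rewrite indicE mem_set ?mulr1// => i.
  have /andP[a0 aK] := box i.
  by rewrite ffunE /=; exact: truncn_itv.
rewrite indicE memNset ?mulr0// => H; move/eqP: jj'; apply.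
apply/ffunP => i; apply/val_inj; rewrite ffunE /=.
have := H i; rewrite -/(a i) => /andP[h1 h2].
by apply/esym/eqP; rewrite (truncn_eq _ (le_trans _ h1))// h1.
Qed.
End grid.

Lemma step_cvg f t : {for rw t, continuous f} -> step n f t @[n --> \oo] --> f (rw t).
Proof.
move=> cf; apply/cvgrPdist_lt => e e0.
have [d d0 Hd] := continuous_ball cf e0.
near=> n.
have [[x tx ->]|[nt _]] := stepP n t.
  apply: Hd; rewrite distrC (le_lt_trans tx)//.
  near: n; exact: near_infty_natSinv_lt (PosNum d0).
exfalso; move: nt; rewrite leNgt => /negP; apply.
near: n; exact: nbhs_infty_gtr.
Unshelve. all: by end_near. Qed.

(** The topology lives on row vectors and the product sigma-algebra on tuples; step functions
    connect them, being measurable by construction and convergent by continuity. *)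
Lemma measurable_continuous_rV f : continuous f -> measurable_fun [set: T] (f \o rw).
Proof.
move=> cf; apply: (measurable_fun_cvg (fun n => measurable_step n f)) => t _.
exact: (@step_cvg f t (cf (rw t))).
Qed.

(** One integrable majorant, up to constants, of all rapidly decreasing functions: its integral
    factors into one-dimensional ones, and it is at least (1 + |x|)^(-2N). *)
Definition weight (x : RN) : R := \prod_(i < N) (1 + (x 0 i) ^+ 2)^-1.

Lemma weight_ge0 x : 0 <= weight x.
Proof. by apply: prodr_ge0 => i _; rewrite invr_ge0 addr_ge0// sqr_ge0. Qed.

Lemma weight_ge1 x : 1 <= (1 + `|x|) ^+ (2 * N) * weight x.
Proof.
rewrite exprM -[X in _ ^+ X]card_ord -prodr_const -big_split/=.
apply: (big_ind (fun y => 1 <= y)) => // [a b a1 b1|i _]; first exact: mulr_ege1.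
have h : 0 < 1 + (x 0 i) ^+ 2 by rewrite ltr_pwDl// sqr_ge0.
rewrite ler_pdivlMr// mul1r sqrrD expr1n mul1r.
have := ler_coord_norm x i; rewrite -(ler_pXn2r (_ : 0 < 2)%N) ?nnegrE//.
rewrite real_normK ?num_real//; have := normr_ge0 x; lra.
Qed.

Lemma integral_weight : (\int[mu]_t (weight (rw t))%:E < +oo)%E.
Proof.
rewrite (_ : (fun t => _) = (fun t => (\prod_(i < N) (1 + (tnth t i) ^+ 2)^-1)%:E)).
  exact: integral_prod_oneDsqr_fin.
by apply/funext => t; congr (_%:E); apply: eq_bigr => i _; rewrite mxE.
Qed.

Lemma integrable_weight : mu.-integrable setT (EFin \o weight \o rw).
Proof.
apply/integrableP; split.
  apply/measurable_EFinP; apply: measurable_prod => i _.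
  rewrite (_ : (fun t => _) = (fun x : R => (1 + x ^+ 2)^-1) \o (fun t : T => tnth t i)).
    apply: measurableT_comp; last exact: measurable_tnth.
    by apply: continuous_measurable_fun; exact: continuous_oneDsqrV.
  by apply/funext => t /=; rewrite mxE.
rewrite (eq_integral (fun t => (weight (rw t))%:E)) ?integral_weight// => t _ /=.
by rewrite ger0_norm// weight_ge0.
Qed.

Lemma rapid_le_weight f : rapid f -> exists M, 0 <= M /\ forall x, `|f x| <= M * weight x.
Proof.
move=> /(_ (2 * N)%N)[M HM]; exists `|M|; split=> // x.
rewrite (le_trans _ (ler_wpM2r (weight_ge0 x) (ler_norm M)))//.
rewrite (le_trans _ (ler_wpM2r (weight_ge0 x) (HM x)))//.
by rewrite mulrAC ler_peMl// weight_ge1.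
Qed.

Lemma integrable_le_weight (F : T -> R) M : measurable_fun setT F ->
  (forall t, `|F t| <= M * weight (rw t)) -> mu.-integrable setT (EFin \o F).
Proof.
move=> mF HM.
apply: (@le_integrable _ _ _ mu setT _ _ (fun t => (M * weight (rw t))%:E)) => //.
- exact/measurable_EFinP.
- by move=> t _ /=; rewrite lee_fin (le_trans (HM t))// ler_norm.
- apply: (eq_integrable _ (fun t => M%:E * (weight (rw t))%:E)%E) => //.
  apply: integrableZl => //; exact: integrable_weight.
Qed.

Lemma smooth_class_continuous (B : (RN -> R) -> Prop) f : smooth_class B f -> continuous f.
Proof. by move=> Bf x; exact/differentiable_continuous/(smooth_class_diff x Bf). Qed.

Lemma rV_of_tuple_reflect (y : RN) (t : T) :
  rw (tuple_reflect [tuple y 0 i | i < N] t) = y - rw t.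
Proof. by apply/rowP => i; rewrite !mxE !tnth_mktuple. Qed.

Lemma integral_reflect (f : RN -> R) y : continuous f ->
  (\int[mu]_t f (y - rw t) = \int[mu]_t f (rw t))%R.
Proof.
move=> cf; rewrite /Rintegral; congr fine.
pose F (t : T) := (f (rw t))%:E.
have mF : measurable_fun setT F by apply/measurable_EFinP; exact: (measurable_continuous_rV cf).
pose s : T := [tuple y 0 i | i < N].
have -> : (\int[mu]_t (f (y - rw t))%:E)%E =
    (\int[mu]_t F (tuple_reflect s t))%E.
  by apply: eq_integral => t _; rewrite /F /s rV_of_tuple_reflect.
rewrite -[RHS]/(\int[mu]_t F t)%E [LHS]integralE [RHS]integralE.
congr (_ - _)%E.
- rewrite -(@ge0_integral_reflect _ _ (F^\+)%E s)//.
    by apply: eq_integral => t _; rewrite !funeposE.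
  exact: measurable_funepos.
- rewrite -(@ge0_integral_reflect _ _ (F^\-)%E s)//.
    by apply: eq_integral => t _; rewrite !funenegE.
  exact: measurable_funeneg.
Qed.

End integration.

(** * Functionals commute with convolution integrals *)

Section exchange.
Variables (R : realType) (N : nat).
Local Notation mR := (measurableTypeR R).
Local Notation T := (N.-tuple mR).
Local Notation mu := (lebesgue_tuple R N).
Local Notation RN := 'rV[R]_N.
Local Notation rw := (@rV_of_tuple R N).
Local Notation weight := (@weight R N).
Implicit Types (f g h : RN -> R) (F G : T -> R).

Definition rint F : R := \int[mu]_t F t.

(** Stronger than integrability; the explicit majorant is what dominated convergence and the
    weighted estimates use. *)
Definition dominated F :=
  measurable_fun setT F /\ exists M, forall t, `|F t| <= M * weight (rw t).

Lemma dominated_integrable F : dominated F -> mu.-integrable setT (EFin \o F).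
Proof. by move=> [mF [M HM]]; exact: integrable_le_weight HM. Qed.

Lemma rintD F G : dominated F -> dominated G -> rint (fun t => F t + G t) = rint F + rint G.
Proof. by move=> /dominated_integrable iF /dominated_integrable iG; exact: RintegralD. Qed.

Lemma rintB F G : dominated F -> dominated G -> rint (fun t => F t - G t) = rint F - rint G.
Proof. by move=> /dominated_integrable iF /dominated_integrable iG; exact: RintegralB. Qed.

Lemma rintZ F c : dominated F -> rint (fun t => c * F t) = c * rint F.
Proof. by move=> /dominated_integrable iF; exact: RintegralZl. Qed.

Lemma dominatedD F G : dominated F -> dominated G -> dominated (fun t => F t + G t).
Proof.
move=> [mF [M HM]] [mG [M' HM']]; split; first exact: measurable_funD.
exists (M + M') => t; rewrite mulrDl (le_trans (ler_normD _ _))// lerD//.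
Qed.

Lemma dominatedZ F c : dominated F -> dominated (fun t => c * F t).
Proof.
move=> [mF [M HM]]; split; first exact: measurable_funM.
by exists (`|c| * M) => t; rewrite normrM -mulrA ler_wpM2l.
Qed.

Lemma dominated0 : dominated (fun=> 0).
Proof. by split=> //; exists 0 => t; rewrite mul0r normr0. Qed.

Lemma rint_sum (I : Type) (r : seq I) (F : I -> T -> R) : (forall i, dominated (F i)) ->
  rint (fun t => \sum_(i <- r) F i t) = \sum_(i <- r) rint (F i).
Proof.
move=> dF.
suff : dominated (fun t => \sum_(i <- r) F i t) /\
    rint (fun t => \sum_(i <- r) F i t) = \sum_(i <- r) rint (F i) by case.
elim: r => [|i r [d IH]].
  rewrite big_nil (_ : (fun t => _) = (fun=> 0)).
    by split; [exact: dominated0|rewrite /rint /Rintegral integral0].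
  by apply/funext => t; rewrite big_nil.
rewrite (_ : (fun t => _) = (fun t => F i t + \sum_(j <- r) F j t)); last first.
  by apply/funext => t; rewrite big_cons.
by split; [exact: dominatedD|rewrite big_cons rintD// IH].
Qed.

Definition total_weight : R := rint (weight \o rw).

Lemma dominated_weight : dominated (weight \o rw).
Proof.
split; last by exists 1 => t; rewrite mul1r ger0_norm// weight_ge0.
by have /measurable_int/measurable_EFinP := @integrable_weight R N.
Qed.

Lemma total_weight_ge0 : 0 <= total_weight.
Proof. by apply: Rintegral_ge0 => t _; exact: weight_ge0. Qed.

Lemma rint_le F G : dominated F -> dominated G -> (forall t, F t <= G t) -> rint F <= rint G.
Proof.
by move=> /dominated_integrable iF /dominated_integrable iG FG; exact: le_Rintegral.
Qed.

Lemma rint_bound F M : measurable_fun setT F -> (forall t, `|F t| <= M * weight (rw t)) ->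
  `|rint F| <= M * total_weight.
Proof.
move=> mF HM; have dF : dominated F by split=> //; exists M.
rewrite ler_norml /total_weight -mulNr -!rintZ; try exact: dominated_weight.
apply/andP; split; apply: rint_le => //; try (exact/dominatedZ/dominated_weight).
  by move=> t /=; rewrite mulNr lerNl (le_trans _ (HM t))// -normrN ler_norm.
by move=> t; rewrite (le_trans (ler_norm _))//; exact: HM.
Qed.

Lemma rint_cvg (F_ : nat -> T -> R) F M : (forall n, measurable_fun setT (F_ n)) ->
  measurable_fun setT F -> (forall t, F_ n t @[n --> \oo] --> F t) ->
  (forall n t, `|F_ n t| <= M * weight (rw t)) ->
  rint (F_ n) @[n --> \oo] --> rint F.
Proof.
move=> mF_ mF cF HM.
have mEF n : measurable_fun setT (EFin \o F_ n) by exact/measurable_EFinP.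
have mE : measurable_fun setT (EFin \o F) by exact/measurable_EFinP.
have cE t : (EFin \o F_ ^~ t) @ \oo --> (EFin \o F) t.
  by apply: cvg_EFin; [exact: nearW|exact: cF].
have [iF _ H] := dominated_convergence (mu := mu) measurableT
  (f_ := fun n => EFin \o F_ n) mEF mE
  (g := EFin \o (fun t => M * weight (rw t)))
  (aeW _ (fun t _ => cE t))
  (dominated_integrable (dominatedZ M dominated_weight))
  (aeW _ (fun t n _ => HM n t)).
by apply: fine_cvg; rewrite fineK; [exact: H|exact: integrable_fin_num].
Qed.

Lemma rapid_weight k f : rapid f ->
  exists M, 0 <= M /\ forall x, (1 + `|x|) ^+ k * `|f x| <= M * weight x.
Proof.
move=> /(_ (2 * N + k)%N)[M HM]; exists `|M|; split=> // x.
rewrite (le_trans _ (ler_wpM2r (weight_ge0 x) (ler_norm M)))//.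
rewrite (le_trans _ (ler_wpM2r (weight_ge0 x) (HM x)))//.
rewrite exprD -mulrA mulrAC ler_peMl ?weight_ge1// mulr_ge0// exprn_ge0//.
Qed.

Lemma rschwartz_dominated f : rschwartz f -> dominated (f \o rw).
Proof.
move=> Sf; split; first exact: (measurable_continuous_rV (smooth_class_continuous Sf)).
have [M [_ HM]] := rapid_le_weight (smooth_class_bound Sf).
by exists M => t; exact: HM.
Qed.

Definition pairing g f : R := rint ((f * g) \o rw).

Lemma tempered_pairing g : rschwartz g -> tempered (pairing g).
Proof.
move=> Sg.
have SM f : rschwartz f -> rschwartz (f * g).
  by move=> Sf; apply: rschwartzM => //; exact: rschwartz_slow.
split=> [f h Sf Sh|c f Sf|].
- rewrite /pairing -rintD; try exact/rschwartz_dominated/SM.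
  by congr rint; apply/funext => t; rewrite /= !fctE mulrDl.
- rewrite /pairing -rintZ; last exact/rschwartz_dominated/SM.
  by congr rint; apply/funext => t; rewrite /= !fctE mulrA.
have [M [M0 HM]] := rapid_le_weight (smooth_class_bound Sg).
exists [:: (0%N, [::])], (M * total_weight); split.
  by rewrite mulr_ge0 ?total_weight_ge0.
move=> f B Sf B0 HB; rewrite mulrC mulrA; apply: rint_bound.
  exact: (rschwartz_dominated (SM f Sf)).1.
move=> t; rewrite /= !fctE normrM -mulrA ler_pM//.
by have := HB 0%N [::] (mem_head _ _) (rw t); rewrite expr0 mul1r.
Qed.

(** Ordinary convolution, written as convolution with the functional of integration against [g]: its
    smoothness and derivatives then come from [rconv_diff] and [rconv_partial], and only the rapid
    decay needs a separate argument. *)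
Definition convol phi g : RN -> R := rconv (pairing g) phi.

Lemma convolE phi g y : convol phi g y = rint (fun t => phi (y - rw t) * g (rw t)).
Proof. by []. Qed.

Lemma measurable_schwartz_reflect phi y : rschwartz phi ->
  measurable_fun setT (fun t : T => phi (y - rw t)).
Proof.
move=> Sp; have := measurable_continuous_rV
  (smooth_class_continuous (rschwartz_reflect y Sp)); exact.
Qed.

Lemma measurable_schwartz phi : rschwartz phi -> measurable_fun setT (phi \o rw).
Proof. by move=> Sp; exact: (measurable_continuous_rV (smooth_class_continuous Sp)). Qed.

Lemma peetre_reflect (x y : RN) k :
  (1 + `|y|) ^+ k <= (1 + `|x|) ^+ k * (1 + `|y - x|) ^+ k.
Proof. by rewrite distrC peetre. Qed.

Lemma weighted_integral_le k (y : RN) F M : 0 <= M -> measurable_fun setT F ->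
  (forall t, (1 + `|y|) ^+ k * `|F t| <= M * weight (rw t)) ->
  (1 + `|y|) ^+ k * `|rint F| <= M * total_weight.
Proof.
move=> M0 mF HM.
have w0 : 0 < (1 + `|y|) ^+ k by rewrite exprn_gt0// one_norm_gt0.
rewrite -ler_pdivlMl// mulrA; apply: rint_bound => // t.
by rewrite -mulrA ler_pdivlMl.
Qed.

Lemma rapid_convol phi g : rschwartz phi -> rschwartz g -> rapid (convol phi g).
Proof.
move=> Sp Sg k; have [M HM] := smooth_class_bound Sp k.
have [M' [M'0 HM']] := rapid_weight k (smooth_class_bound Sg).
exists (`|M| * M' * total_weight) => y; rewrite convolE.
apply: weighted_integral_le; first exact: mulr_ge0.
  apply: measurable_funM; [exact: measurable_schwartz_reflect|exact: measurable_schwartz].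
move=> t; rewrite normrM mulrA.
apply: (@le_trans _ _ (((1 + `|y - rw t|) ^+ k * `|phi (y - rw t)|) *
  ((1 + `|rw t|) ^+ k * `|g (rw t)|))).
  rewrite mulrACA [leRHS]mulrA; apply: ler_wpM2r => //; apply: ler_wpM2r => //.
  by rewrite [leRHS]mulrC peetre_reflect.
have e0 z : 0 <= (1 + `|z : RN|) ^+ k by rewrite exprn_ge0// addr_ge0.
rewrite -[leRHS]mulrA; apply: ler_pM; [exact: mulr_ge0|exact: mulr_ge0| |exact: HM'].
by rewrite (le_trans (HM _))// ler_norm.
Qed.

Lemma rschwartz_convol phi g : rschwartz phi -> rschwartz g -> rschwartz (convol phi g).
Proof.
move=> Sp Sg s; have tg := tempered_pairing Sg.
have Ss : rschwartz (partial s phi) by exact: smooth_class_partial.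
rewrite /convol (rconv_partial tg)//; split => [x|]; last exact: rapid_convol.
by case: (rconv_diff tg x Ss).
Qed.

Lemma convolC phi g : rschwartz phi -> rschwartz g -> convol phi g = convol g phi.
Proof.
move=> Sp Sg; apply/funext => y; rewrite !convolE.
pose h x := phi (y - x) * g x.
have ch : continuous h.
  apply: (@smooth_class_continuous _ _ (@rapid R N)).
  apply: (@rschwartzM _ _ (fun x => phi (y - x)) g); last exact: rschwartz_slow.
  exact: rschwartz_reflect.
rewrite -[LHS](integral_reflect y ch); congr rint; apply/funext => t.
by rewrite /h subKr mulrC.
Qed.

(** * Riemann sums of a convolution *)

Section riemann.
Variables (phi g : RN -> R).
Hypotheses (Sp : rschwartz phi) (Sg : rschwartz g).

Let cell_mass n (j : grid N n) : R := rint (fun t => \1_(grid_cell j) t * g (rw t)).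

(** A hybrid Riemann sum of the integral of phi(y - x) g(x) in x: [phi] is sampled at grid points
    while [g] is integrated exactly over each cell, so the error involves the variation of [phi]
    only. In [y] it is a finite combination of translates of [phi], on which a functional acts by
    linearity. *)
Let approx n : RN -> R :=
  \sum_(j : grid N n) cst (cell_mass j) * (fun y => phi (y - grid_point R j)).

Lemma dominated_cell n (j : grid N n) :
  dominated (fun t => \1_(grid_cell j) t * g (rw t)).
Proof.
have [M [M0 HM]] := rapid_le_weight (smooth_class_bound Sg).
split.
  apply: measurable_funM; last exact: measurable_schwartz.
  by apply: measurable_indic; exact: measurable_grid_cell.
exists M => t; rewrite normrM (le_trans _ (HM (rw t)))//.
by rewrite ler_piMl// indicE; case: (_ \in _); rewrite ?normr1 ?normr0.
Qed.

Lemma rint_step n h : rint (fun t => step n h t * g (rw t)) =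
  \sum_(j : grid N n) h (grid_point R j) * cell_mass j.
Proof.
rewrite (_ : (fun t => _) = (fun t => \sum_(j : grid N n)
    h (grid_point R j) * (\1_(grid_cell j) t * g (rw t)))).
  rewrite rint_sum; last by move=> j; exact/dominatedZ/dominated_cell.
  by apply: eq_bigr => j _; rewrite rintZ//; exact: dominated_cell.
apply/funext => t; rewrite /step mulr_suml; apply: eq_bigr => j _.
by rewrite mulrA.
Qed.

Lemma partial_approx n s y :
  partial s (approx n) y = rint (fun t => step n (fun x => partial s phi (y - x)) t * g (rw t)).
Proof.
rewrite rint_step /approx partial_sum => [|j]; last first.
  exact/smooth_cstM/smooth_class_smooth/rschwartz_translate/Sp.
rewrite fct_sumE; apply: eq_bigr => j _.
rewrite partial_cstM; last exact/smooth_class_smooth/rschwartz_translate/Sp.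
by rewrite partial_translate !fctE mulrC.
Qed.

Lemma rschwartz_approx n : rschwartz (approx n).
Proof.
by apply: rschwartz_sum => j _; apply: rschwartzZ; exact: rschwartz_translate.
Qed.

(** Within the cube the sampling point is at distance at most 1/(n+1) and the Lipschitz bound gives
    the rate. Outside, the step function is zero but 1 + |t| >= n + 1, so one more power of 1 + |t|
    pays for the factor 1/(n+1). The rapid decay of [g] later absorbs the weight. *)
Lemma step_error k s : exists A, 0 <= A /\ forall n (y : RN) t,
  (1 + `|y|) ^+ k *
    `|step n (fun x => partial s phi (y - x)) t - partial s phi (y - rw t)| <=
  A / n.+1%:R * (1 + `|rw t|) ^+ k.+1.
Proof.
pose psi := partial s phi.
have [B [B0 HB]] := rschwartz_seminorm_le
  ((k, s) :: [seq (k, i :: s) | i <- enum 'I_N]) Sp.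
have HB0 z : (1 + `|z|) ^+ k * `|psi z| <= B by apply: HB; exact: mem_head.
have HB1 i z : (1 + `|z|) ^+ k * `|pderive i psi z| <= B.
  apply: (HB k (i :: s)); rewrite inE; apply/orP; right.
  by apply/mapP; exists i; rewrite ?mem_enum.
have e0 (z : RN) : 0 < (1 + `|z|) ^+ k by rewrite exprn_gt0// one_norm_gt0.
exists (N%:R * (2 ^+ k * B) + B); split.
  by rewrite addr_ge0// !mulr_ge0// exprn_ge0.
move=> n y t; have n0 : 0 < n.+1%:R :> R by [].
have C0 : 0 <= N%:R * (2 ^+ k * B) by rewrite !mulr_ge0// exprn_ge0.
have [[p tp ->]|[nt ->]] := stepP n t; last first.
  rewrite sub0r normrN -/psi.
  apply: (@le_trans _ _ (B * (1 + `|rw t|) ^+ k)).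
    apply: (@le_trans _ _ ((1 + `|rw t|) ^+ k * ((1 + `|y - rw t|) ^+ k * `|psi (y - rw t)|))).
      by rewrite [leRHS]mulrA ler_wpM2r// peetre_reflect.
    by rewrite mulrC ler_wpM2r ?HB0// ltW.
  rewrite exprS [leRHS]mulrA; apply: ler_wpM2r; first exact/ltW/e0.
  rewrite -[leRHS]mulrA [X in _ <= _ * X]mulrC.
  apply: (@le_trans _ _ (N%:R * (2 ^+ k * B) + B)); first by rewrite lerDr.
  rewrite ler_peMr ?addr_ge0// ler_pdivlMr// mul1r -natr1 addrC.
  by rewrite lerD2l.
have v1 : `|rw t - p| <= 1 by rewrite (le_trans tp)// invf_le1// ler1n.
have -> : y - p = y - rw t + (rw t - p) by rewrite addrA subrK.
set v := rw t - p in tp v1 *.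
(* Bound for the first derivatives on the unit ball around y - t: [peetre_reflect] moves the weight
   from [y] to y - t, [weight_near] from there to the nearby point. *)
pose M := 2 ^+ k * B * (1 + `|rw t|) ^+ k / (1 + `|y|) ^+ k.
have dpsi z : differentiable psi z by case: (Sp s).
have L : `|psi (y - rw t + v) - psi (y - rw t)| <= N%:R * M * `|v|.
  apply: lipschitz_of_pderive => // i z zv.
  rewrite /M ler_pdivlMr ?e0// mulrC.
  apply: (@le_trans _ _ ((1 + `|rw t|) ^+ k * (2 ^+ k * (1 + `|z|) ^+ k) *
      `|pderive i psi z|)).
    apply: ler_wpM2r => //; apply: (le_trans (peetre_reflect (rw t) y k)).
    apply: ler_wpM2l; first exact/ltW/e0.
    by apply: weight_near; exact: le_trans v1.
  have alg (a b c d : R) : a * (b * c) * d = b * (c * d) * a by ring.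
  rewrite alg; apply: ler_wpM2r; first exact/ltW/e0.
  by rewrite ler_wpM2l ?exprn_ge0// HB1.
apply: le_trans (ler_wpM2l (ltW (e0 y)) L) _.
have -> : (1 + `|y|) ^+ k * (N%:R * M * `|v|) =
    N%:R * (2 ^+ k * B) * `|v| * (1 + `|rw t|) ^+ k.
  by rewrite /M; field; rewrite expf_neq0// gt_eqF// one_norm_gt0.
apply: ler_pM; [by rewrite mulr_ge0|exact/ltW/e0| |].
  by apply: ler_pM => //; rewrite lerDl.
by rewrite ler_weXn2l// one_norm_ge1.
Qed.

Lemma approx_error k s : exists C, 0 <= C /\ forall n (y : RN),
  (1 + `|y|) ^+ k * `|partial s (approx n - convol phi g) y| <= C / n.+1%:R.
Proof.
have [A [A0 HA]] := step_error k s.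
have [M [M0 HM]] := rapid_weight k.+1 (smooth_class_bound Sg).
exists (A * M * total_weight); split=> [|n y].
  by rewrite !mulr_ge0// total_weight_ge0.
have Ss : rschwartz (partial s phi) by exact: smooth_class_partial.
have mstep : measurable_fun setT
    (fun t => step n (fun x => partial s phi (y - x)) t * g (rw t)).
  by apply: measurable_funM; [exact: measurable_step|exact: measurable_schwartz].
have dconv : dominated (fun t => partial s phi (y - rw t) * g (rw t)).
  have := @rschwartz_dominated (fun x => partial s phi (y - x) * g x); apply.
  apply: (@rschwartzM _ _ (fun x => partial s phi (y - x)) g); last exact: rschwartz_slow.
  exact: rschwartz_reflect.
have dstep : dominated (fun t => step n (fun x => partial s phi (y - x)) t * g (rw t)).
  rewrite (_ : (fun t => _) = (fun t => \sum_(j : grid N n)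
    partial s phi (y - grid_point R j) * (\1_(grid_cell j) t * g (rw t)))).
    suff H (r : seq (grid N n)) : dominated (fun t => \sum_(j <- r)
        partial s phi (y - grid_point R j) * (\1_(grid_cell j) t * g (rw t))) by exact: H.
    elim: r => [|j r IH].
      rewrite (_ : (fun t => _) = (fun=> 0)); first exact: dominated0.
      by apply/funext => t; rewrite big_nil.
    rewrite (_ : (fun t => _) = (fun t =>
      partial s phi (y - grid_point R j) * (\1_(grid_cell j) t * g (rw t)) +
      \sum_(j <- r) partial s phi (y - grid_point R j) *
        (\1_(grid_cell j) t * g (rw t)))); last first.
      by apply/funext => t; rewrite big_cons.
    by apply: dominatedD => //; apply: dominatedZ; exact: dominated_cell.
  apply/funext => t; rewrite /step mulr_suml; apply: eq_bigr => j _.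
  by rewrite mulrA.
have -> : partial s (approx n - convol phi g) y =
    rint (fun t => (step n (fun x => partial s phi (y - x)) t - partial s phi (y - rw t)) *
       g (rw t)).
  rewrite (_ : approx n - convol phi g = approx n + cst (-1) * convol phi g); last first.
    by apply/funext => x; rewrite !fctE mulN1r.
  have sc := smooth_class_smooth (rschwartz_convol Sp Sg).
  rewrite partialD; [|exact: smooth_class_smooth (rschwartz_approx n)|exact: smooth_cstM].
  rewrite partial_cstM// !fctE mulN1r partial_approx.
  rewrite /convol rconv_partial//; last exact: tempered_pairing.
  rewrite -[rconv _ _ y]/(rint (fun t => partial s phi (y - rw t) * g (rw t))) -rintB//.
  by congr rint; apply/funext => t; rewrite mulrBl.
rewrite mulrAC; apply: weighted_integral_le.
- by rewrite !mulr_ge0// ?invr_ge0//.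
- rewrite (_ : (fun t => _) = (fun t =>
    step n (fun x => partial s phi (y - x)) t * g (rw t) -
    partial s phi (y - rw t) * g (rw t))).
    by apply: measurable_funB; [exact: dstep.1|exact: dconv.1].
  by apply/funext => t; rewrite mulrBl.
- move=> t; rewrite normrM mulrA.
  apply: le_trans (ler_wpM2r (normr_ge0 _) (HA n y t)) _.
  rewrite -[leLHS]mulrA; apply: (@le_trans _ _ (A / n.+1%:R * (M * weight (rw t)))).
    by apply: ler_wpM2l; [rewrite divr_ge0|exact: HM].
  have alg (a b c d : R) : a * b * (c * d) = a * c * b * d by ring.
  by rewrite alg.
Qed.

Lemma approx_seminorm m : exists C, 0 <= C /\ forall n,
  seminorm_le m (approx n - convol phi g) (C / n.+1%:R).
Proof.
elim: m => [|[k s] m [C [C0 HC]]]; first by exists 0.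
have [C' [C'0 HC']] := approx_error k s.
exists (C + C'); split=> [|n k' s']; first exact: addr_ge0.
rewrite inE => /orP[/eqP[-> ->] x|/(HC n) {}HC x].
  by rewrite (le_trans (HC' n x))// ler_wpM2r// lerDr.
by rewrite (le_trans (HC x))// ler_wpM2r// lerDl.
Qed.

(** The sequence w (approx n) has two limits. It tends to the left side since [approx] converges in
    every seminorm. By linearity it is also the integral of step n H against [g], where H x = w
    (phi(. - x)), and tends to the right side by dominated convergence. *)
Lemma tempered_convol w : tempered w ->
  w (convol phi g) = rint (fun t => w (fun y => phi (y - rw t)) * g (rw t)).
Proof.
move=> tw; pose H x := w (fun y => phi (y - x)).
have HE : H = rconv w (fun z => phi (- z)).
  by apply/funext => x; congr w; apply/funext => y; rewrite opprB.
have sH : slow H by rewrite HE; apply: rconv_slow => //; exact: rschwartz_opp.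
have wE n : w (approx n) = rint (fun t => step n H t * g (rw t)).
  rewrite rint_step /approx tempered_sum//; last first.
    by move=> j; apply: rschwartzZ; exact: rschwartz_translate.
  apply: eq_bigr => j _; rewrite temperedZ//; last exact: rschwartz_translate.
  exact: mulrC.
have c1 : w (approx n) @[n --> \oo] --> w (convol phi g).
  have [m [C [C0 HC]]] := tempered_bound tw.
  have [C' [C'0 HC']] := approx_seminorm m.
  have e n : `|w (approx n) - w (convol phi g)| <= C * C' / n.+1%:R.
    rewrite -temperedB//; [|exact: rschwartz_approx|exact: rschwartz_convol].
    rewrite -mulrA; apply: HC; last exact: HC'.
      by apply: rschwartzB; [exact: rschwartz_approx|exact: rschwartz_convol].
    by rewrite divr_ge0.
  apply/cvgrPdist_le => eps eps0; near=> n.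
  rewrite distrC (le_trans (e n))// ler_pdivrMr// -ler_pdivrMl//.
  have : (C * C') / eps < n%:R by near: n; exact: nbhs_infty_gtr.
  rewrite mulrC => /ltW/le_trans; apply; by rewrite ler_nat.
have c2 : w (approx n) @[n --> \oo] --> rint (fun t => H (rw t) * g (rw t)).
  rewrite (_ : (fun n => w (approx n)) = (fun n => rint (fun t => step n H t * g (rw t)))).
    have [k [M [M0 HM]]] := moderateP (smooth_class_bound sH).
    have [M' [M'0 HM']] := rapid_weight k (smooth_class_bound Sg).
    have cH := smooth_class_continuous sH.
    apply: (@rint_cvg _ _ (M * 2 ^+ k * M')).
    - by move=> n; apply: measurable_funM; [exact: measurable_step|exact: measurable_schwartz].
    - by apply: measurable_funM; [exact: (measurable_continuous_rV cH)|exact: measurable_schwartz].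
    - move=> t; apply: cvgM; last exact: cvg_cst.
      exact: (step_cvg (cH (rw t))).
    - move=> n t; rewrite normrM.
      (* The sampling point is within 1 of [t], so polynomial growth of [H] there becomes growth at
         [t] uniformly in [n], which [g] beats. *)
      have h : `|step n H t| <= M * 2 ^+ k * (1 + `|rw t|) ^+ k.
        have [[p tp ->]|[nt ->]] := stepP n t; last first.
          by rewrite normr0 !mulr_ge0// exprn_ge0// addr_ge0.
        rewrite (le_trans (HM p))// -mulrA ler_wpM2l// weight_near//.
        by rewrite (le_trans tp)// invf_le1// ler1n.
      apply: (@le_trans _ _ (M * 2 ^+ k * ((1 + `|rw t|) ^+ k * `|g (rw t)|))).
        by rewrite mulrA ler_wpM2r.
      by rewrite -[leRHS]mulrA ler_wpM2l ?HM'// mulr_ge0// exprn_ge0.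
  by apply/funext => n; rewrite wE.
by rewrite -(cvg_lim _ c1)// (cvg_lim _ c2).
Unshelve. all: by end_near. Qed.

End riemann.

Lemma rconv_pairing_sym w f g : tempered w -> rschwartz f -> rschwartz g ->
  rint (fun t => rconv w f (rw t) * g (rw t)) =
  rint (fun t => rconv w (fun x => g (- x)) (rw t) * f (- rw t)).
Proof.
move=> tw Sf Sg; have Sf' := rschwartz_opp Sf.
have <- : w (convol (fun x => f (- x)) g) =
    rint (fun t => rconv w f (rw t) * g (rw t)).
  rewrite tempered_convol//; congr rint; apply/funext => t; congr (w _ * _).
  by apply/funext => y; rewrite opprB.
rewrite convolC// tempered_convol//; congr rint; apply/funext => t; congr (w _ * _).
by apply/funext => y; rewrite opprB.
Qed.

End exchange.

(** * Real multipliers *)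

Section multipliers.
Variables (R : realType) (N : nat).
Local Notation mR := (measurableTypeR R).
Local Notation T := (N.-tuple mR).
Local Notation mu := (lebesgue_tuple R N).
Local Notation RN := 'rV[R]_N.
Local Notation rw := (@rV_of_tuple R N).
Implicit Types (f g h : RN -> R) (F G : T -> R) (w : (RN -> R) -> R).

Definition nnint F : \bar R := (\int[mu]_t (F t)%:E)%E.

Lemma nnint_ge0 F : (forall t, 0 <= F t) -> (0 <= nnint F)%E.
Proof. by move=> F0; apply: integral_ge0 => t _; rewrite lee_fin. Qed.

Lemma nnint_le F G : measurable_fun setT F -> measurable_fun setT G ->
  (forall t, 0 <= F t) -> (forall t, F t <= G t) -> (nnint F <= nnint G)%E.
Proof.
move=> mF mG F0 FG; apply: ge0_le_integral => //.
- by move=> t _; rewrite lee_fin.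
- exact/measurable_EFinP.
- exact/measurable_EFinP.
- by move=> t _; rewrite lee_fin.
Qed.

Lemma nnintD F G : measurable_fun setT F -> measurable_fun setT G ->
  (forall t, 0 <= F t) -> (forall t, 0 <= G t) ->
  nnint (fun t => F t + G t) = (nnint F + nnint G)%E.
Proof.
move=> mF mG F0 G0; rewrite -ge0_integralD//; try exact/measurable_EFinP.
- by move=> t _; rewrite lee_fin.
- by move=> t _; rewrite lee_fin.
Qed.

Lemma nnintZ F c : measurable_fun setT F -> (forall t, 0 <= F t) -> 0 <= c ->
  nnint (fun t => c * F t) = (c%:E * nnint F)%E.
Proof.
move=> mF F0 c0; rewrite -ge0_integralZl_EFin//; try exact/measurable_EFinP.
by move=> t _; rewrite lee_fin.
Qed.

Lemma nnint_rint F : dominated F -> nnint F = (rint F)%:E.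
Proof.
move=> /dominated_integrable iF; rewrite /rint /Rintegral fineK//.
exact: integrable_fin_num.
Qed.

(** Carries a uniform bound on approximations to a limit whose integral is not yet known to be
    finite; both duality and interpolation end with it. *)
Lemma nnint_fatou (F_ : nat -> T -> R) F B : (forall n, measurable_fun setT (F_ n)) ->
  (forall n t, 0 <= F_ n t) -> (forall t, F_ n t @[n --> \oo] --> F t) ->
  (forall n, nnint (F_ n) <= B)%E -> (nnint F <= B)%E.
Proof.
move=> mF F0 cF HB.
have E t : (F t)%:E = limn_einf (fun n => (F_ n t)%:E).
  have c : (F_ n t)%:E @[n --> \oo] --> (F t)%:E.
    by apply: cvg_EFin; [exact: nearW|exact: cF].
  by rewrite is_cvg_limn_einfE ?(cvg_lim _ c)//; apply/cvg_ex; exists (F t)%:E.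
rewrite /nnint; under eq_integral do rewrite E.
apply: (@le_trans _ _ (limn_einf (fun n => nnint (F_ n)))).
  apply: (@fatou _ _ _ mu setT measurableT (fun n t => (F_ n t)%:E)).
  - by move=> n; exact/measurable_EFinP.
  - by move=> n t _; rewrite lee_fin.
rewrite limn_einf_lim; apply: lime_le; first exact: is_cvg_einfs.
apply: nearW => n; apply: le_trans (HB n); apply: ereal_inf_lbound.
by exists n => /=.
Qed.

Definition Lp_mass (p : R) h : \bar R := nnint (fun t => `|h (rw t)| `^ p).

Lemma measurable_Lp_mass p h : continuous h ->
  measurable_fun setT (fun t : T => `|h (rw t)| `^ p).
Proof.
move=> ch; apply: (@measurableT_comp _ _ _ _ _ _ (@powR R ^~ p)).
  exact: measurable_powR.
by apply: measurableT_comp => //; exact: (measurable_continuous_rV ch).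
Qed.

Lemma Lp_mass_ge0 p h : (0 <= Lp_mass p h)%E.
Proof. by apply: nnint_ge0 => t; exact: powR_ge0. Qed.

Lemma Lp_massZ p c h : continuous h -> 0 <= c ->
  Lp_mass p (cst c * h) = ((c `^ p)%:E * Lp_mass p h)%E.
Proof.
move=> ch c0.
rewrite -(nnintZ (measurable_Lp_mass p ch) (fun t => powR_ge0 _ _) (powR_ge0 _ _)).
by congr nnint; apply/funext => t; rewrite !fctE normrM powRM// ger0_norm.
Qed.

(** Boundedness on the unit ball, in terms of p-th and q-th powers of norms: this avoids roots and
    lets masses for different exponents be added. Homogeneity restores the usual inequality. *)
Definition real_multiplier (p q : R) w := exists C : R, forall f, rschwartz f ->
  (Lp_mass p f <= 1)%E -> (Lp_mass q (rconv w f) <= C%:E)%E.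

(** [K] is any positive upper bound of the norm, not the norm itself, so rescaling by 1/K is
    possible even for functions of zero mass. *)
Lemma real_multiplierP p q w : 0 < p -> 0 < q -> tempered w -> real_multiplier p q w ->
  exists C, 0 < C /\ forall f K, rschwartz f -> 0 < K ->
    (Lp_mass p f <= (K `^ p)%:E)%E -> (Lp_mass q (rconv w f) <= (C * K `^ q)%:E)%E.
Proof.
move=> p0 q0 tw [C HC]; exists (1 + `|C|); split; first by rewrite ltr_pwDl.
move=> f K Sf K0 fK.
have Sf' : rschwartz (cst K^-1 * f) by exact: rschwartzZ.
have K0' := ltW K0; have Ki0 : 0 <= K^-1 by rewrite invr_ge0.
have cf := smooth_class_continuous Sf.
have cwf := smooth_class_continuous (rconv_slow tw Sf').
have := HC _ Sf'; rewrite (Lp_massZ p cf Ki0).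
have Kp : 0 < K `^ p by exact: powR_gt0.
have Kq : 0 < K `^ q by exact: powR_gt0.
have -> : K^-1 `^ p = (K `^ p)^-1 by rewrite -(powR_inv1 K0') -powRrM mulN1r powRN.
rewrite lee_pdivrMl// mule1 => /(_ fK) H.
have -> : rconv w f = cst K * rconv w (cst K^-1 * f).
  by apply/funext => x; rewrite !fctE rconvZ// mulrA divff ?mul1r// gt_eqF.
rewrite (Lp_massZ q cwf K0') (mulrC (1 + `|C|)) EFinM lee_pmul2l ?lte_fin//.
by rewrite (le_trans H)// lee_fin (le_trans (ler_norm C))// lerDr.
Qed.

(** Pointwise, |h|^q is at most |h|^q1 where |h| >= 1 and at most |h|^q0 elsewhere; on the unit ball
    of the source this suffices, and the constants add. *)
Lemma real_multiplier_logconvex p q0 q1 q w : 0 < q0 -> q0 <= q <= q1 -> tempered w ->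
  real_multiplier p q0 w -> real_multiplier p q1 w -> real_multiplier p q w.
Proof.
move=> q00 /andP[q01 q12] tw [C0 H0] [C1 H1]; exists (C0 + C1) => f Sf f1.
have ch := smooth_class_continuous (rconv_slow tw Sf).
rewrite EFinD (le_trans _ (leeD (H0 f Sf f1) (H1 f Sf f1)))//.
rewrite -nnintD; [|exact: measurable_Lp_mass|exact: measurable_Lp_mass|by move=> t; exact: powR_ge0..].
apply: nnint_le; [exact: measurable_Lp_mass| |by move=> t; exact: powR_ge0|].
  by apply: measurable_funD; exact: measurable_Lp_mass.
move=> t; have [h1|h1] := leP 1 `|rconv w f (rw t)|.
  by rewrite (le_trans (ler_powR h1 q12))// lerDr powR_ge0.
have [h0|h0] := eqVneq (rconv w f (rw t)) 0.
  rewrite h0 normr0 [0 `^ q]powR0 ?addr_ge0 ?powR_ge0// gt_eqF//.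
  exact: lt_le_trans q01.
rewrite (@le_trans _ _ (`|rconv w f (rw t)| `^ q0))// ?lerDl ?powR_ge0//.
by apply: ger_powR => //; rewrite normr_gt0 h0 ltW.
Qed.

Lemma powR_continuous (a x : R) : 0 < x -> {for x, continuous (fun y : R => y `^ a)}.
Proof.
move=> x0; have [d _] := @is_derive1_powR _ a x x0.
by apply: differentiable_continuous; exact/derivable1_diffP.
Qed.

Lemma mul_le_powRD (a b q q' : R) : 1 < q -> q^-1 + q'^-1 = 1 -> 0 <= a -> 0 <= b ->
  a * b <= a `^ q + b `^ q'.
Proof.
move=> q1 qq' a0 b0.
have q0 : 0 < q by exact: lt_trans q1.
have q'0 : 0 < q'.
  by rewrite -invr_gt0; have : q^-1 < 1 by [rewrite invf_lt1]; move=> ?; lra.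
rewrite (le_trans (conjugate_powR a0 b0 q0 q'0 qq'))// lerD// ler_piMr ?powR_ge0//.
  by rewrite invf_le1// ltW.
have h : 0 < q^-1 by rewrite invr_gt0.
by lra.
Qed.

(** * Test functions for duality *)

Section test_function.
Variables (h : RN -> R) (r d c : R) (m : nat).
Hypotheses (sh : slow h) (d0 : 0 < d) (c0 : 0 < c).

(** As [d] and [c] tend to 0, h h^(2m) times this weight tends to |h|^(r-2) h. Positivity of [d]
    makes the power smooth and the Gaussian gives decay. The factor h^(2m) is split off so that,
    once r/2 <= m + 1, the exponent is nonpositive and adding [d] can only decrease the value. *)
Definition test_weight (x : RN) : R :=
  (h x ^+ 2 + d) `^ (r / 2 - m.+1%:R) * expR (- c * sqnorm x).

Definition test_fun (x : RN) : R := h x * (h x ^+ 2) ^+ m * test_weight x.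

Lemma slowX k : slow (fun x => h x ^+ k).
Proof.
elim: k => [|k IH].
  by rewrite (_ : (fun x => _) = cst 1); [exact: slow_cst|apply/funext => x; rewrite expr0].
rewrite (_ : (fun x => _) = h * (fun x => h x ^+ k)); first exact: slowM.
by apply/funext => x; rewrite exprS.
Qed.

Lemma rschwartz_test_fun : rschwartz test_fun.
Proof.
have su : slow (fun x => h x ^+ 2 + d).
  rewrite (_ : (fun x => _) = (fun x => h x ^+ 2) + cst d)//.
  by apply: slowD; [exact: slowX|exact: slow_cst].
rewrite (_ : test_fun = ((fun x => h x ^+ (2 * m).+1) *
    (fun x => (h x ^+ 2 + d) `^ (r / 2 - m.+1%:R))) *
    (fun x => expR (- c * sqnorm x))).
  apply: rschwartz_gauss => //; apply: slowM; first exact: slowX.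
  by apply: (slow_powR _ d0) => // x; rewrite lerDr sqr_ge0.
by apply/funext => x; rewrite /test_fun /test_weight !fctE mulrA [_ ^+ (2 * m).+1]exprS exprM.
Qed.

(** Writing g for the test function, |g| <= |h|^(r-1). As (r-1)(p-1) = 1 for conjugate exponents,
    |g|^(p-1) <= |h|, and multiplication by |g| gives the claim, [h] and g having the same sign. *)
Lemma test_fun_bound p x : 1 < p -> p^-1 + r^-1 = 1 -> r / 2 <= m.+1%:R ->
  `|test_fun x| `^ p <= h x * test_fun x.
Proof.
move=> p1 pr rm.
have p0 : 0 < p by exact: lt_trans p1.
have r0 : 0 < r.
  by rewrite -invr_gt0; have : p^-1 < 1 by [rewrite invf_lt1]; move=> ?; lra.
have [h0|h0] := eqVneq (h x) 0.
  by rewrite /test_fun h0 !mul0r normr0 powR0// gt_eqF.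
have x0 : 0 < `|h x| by rewrite normr_gt0.
have hp0 : 0 < h x ^+ 2 by rewrite exprn_even_gt0.
have w0 : 0 <= test_weight x by rewrite mulr_ge0 ?powR_ge0 ?expR_ge0.
have hm0 : 0 <= (h x ^+ 2) ^+ m by rewrite exprn_ge0// ltW.
have ng : `|test_fun x| = `|h x| * (h x ^+ 2) ^+ m * test_weight x.
  by rewrite /test_fun normrM (ger0_norm w0) normrM (ger0_norm hm0).
have -> : h x * test_fun x = `|h x| * `|test_fun x|.
  rewrite ng /test_fun !mulrA -expr2 -(real_normK (num_real (h x))) expr2.
  by [].
have key : `|test_fun x| `^ (p - 1) <= `|h x|.
  have -> : `|h x| = (`|h x| `^ (r - 1)) `^ (p - 1).
    rewrite -powRrM (_ : (r - 1) * (p - 1) = 1) ?powRr1 ?(ltW x0)//.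
    apply: (@mulfI _ (p^-1 * r^-1)); first by rewrite mulf_neq0 ?invr_neq0 ?gt_eqF.
    rewrite mulr1 (_ : _ * _ = (1 - r^-1) * (1 - p^-1)); last first.
      by field; rewrite !gt_eqF.
    by rewrite -pr addrK addrAC subrr add0r.
  apply: ge0_ler_powR; rewrite ?nnegrE ?powR_ge0//; first by rewrite subr_ge0 (ltW p1).
  rewrite ng.
  have -> : `|h x| `^ (r - 1) =
      `|h x| * (h x ^+ 2) ^+ m * (h x ^+ 2) `^ (r / 2 - m.+1%:R).
    rewrite -(real_normK (num_real (h x))) -exprM -exprS.
    rewrite -!powR_mulrn ?(ltW x0)// -powRrM -powRD; last by rewrite (gt_eqF x0) implybT.
    congr (_ `^ _); rewrite -!natr1 natrM; by field.
  rewrite ler_wpM2l ?mulr_ge0//.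
  rewrite /test_weight (@le_trans _ _ ((h x ^+ 2 + d) `^ (r / 2 - m.+1%:R)))//.
    rewrite ler_piMr ?powR_ge0// -expR0 ler_expR mulNr oppr_le0.
    by rewrite mulr_ge0 ?sqnorm_ge0// ltW.
  rewrite -(opprB m.+1%:R) !powRN lef_pV2 ?posrE ?powR_gt0//; last first.
    by rewrite addr_gt0.
  apply: ge0_ler_powR; rewrite ?nnegrE ?subr_ge0 ?addr_ge0 ?(ltW hp0) ?(ltW d0)//.
  by rewrite lerDl ltW.
rewrite -[p in X in X <= _](subrK 1) addrC.
have [->|g0] := eqVneq (test_fun x) 0.
  by rewrite normr0 mulr0 powR0// addrC subrK gt_eqF.
rewrite powRD; last by rewrite normr_eq0 g0 implybT.
by rewrite powRr1// mulrC ler_wpM2r.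
Qed.

End test_function.

End multipliers.

(** * Duality *)

Section duality.
Variables (R : realType) (N : nat).
Local Notation mR := (measurableTypeR R).
Local Notation T := (N.-tuple mR).
Local Notation mu := (lebesgue_tuple R N).
Local Notation RN := 'rV[R]_N.
Local Notation rw := (@rV_of_tuple R N).
Implicit Types (f g h : RN -> R) (F G : T -> R) (w : (RN -> R) -> R).

Lemma Lp_mass_opp p g : continuous g -> Lp_mass p (fun x => g (- x)) = Lp_mass p g.
Proof.
move=> cg; pose F (t : T) := (`|g (rw t)| `^ p)%:E.
have mF : measurable_fun setT F by apply/measurable_EFinP; exact: measurable_Lp_mass.
pose s : T := [tuple (0 : RN) 0 i | i < N].
transitivity (\int[mu]_t F (tuple_reflect s t))%E.
  by apply: eq_integral => t _; rewrite /F /s rV_of_tuple_reflect sub0r.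
by apply: (ge0_integral_reflect s mF) => t; rewrite lee_fin powR_ge0.
Qed.

(** If [F] is not integrable the right side is infinite, so the value that [rint] then takes does
    not matter. *)
Lemma nnint_norm_rint F : measurable_fun setT F -> ((rint F)%:E <= nnint (fun t => `|F t|%R))%E.
Proof.
move=> mF.
have [iF|niF] := pselect (mu.-integrable setT (EFin \o F)).
  rewrite /rint /Rintegral fineK; last exact: integrable_fin_num.
  apply: (le_trans (lee_abs _)).
  by apply: (le_abse_integral mu measurableT); exact/measurable_EFinP.
suff -> : nnint (fun t => `|F t|) = +oo%E by exact: leey.
apply/eqP; rewrite -leye_eq leNgt; apply/negP => H; apply: niF.
by apply/integrableP; split => //; exact/measurable_EFinP.
Qed.

Lemma test_fun_cvg h r m x : 0 < r ->
  h x * test_fun h r n.+1%:R^-1 n.+1%:R^-1 m x @[n --> \oo] --> `|h x| `^ r.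
Proof.
move=> r0; have [h0|h0] := eqVneq (h x) 0.
  rewrite h0 normr0 powR0 ?gt_eqF// (_ : (fun n => _) = fun=> 0); first exact: cvg_cst.
  by apply/funext => n; rewrite mul0r.
have x0 : 0 < `|h x| by rewrite normr_gt0.
have hp0 : 0 < h x ^+ 2 by rewrite exprn_even_gt0.
have -> : `|h x| `^ r = h x * (h x * (h x ^+ 2) ^+ m *
    ((h x ^+ 2) `^ (r / 2 - m.+1%:R) * expR (- 0 * sqnorm x))).
  rewrite oppr0 mul0r expR0 mulr1 !mulrA -expr2 -exprS.
  rewrite -(real_normK (num_real (h x))) -exprM -!powR_mulrn ?(ltW x0)// -powRrM.
  rewrite -powRD; last by rewrite (gt_eqF x0) implybT.
  by congr (_ `^ _); rewrite natrM; field.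
have ce : (n.+1%:R^-1 : R) @[n --> \oo] --> 0 by exact: cvg_harmonic.
apply: cvgM; first exact: cvg_cst.
apply: cvgM; first exact: cvg_cst.
apply: cvgM.
  apply: (@cvg_comp _ _ _ (fun n : nat => h x ^+ 2 + n.+1%:R^-1)
    (fun y => y `^ (r / 2 - m.+1%:R)) _ (nbhs (h x ^+ 2))); last exact: powR_continuous.
  have c : (h x ^+ 2 + n.+1%:R^-1) @[n --> \oo] --> h x ^+ 2 + 0.
    by apply: cvgD => //; exact: cvg_cst.
  by rewrite addr0 in c; exact: c.
apply: (@cvg_comp _ _ _ (fun n : nat => - n.+1%:R^-1 * sqnorm x)
    (@expR R) _ (nbhs (- 0 * sqnorm x))); last exact: continuous_expR.
by apply: cvgM; [exact: cvgN|exact: cvg_cst].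
Qed.

(** Let A be the integral of h g_n. The p-mass of g_n is at most A, so the hypothesis bounds the
    q-mass of w * g_n(-.) in terms of K = A^(1/p), and the symmetry of the pairing with Young's
    inequality gives A <= K (C + 1). Since g_n is Schwartz, A is finite and K can be divided out:
    A^(1/p') <= C + 1, uniformly in n. *)
Lemma real_multiplier_dual p q p' q' w : 1 < p -> 1 < q -> p^-1 + p'^-1 = 1 -> q^-1 + q'^-1 = 1 ->
  tempered w -> real_multiplier p q w -> real_multiplier q' p' w.
Proof.
move=> p1 q1 pp' qq' tw mw.
have p0 : 0 < p by exact: lt_trans p1.
have q0 : 0 < q by exact: lt_trans q1.
have p'0 : 0 < p'.
  by rewrite -invr_gt0; have : p^-1 < 1 by [rewrite invf_lt1]; move=> ?; lra.
have [C [C0 HC]] := real_multiplierP p0 q0 tw mw.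
exists ((C + 1) `^ p') => f Sf f1.
pose h := rconv w f.
have sh : slow h by exact: rconv_slow.
have ch := smooth_class_continuous sh.
pose m := Num.truncn (p' / 2).
have hm : p' / 2 <= m.+1%:R by rewrite ltW// truncnS_gt.
pose e n : R := n.+1%:R^-1.
have e0 n : 0 < e n by rewrite invr_gt0.
pose g n := test_fun h p' (e n) (e n) m.
have Sg n : rschwartz (g n) by exact: rschwartz_test_fun.
have hg0 n x : 0 <= h x * g n x.
  by apply: le_trans (test_fun_bound h (e0 n) (e0 n) x p1 pp' hm); exact: powR_ge0.
have Shg n : rschwartz (h * g n) by rewrite mulrC; exact: rschwartzM.
pose A n := rint (fun t => h (rw t) * g n (rw t)).
have EA n : nnint (fun t => h (rw t) * g n (rw t)) = (A n)%:E.
  exact: (nnint_rint (rschwartz_dominated (Shg n))).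
have A0 n : 0 <= A n by rewrite -lee_fin -EA; apply: nnint_ge0 => t; exact: hg0.
have Lp_mass_g n : (Lp_mass p (g n) <= (A n)%:E)%E.
  rewrite -EA; apply: nnint_le => [||t|t].
  - by apply: measurable_Lp_mass; exact: smooth_class_continuous (Sg n).
  - exact: (measurable_schwartz (Shg n)).
  - exact: powR_ge0.
  - exact: test_fun_bound.
have AC n : A n <= (C + 1) `^ p'.
  have [A_eq0|An0] := eqVneq (A n) 0; first by rewrite A_eq0 powR_ge0.
  have Apos : 0 < A n by rewrite lt_neqAle eq_sym An0 A0.
  pose K := A n `^ p^-1.
  have K0 : 0 < K by exact: powR_gt0.
  have Kp : K `^ p = A n by rewrite -powRrM mulVf ?powRr1// gt_eqF.
  pose g' x := g n (- x).
  have Sg' : rschwartz g' by exact: rschwartz_opp.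
  have H : (Lp_mass q (rconv w g') <= (C * K `^ q)%:E)%E.
    by apply: HC => //; rewrite Kp Lp_mass_opp//; exact: smooth_class_continuous (Sg n).
  have cG := smooth_class_continuous (rconv_slow tw Sg').
  have Sf' := rschwartz_opp Sf; have cf' := smooth_class_continuous Sf'.
  have cf := smooth_class_continuous Sf.
  have AE : A n = rint (fun t => rconv w g' (rw t) * f (- rw t)).
    exact: rconv_pairing_sym.
  have : ((A n)%:E <= (K * (C + 1))%:E)%E.
    rewrite AE; apply: (le_trans (nnint_norm_rint _)).
      by apply: measurable_funM; [exact: (measurable_continuous_rV cG)
                                 |exact: (measurable_continuous_rV cf')].
    have ma := measurable_Lp_mass q cG; have mb := measurable_Lp_mass q' cf'.
    have Kq : 0 < K `^ q by exact: powR_gt0.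
    have Kqi : 0 <= (K `^ q)^-1 by rewrite invr_ge0 ltW.
    (* Young's inequality is applied after dividing the first factor by [K], so that both resulting
       masses are bounded independently of [A]. *)
    apply: (@le_trans _ _ (nnint (fun t => K * ((K `^ q)^-1 * `|rconv w g' (rw t)| `^ q +
        `|f (- rw t)| `^ q')))).
      apply: nnint_le => [|||t].
      - by apply: measurableT_comp => //; apply: measurable_funM;
          [exact: (measurable_continuous_rV cG)|exact: (measurable_continuous_rV cf')].
      - by apply: measurable_funM => //; apply: measurable_funD => //; exact: measurable_funM.
      - by [].
      - rewrite normrM -ler_pdivrMl// mulrA.
        have -> : (K `^ q)^-1 * `|rconv w g' (rw t)| `^ q = (K^-1 * `|rconv w g' (rw t)|) `^ q.
          rewrite powRM ?invr_ge0 ?(ltW K0)//; congr (_ * _).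
          by rewrite -(powR_inv1 (ltW K0)) -powRrM mulN1r powRN.
        by apply: mul_le_powRD => //; rewrite mulr_ge0// invr_ge0 ltW.
    have t0 t : 0 <= (K `^ q)^-1 * `|rconv w g' (rw t)| `^ q by rewrite mulr_ge0 ?powR_ge0.
    have t1 t : 0 <= `|f (- rw t)| `^ q' by exact: powR_ge0.
    have m0 : measurable_fun setT
        (fun t : T => (K `^ q)^-1 * `|rconv w g' (rw t)| `^ q) by exact: measurable_funM.
    have t2 t : 0 <= (K `^ q)^-1 * `|rconv w g' (rw t)| `^ q + `|f (- rw t)| `^ q'.
      by rewrite addr_ge0.
    rewrite (nnintZ (measurable_funD m0 mb) t2 (ltW K0)).
    rewrite EFinM lee_pmul2l ?lte_fin// (nnintD m0 mb t0 t1).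
    rewrite (nnintZ ma (fun t => powR_ge0 _ _) Kqi).
    rewrite EFinD; apply: leeD; last first.
      by rewrite -[X in (X <= _)%E]/(Lp_mass q' (fun x => f (- x))) Lp_mass_opp.
    by rewrite lee_pdivrMl// -EFinM mulrC.
  rewrite lee_fin => AK.
  have h1 : A n `^ p'^-1 <= C + 1.
    have -> : p'^-1 = 1 - p^-1 by rewrite -pp' addrAC subrr add0r.
    rewrite powRB; last by rewrite An0 implybT.
    by rewrite powRr1// ler_pdivrMr// mulrC.
  have -> : A n = (A n `^ p'^-1) `^ p' by rewrite -powRrM mulVf ?powRr1// gt_eqF.
  by apply: ge0_ler_powR; rewrite ?nnegrE ?powR_ge0 ?(ltW p'0) ?addr_ge0 ?(ltW C0).
apply: (@nnint_fatou _ _ (fun n t => h (rw t) * g n (rw t))) => //.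
- by move=> n; exact: (measurable_schwartz (Shg n)).
- by move=> t; exact: test_fun_cvg.
- by move=> n; rewrite EA lee_fin.
Qed.

End duality.

(** * A dyadic decomposition *)

Section dyadic.
Variables (R : realType) (p : R).
Hypothesis p3 : 3 < p.
Implicit Types (l a b x t : R).

(** This equals l^3 (|a/l|^2 + |b/l|^p): the dyadic layer-cake term at height l for the cube of |a +
    b|, with the Chebyshev bounds in L^2 and L^p put in place of the distribution function. *)
Definition K_summand l a b : R := l * (`|a| `^ 2 + l `^ (2 - p) * `|b| `^ p).

(** A smooth truncation: about x for |x| well below l, about l^2/x well above. The inverse is
    written as a real power so that [slow_powR] applies. *)
Definition cutoff l x : R := x * (1 + (l^-1 * x) ^+ 2) `^ (-1).

Let rho : R := 2 `^ (p - 3).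

(** With s = t^(p-3), the increment of s/(1+s) from t to 2t is (rho - 1) s / ((1+s)(1 + rho s)). The
    quotient rho/(rho - 1) cancels rho - 1 and compensates 1 + rho s <= rho (1 + s); the 4 comes
    from (1+s)^2 <= 4 max(1, s^2). *)
Definition dyadic_const : R := 4 * rho / (rho - 1).

(** Bounded, and with increments from t to 2t that dominate the two terms of [K_summand] for the
    truncation, where t = l/|x|; sums over dyadic l then telescope. *)
Definition primitive t : R :=
  6 * (t / (1 + t)) + dyadic_const * (t `^ (p - 3) / (1 + t `^ (p - 3))).

Let p0 : 0 < p. Proof. by move: p3; lra. Qed.

Lemma rho_gt1 : 1 < rho.
Proof.
have := @gt0_ltr_powR R (p - 3); rewrite subr_gt0 => /(_ p3 1 2).
by rewrite !nnegrE ler01 ler0n powR1; apply => //; rewrite ltr1n.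
Qed.

Lemma dyadic_const_ge0 : 0 <= dyadic_const.
Proof.
by have := rho_gt1 => ?; rewrite divr_ge0 ?mulr_ge0 ?powR_ge0 ?subr_ge0// ltW.
Qed.

Lemma K_summand_ge0 l a b : 0 <= l -> 0 <= K_summand l a b.
Proof. by move=> l0; rewrite mulr_ge0// addr_ge0 ?mulr_ge0 ?powR_ge0. Qed.

(** One of |a|, |b| is at least half of x = |a + b|. In the first case x^3 <= 8 l |a|^2 and 8 <=
    2^p; in the second x^3 = 2^p x^(3-p) (x/2)^p, where x^(3-p) <= l^(3-p) because 3 - p < 0. *)
Lemma K_summand_lower l a b : 0 < l -> l <= `|a + b| <= 2 * l ->
  `|a + b| `^ 3 <= 2 `^ p * K_summand l a b.
Proof.
move=> l0 /andP[]; set x := `|a + b| => lx xl.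
have x0 : 0 < x by exact: lt_le_trans lx.
have xab : x <= `|a| + `|b| by exact: ler_normD.
have K8 : 8 <= 2 `^ p :> R.
  have -> : 8 = 2 `^ 3 :> R by rewrite powR_mulrn//; ring.
  by rewrite ler_powR ?ler1n// ltW.
have T1 : 0 <= `|a| `^ 2 by exact: powR_ge0.
have T2 : 0 <= l `^ (2 - p) * `|b| `^ p by rewrite mulr_ge0 ?powR_ge0.
rewrite /K_summand; have [ha|ha] := leP (x / 2) `|a|.
  apply: (@le_trans _ _ (8 * (l * `|a| `^ 2))); last first.
    apply: ler_pM => //; first by rewrite mulr_ge0// ltW.
    by rewrite ler_pM2l// lerDl.
  rewrite !powR_mulrn ?(ltW x0)//.
  have -> : x ^+ 3 = 8 * (x / 2 * (x / 2) ^+ 2) by field.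
  rewrite ler_pM2l//; apply: ler_pM; rewrite ?divr_ge0 ?exprn_ge0 ?divr_ge0 ?(ltW x0)//.
    by rewrite ler_pdivrMr// mulrC.
  by rewrite lerXn2r ?nnegrE ?divr_ge0 ?(ltW x0).
have hb : x / 2 <= `|b| by move: ha xab; lra.
apply: (@le_trans _ _ (2 `^ p * (x `^ (3 - p) * (x / 2) `^ p))); last first.
  rewrite ler_pM2l ?powR_gt0//.
  apply: (@le_trans _ _ (l * (l `^ (2 - p) * `|b| `^ p))); last by rewrite ler_pM2l// lerDr.
  rewrite mulrA; apply: ler_pM; rewrite ?powR_ge0//; last first.
    by apply: ge0_ler_powR; rewrite ?nnegrE ?divr_ge0 ?(ltW p0) ?(ltW x0).
  rewrite -{1}(powRr1 (ltW l0)) -powRD; last by rewrite (gt_eqF l0) implybT.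
  rewrite (_ : 1 + (2 - p) = - (p - 3)); last by ring.
  rewrite -(opprB p 3) !powRN lef_pV2 ?posrE ?powR_gt0//.
  by apply: ge0_ler_powR; rewrite ?nnegrE ?subr_ge0 ?(ltW p3) ?(ltW x0) ?(ltW l0).
rewrite mulrCA -powRM ?divr_ge0 ?(ltW x0)// mulrCA divff// mulr1.
rewrite -powRD; last by rewrite (gt_eqF x0) implybT.
by rewrite subrK.
Qed.

Lemma cutoff_term1 t : 0 < t ->
  t / (1 + t ^+ 2) ^+ 2 <= 6 * (2 * t / (1 + 2 * t)) - 6 * (t / (1 + t)).
Proof.
move=> t0; have h1 : 0 < 1 + t by lra.
have h2 : 0 < 1 + 2 * t by lra.
have h3 : 0 < (1 + t ^+ 2) ^+ 2 by rewrite exprn_gt0// ltr_pwDl// sqr_ge0.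
have -> : 6 * (2 * t / (1 + 2 * t)) - 6 * (t / (1 + t)) = 6 * t / ((1 + t) * (1 + 2 * t)).
  by field; rewrite !gt_eqF.
rewrite ler_pdivrMr// mulrAC ler_pdivlMr ?mulr_gt0//.
rewrite (mulrC 6) -mulrA ler_pM2l//.
have : 0 <= (t - 1) ^+ 2 by rewrite sqr_ge0.
have : 0 <= t ^+ 4 by rewrite exprn_ge0// ltW.
have -> : (1 + t ^+ 2) ^+ 2 = 1 + 2 * t ^+ 2 + t ^+ 4 by ring.
by move=> *; nra.
Qed.

Lemma cutoff_term2 t : 0 < t ->
  t `^ (3 - p) * (t ^+ 2 / (1 + t ^+ 2)) `^ p <=
  dyadic_const * ((2 * t) `^ (p - 3) / (1 + (2 * t) `^ (p - 3))) -
  dyadic_const * (t `^ (p - 3) / (1 + t `^ (p - 3))).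
Proof.
move=> t0; have r1 := rho_gt1.
have t2 : 0 < 1 + t ^+ 2 by rewrite ltr_pwDl// sqr_ge0.
have t20 : 0 <= t ^+ 2 by rewrite sqr_ge0.
rewrite [(2 * t) `^ _]powRM ?(ltW t0)// -/rho /dyadic_const.
rewrite -(opprB p 3) powRN.
pose s := t `^ (p - 3); have s0 : 0 < s by exact: powR_gt0.
pose Z := (1 + t ^+ 2) `^ p; have Z0 : 0 < Z by exact: powR_gt0.
have E : (t ^+ 2) `^ p = s ^+ 2 * t ^+ 6.
  rewrite /s -!powR_mulrn ?(ltW t0) ?powR_ge0// -!powRrM -powRD; last first.
    by rewrite (gt_eqF t0) implybT.
  by congr (_ `^ _); ring.
have -> : (t ^+ 2 / (1 + t ^+ 2)) `^ p = s ^+ 2 * t ^+ 6 / Z.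
  rewrite powRM ?invr_ge0 ?(ltW t2)// E; congr (_ * _).
  by rewrite -(powR_inv1 (ltW t2)) -powRrM mulN1r powRN.
rewrite -/s.
(* For t <= 1 also s <= 1 and Z >= 1. For t > 1, (1 + s)^2 <= 4 s^2 and s^2 t^6 = t^(2p) <= Z. *)
have claim : t ^+ 6 * (1 + s) ^+ 2 <= 4 * Z.
  have [t1|t1] := leP t 1.
    have s1 : s <= 1.
      have : s <= 1 `^ (p - 3); last by rewrite powR1.
      by apply: ge0_ler_powR; rewrite ?nnegrE ?subr_ge0 ?(ltW p3) ?(ltW t0).
    have Z1 : 1 <= Z.
      by rewrite -[leLHS](powRr0 (1 + t ^+ 2)) ler_powR ?(ltW p0)// lerDl.
    apply: (@le_trans _ _ (1 * 4)); last by rewrite mul1r ler_peMr.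
    apply: ler_pM; rewrite ?exprn_ge0 ?addr_ge0 ?(ltW t0) ?(ltW s0)//.
      by rewrite exprn_ile1// ltW.
    by move: s1 s0; nra.
  have s1 : 1 <= s by rewrite -(powRr0 t) ler_powR ?subr_ge0 ?(ltW p3) ?(ltW t1).
  apply: (@le_trans _ _ (4 * (s ^+ 2 * t ^+ 6))).
    rewrite mulrC mulrA ler_pM2r ?exprn_gt0//.
    by move: s1; nra.
  rewrite ler_pM2l// -E; apply: ge0_ler_powR; rewrite ?nnegrE ?(ltW p0) ?(ltW t2)//.
  by rewrite lerDr.
have h1 : 0 < 1 + s by rewrite addr_gt0.
have r0 : 0 < rho by exact: lt_trans r1.
have h2 : 0 < 1 + rho * s by rewrite addr_gt0// mulr_gt0.
have h3 : 0 < rho - 1 by rewrite subr_gt0.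
have -> : s^-1 * (s ^+ 2 * t ^+ 6 / Z) = s * (t ^+ 6 / Z).
  by field; rewrite !gt_eqF.
have -> : 4 * rho / (rho - 1) * (rho * s / (1 + rho * s)) -
    4 * rho / (rho - 1) * (s / (1 + s)) = s * (4 * rho / ((1 + s) * (1 + rho * s))).
  by field; rewrite !gt_eqF.
rewrite ler_pM2l// ler_pdivlMr ?mulr_gt0// mulrAC ler_pdivrMr//.
have H : t ^+ 6 * (1 + s) ^+ 2 * rho <= 4 * Z * rho by rewrite ler_pM2r.
rewrite [leRHS]mulrAC; apply: le_trans H.
have t6 : 0 < t ^+ 6 by rewrite exprn_gt0.
rewrite [(1 + s) ^+ 2]expr2 -!(mulrA (t ^+ 6)) ler_pM2l// -(mulrA (1 + s)) ler_pM2l//.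
by move: s0 r1; nra.
Qed.

(** Homogeneity of degree 3 reduces everything to t = l/|x|: the truncation is x t^2/(1+t^2) and the
    remainder x/(1+t^2). *)
Lemma K_summand_cutoff l x : 0 < l -> x != 0 ->
  K_summand l (x - cutoff l x) (cutoff l x) <=
  `|x| `^ 3 * (primitive (2 * l / `|x|) - primitive (l / `|x|)).
Proof.
move=> l0 x0'; have x0 : 0 < `|x| by rewrite normr_gt0.
pose t := l / `|x|; have t0 : 0 < t by exact: divr_gt0.
have t2 : 0 < 1 + t ^+ 2 by rewrite ltr_pwDl// sqr_ge0.
have lE : l = t * `|x| by rewrite /t divfK// gt_eqF.
have cE : cutoff l x = x * (t ^+ 2 / (1 + t ^+ 2)).
  rewrite /cutoff powR_inv1; last by rewrite addr_ge0// sqr_ge0.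
  congr (_ * _); rewrite exprMn -(real_normK (num_real x)) -exprMn.
  have -> : l^-1 * `|x| = t^-1 by rewrite /t invfM invrK.
  by field; rewrite !gt_eqF.
have nc : `|cutoff l x| = `|x| * (t ^+ 2 / (1 + t ^+ 2)).
  by rewrite cE normrM (ger0_norm (_ : 0 <= t ^+ 2 / _)) ?divr_ge0 ?sqr_ge0 ?(ltW t2).
have nd : `|x - cutoff l x| = `|x| / (1 + t ^+ 2).
  have -> : x - cutoff l x = x / (1 + t ^+ 2) by rewrite cE; field; rewrite gt_eqF.
  by rewrite normrM (ger0_norm (_ : 0 <= (1 + t ^+ 2)^-1)) ?invr_ge0 ?(ltW t2).
have f0 : 0 <= t ^+ 2 / (1 + t ^+ 2) by rewrite divr_ge0 ?sqr_ge0 ?(ltW t2).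
have -> : K_summand l (x - cutoff l x) (cutoff l x) =
    `|x| `^ 3 * (t / (1 + t ^+ 2) ^+ 2 +
      t `^ (3 - p) * (t ^+ 2 / (1 + t ^+ 2)) `^ p).
  rewrite /K_summand nc nd mulrDr [RHS]mulrDr; congr (_ + _).
    rewrite !powR_mulrn ?divr_ge0 ?(ltW x0) ?(ltW t2)// lE.
    by field; rewrite gt_eqF.
  rewrite mulrA -{1}(powRr1 (ltW l0)) -powRD; last by rewrite (gt_eqF l0) implybT.
  rewrite (_ : 1 + (2 - p) = 3 - p); last by ring.
  rewrite [in LHS]powRM ?(ltW x0)// lE powRM ?(ltW x0) ?(ltW t0)//.
  rewrite -(mulrA (t `^ _)) (mulrA (`|x| `^ (3 - p))) -powRD; last first.
    by rewrite (gt_eqF x0) implybT.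
  by rewrite subrK mulrCA.
rewrite ler_pM2l ?powR_gt0// -mulrA -/t /primitive.
have alg (a b c d : R) : a + b - (c + d) = (a - c) + (b - d) by ring.
by rewrite alg; apply: lerD; [exact: cutoff_term1|exact: cutoff_term2].
Qed.

Lemma primitive_ge0 t : 0 <= t -> 0 <= primitive t.
Proof.
move=> t0; have := dyadic_const_ge0 => ?.
have frac (a : R) : 0 <= a -> 0 <= a / (1 + a) by move=> a0; rewrite divr_ge0 ?addr_ge0.
by apply: addr_ge0; apply: mulr_ge0 => //; apply: frac => //; exact: powR_ge0.
Qed.

Lemma primitive_le t : 0 <= t -> primitive t <= 6 + dyadic_const.
Proof.
move=> t0; have := dyadic_const_ge0 => c0.
have frac (a : R) : 0 <= a -> a / (1 + a) <= 1.
  by move=> a0; rewrite ler_pdivrMr ?mul1r ?lerDr// ltr_pwDl.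
by apply: lerD; rewrite ler_piMr// frac ?powR_ge0.
Qed.

(** [level] and [colevel] together run through all integer powers of 2, each once; [colevel] starts
    at 1/2 to avoid counting 1 twice. *)
Definition level (n : nat) : R := 2 ^+ n.
Definition colevel (n : nat) : R := (2 ^+ n.+1)^-1.

Lemma level_gt0 n : 0 < level n. Proof. by rewrite exprn_gt0. Qed.
Lemma colevel_gt0 n : 0 < colevel n. Proof. by rewrite invr_gt0 exprn_gt0. Qed.

Definition K_pair n (a b : R -> R) : R :=
  K_summand (level n) (a (level n)) (b (level n)) +
  K_summand (colevel n) (a (colevel n)) (b (colevel n)).

Lemma K_pair_ge0 n (a b : R -> R) : 0 <= K_pair n a b.
Proof. by rewrite addr_ge0// K_summand_ge0// ?(ltW (level_gt0 _)) ?(ltW (colevel_gt0 _)). Qed.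

Lemma sum_K_pair_cutoff x K :
  \sum_(n < K) K_pair n (fun l => x - cutoff l x) (fun l => cutoff l x) <=
  2 * (6 + dyadic_const) * `|x| `^ 3.
Proof.
have c0 := dyadic_const_ge0.
have [->|x0'] := eqVneq x 0.
  rewrite big1 => [|n _]; first by rewrite mulr_ge0 ?powR_ge0// mulr_ge0 ?addr_ge0.
  by rewrite /K_pair /K_summand /cutoff !(mul0r, subrr, normr0) !powR0 ?gt_eqF// !(mulr0, addr0).
have x0 : 0 < `|x| by rewrite normr_gt0.
have u1 (u : nat -> R) : (forall n, 0 <= u n <= 6 + dyadic_const) ->
    \sum_(n < K) (u n.+1 - u n) <= 6 + dyadic_const.
  move=> Hu; rewrite -(big_mkord xpredT (fun n => u n.+1 - u n)) telescope_sumr//.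
  have /andP[_ h1] := Hu K; have /andP[h2 _] := Hu 0%N.
  by rewrite (le_trans _ h1)// gerBl.
have Hp (l : R) : 0 <= l -> 0 <= primitive (l / `|x|) <= 6 + dyadic_const.
  by move=> l0; rewrite primitive_ge0 ?primitive_le ?divr_ge0.
apply: (@le_trans _ _ (\sum_(n < K) (`|x| `^ 3 *
    (primitive (level n.+1 / `|x|) - primitive (level n / `|x|)) +
    `|x| `^ 3 * (primitive (2 * colevel n / `|x|) - primitive (colevel n / `|x|))))).
  apply: ler_sum => n _; apply: lerD; last exact: K_summand_cutoff (colevel_gt0 _) x0'.
  by rewrite /level exprS; exact: K_summand_cutoff (level_gt0 _) x0'.
rewrite big_split/= -!mulr_sumr -mulrDr mulrC ler_pM2r ?powR_gt0// mulr2n mulrDl !mul1r.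
apply: lerD.
  apply: (u1 (fun n => primitive (level n / `|x|))) => n.
  by apply: Hp; rewrite ltW// level_gt0.
(* The colevels decrease, so the telescoping sequence is the complement of [primitive] to its upper
   bound; it again lies between 0 and that bound. *)
pose v n := 6 + dyadic_const - primitive ((2 ^+ n)^-1 / `|x|).
rewrite (eq_bigr (fun n : 'I_K => v n.+1 - v n)) => [|n _].
  apply: u1 => n; rewrite /v; have /andP[h1 h2] : 0 <= primitive ((2 ^+ n)^-1 / `|x|) <= 6 + dyadic_const.
    by apply: Hp; rewrite invr_ge0 exprn_ge0.
  by rewrite subr_ge0 h2 gerBl.
rewrite /v /colevel.
have -> : 2 * (2 ^+ n.+1)^-1 = (2 ^+ n)^-1 :> R.
  by rewrite exprS; field; rewrite expf_neq0.
have alg (a b c : R) : b - c = a - c - (a - b) by ring.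
exact: alg.
Qed.

Lemma dyadic_scale x : 0 < x -> exists n,
  level n <= x <= 2 * level n \/ colevel n <= x <= 2 * colevel n.
Proof.
have H y : 1 <= y -> exists n, level n <= y <= 2 * level n.
  move=> y1; have y0 : 0 <= y by exact: le_trans y1.
  have t0 : (0 < Num.truncn y)%N by rewrite truncn_gt_nat.
  have /andP[h1 h2] := truncn_itv y0.
  have /andP[k1 k2] := trunc_log_bounds (isT : 1 < 2)%N t0.
  exists (trunc_log 2 (Num.truncn y)); rewrite /level -exprS -!natrX; apply/andP; split.
    by rewrite (le_trans _ h1)// ler_nat.
  by rewrite (le_trans (ltW h2))// ler_nat.
move=> x0; have [x1|x1] := leP 1 x.
  by have [n Hn] := H x x1; exists n; left.
have [|n /andP[h1 h2]] := H x^-1; first by rewrite invf_ge1// ltW.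
exists n; right; rewrite /colevel.
have e0 : 0 < 2 ^+ n :> R by rewrite exprn_gt0.
apply/andP; split.
  by rewrite -[leRHS]invrK lef_pV2 ?posrE ?invr_gt0 ?exprn_gt0// exprS.
have -> : 2 * (2 ^+ n.+1)^-1 = (2 ^+ n)^-1 :> R.
  by rewrite exprS; field; rewrite expf_neq0.
by rewrite -[leLHS]invrK lef_pV2 ?posrE ?invr_gt0.
Qed.

(** A single dyadic height l with l <= |x| <= 2l suffices, the other terms being nonnegative. The
    rank [K0] depends on [x]. *)
Lemma sum_K_pair_lower (a b : R -> R) x : (forall l, a l + b l = x) ->
  exists K0, forall K, (K0 <= K)%N ->
  `|x| `^ 3 <= 2 `^ p * \sum_(n < K) K_pair n a b.
Proof.
move=> ab; have [->|x0'] := eqVneq x 0.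
  exists 0%N => K _; rewrite normr0 powR0 ?gt_eqF// mulr_ge0 ?powR_ge0//.
  by apply: sumr_ge0 => n _; exact: K_pair_ge0.
have x0 : 0 < `|x| by rewrite normr_gt0.
have [n Hn] := dyadic_scale x0; exists n.+1 => K nK.
apply: (@le_trans _ _ (2 `^ p * K_pair n a b)); last first.
  rewrite ler_pM2l ?powR_gt0// (bigD1 (Ordinal nK))//= lerDl.
  by apply: sumr_ge0 => i _; exact: K_pair_ge0.
rewrite /K_pair; case: Hn => Hn.
  apply: (@le_trans _ _ (2 `^ p * K_summand (level n) (a (level n)) (b (level n)))).
    by rewrite -(ab (level n)) K_summand_lower ?level_gt0// ab.
  by rewrite ler_pM2l ?powR_gt0// lerDl K_summand_ge0// ltW// colevel_gt0.
apply: (@le_trans _ _ (2 `^ p * K_summand (colevel n) (a (colevel n)) (b (colevel n)))).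
  by rewrite -(ab (colevel n)) K_summand_lower ?colevel_gt0// ab.
by rewrite ler_pM2l ?powR_gt0// lerDr K_summand_ge0// ltW// level_gt0.
Qed.

End dyadic.

(** * Interpolation *)

Section interpolation.
Variables (R : realType) (N : nat).
Local Notation mR := (measurableTypeR R).
Local Notation T := (N.-tuple mR).
Local Notation mu := (lebesgue_tuple R N).
Local Notation RN := 'rV[R]_N.
Local Notation rw := (@rV_of_tuple R N).
Implicit Types (f g h : RN -> R) (w : (RN -> R) -> R).

(** With equal exponents the homogeneous inequality is linear in the mass. Enlarging the mass by e/C
    keeps K positive; e is arbitrary. *)
Lemma real_multiplier_diag p w : 0 < p -> tempered w -> real_multiplier p p w ->
  exists C, 0 < C /\ forall f, rschwartz f -> (Lp_mass p (rconv w f) <= C%:E * Lp_mass p f)%E.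
Proof.
move=> p0 tw mw; have [C [C0 HC]] := real_multiplierP p0 p0 tw mw.
exists C; split=> // f Sf; have := Lp_mass_ge0 p f.
case: (Lp_mass p f) (HC f) => [v||//] H; last by rewrite gt0_muley ?leey ?lte_fin.
rewrite lee_fin => v0; apply/lee_addgt0Pr => e e0.
have ve0 : 0 < v + e / C by rewrite ltr_wpDl// divr_gt0.
have := H ((v + e / C) `^ p^-1) Sf (powR_gt0 _ ve0).
rewrite -powRrM mulVf ?powRr1 ?(ltW ve0) ?gt_eqF// lee_fin lerDl divr_ge0 ?(ltW e0) ?(ltW C0)//.
by move=> /(_ isT); rewrite mulrDr mulrCA divff ?mulr1 ?gt_eqF.
Qed.

Lemma nnint_sum (I : Type) (r : seq I) (F : I -> T -> R) :
  (forall i, measurable_fun setT (F i)) -> (forall i t, 0 <= F i t) ->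
  nnint (fun t => \sum_(i <- r) F i t) = (\sum_(i <- r) nnint (F i))%E.
Proof.
move=> mF F0; rewrite /nnint -ge0_integral_sum//.
- by apply: eq_integral => t _; rewrite sumEFin.
- by move=> i; exact/measurable_EFinP.
- by move=> i t _; rewrite lee_fin.
Qed.

Lemma measurable_K_summand p l (A B : RN -> R) : continuous A -> continuous B ->
  measurable_fun setT (fun t : T => K_summand p l (A (rw t)) (B (rw t))).
Proof.
move=> cA cB; apply: measurable_funM => //; apply: measurable_funD.
  exact: measurable_Lp_mass.
by apply: measurable_funM => //; exact: measurable_Lp_mass.
Qed.

Lemma nnint_K_summand p l (A B : RN -> R) : 0 <= l -> continuous A -> continuous B ->
  nnint (fun t => K_summand p l (A (rw t)) (B (rw t))) =
  (l%:E * (Lp_mass 2 A + (l `^ (2 - p))%:E * Lp_mass p B))%E.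
Proof.
move=> l0 cA cB; have mA := measurable_Lp_mass 2 cA; have mB := measurable_Lp_mass p cB.
have m0 : measurable_fun setT (fun t : T => l `^ (2 - p) * `|B (rw t)| `^ p).
  exact: measurable_funM.
have t0 (t : T) : 0 <= `|A (rw t)| `^ 2 by exact: powR_ge0.
have t1 (t : T) : 0 <= l `^ (2 - p) * `|B (rw t)| `^ p by rewrite mulr_ge0 ?powR_ge0.
rewrite (nnintZ (measurable_funD mA m0) (fun t => addr_ge0 (t0 t) (t1 t)) l0).
by rewrite (nnintD mA m0 t0 t1) (nnintZ mB (fun t => powR_ge0 _ _) (powR_ge0 _ _)).
Qed.

Lemma rschwartz_cutoff f l : rschwartz f -> rschwartz (fun x => cutoff l (f x)).
Proof.
move=> Sf; pose u x := 1 + (l^-1 * f x) ^+ 2.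
rewrite (_ : (fun x => _) = f * (fun x => u x `^ (-1)))//.
apply: rschwartzM => //; apply: (slow_powR _ ltr01) => [x|]; first by rewrite lerDl sqr_ge0.
rewrite (_ : u = cst 1 + (cst l^-1 * f) * (cst l^-1 * f)); last first.
  by apply/funext => x; rewrite /u !fctE expr2.
apply: slowD; first exact: slow_cst.
by apply: slowM; apply: rschwartz_slow; exact: rschwartzZ.
Qed.

(** At each height l the large part f - s_l is estimated by the L^2 bound and the truncated part s_l
    by the L^p bound. The pointwise inequality [sum_K_pair_lower] bounds |w * f|^3 by the pieces of
    w * f, and [sum_K_pair_cutoff] bounds the pieces of [f] by |f|^3. *)
Lemma marcinkiewicz3 p w : 3 < p -> tempered w ->
  real_multiplier 2 2 w -> real_multiplier p p w -> real_multiplier 3 3 w.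
Proof.
move=> p3 tw w2 wp; have p0 : 0 < p by lra.
have [C2 [C20 H2]] := real_multiplier_diag (ltr0n _ 2) tw w2.
have [Cp [Cp0 Hp]] := real_multiplier_diag p0 tw wp.
pose C := C2 + Cp; have C0 : 0 <= C by rewrite addr_ge0 ?(ltW C20) ?(ltW Cp0).
exists (2 `^ p * (C * (2 * (6 + dyadic_const p)))) => f Sf f1.
have sh := rconv_slow tw Sf; have ch := smooth_class_continuous sh.
pose s l x := cutoff l (f x); pose b l : RN -> R := f - s l.
have Ss l : rschwartz (s l) by exact: rschwartz_cutoff.
have Sb l : rschwartz (b l) by exact: rschwartzB.
have cs l := smooth_class_continuous (Ss l); have cb l := smooth_class_continuous (Sb l).
have cws l := smooth_class_continuous (rconv_slow tw (Ss l)).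
have cwb l := smooth_class_continuous (rconv_slow tw (Sb l)).
pose G (n : nat) t := K_pair p n (fun l => rconv w (b l) (rw t)) (fun l => rconv w (s l) (rw t)).
pose F (n : nat) t := K_pair p n (fun l => b l (rw t)) (fun l => s l (rw t)).
have mG n : measurable_fun setT (G n) by apply: measurable_funD; exact: measurable_K_summand.
have mF n : measurable_fun setT (F n) by apply: measurable_funD; exact: measurable_K_summand.
have G0 n t : 0 <= G n t by exact: K_pair_ge0.
have F0 n t : 0 <= F n t by exact: K_pair_ge0.
have term l : 0 <= l -> (nnint (fun t => K_summand p l (rconv w (b l) (rw t)) (rconv w (s l) (rw t))) <=
    C%:E * nnint (fun t => K_summand p l (b l (rw t)) (s l (rw t))))%E.
  move=> l0; rewrite !nnint_K_summand// muleCA; apply: lee_wpmul2l; first by rewrite lee_fin.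
  have lp : (0 <= (l `^ (2 - p))%:E)%E by rewrite lee_fin powR_ge0.
  rewrite (ge0_muleDr _ (Lp_mass_ge0 2 _) (mule_ge0 lp (Lp_mass_ge0 p _))); apply: leeD.
    apply: (le_trans (H2 _ (Sb l))); apply: lee_wpmul2r; first exact: Lp_mass_ge0.
    by rewrite lee_fin lerDl ltW.
  rewrite [leRHS]muleCA; apply: lee_wpmul2l => //.
  apply: (le_trans (Hp _ (Ss l))); apply: lee_wpmul2r; first exact: Lp_mass_ge0.
  by rewrite lee_fin lerDr ltW.
have GF n : (nnint (G n) <= C%:E * nnint (F n))%E.
  have k0 := ltW (level_gt0 R n); have k1 := ltW (colevel_gt0 R n).
  rewrite /G /F /K_pair.
  rewrite !nnintD; try (exact: measurable_K_summand); try (by move=> t; exact: K_summand_ge0).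
  rewrite ge0_muleDr; try (by apply: nnint_ge0 => t; exact: K_summand_ge0).
  by apply: leeD; exact: term.
(* The partial sums dominate only from a rank depending on [t]. The minimum is eventually equal to
   |w * f|^3 at each point, yet bounded by the K-th sum everywhere, as Fatou requires. *)
apply: (@nnint_fatou _ _ (fun K t => Num.min (`|rconv w f (rw t)| `^ 3)
   (2 `^ p * \sum_(n < K) G n t))).
- move=> K; apply: measurable_minr; first exact: measurable_Lp_mass.
  by apply: measurable_funM => //; apply: measurable_sum => n; exact: mG.
- move=> K t; rewrite le_min powR_ge0 mulr_ge0 ?powR_ge0//.
  by apply: sumr_ge0 => n _; exact: G0.
- move=> t; apply: cvg_near_cst.
  have [|K0 HK0] := @sum_K_pair_lower _ _ p3 (fun l => rconv w (b l) (rw t))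
      (fun l => rconv w (s l) (rw t)) (rconv w f (rw t)).
    move=> l; rewrite -rconvD//; congr (rconv w _ _).
    by apply/funext => x; rewrite !fctE subrK.
  near=> K; apply/min_idPl; apply: HK0.
  by near: K; exact: nbhs_infty_ge.
move=> K.
have mSG : measurable_fun setT (fun t => \sum_(n < K) G n t).
  by apply: measurable_sum => n; exact: mG.
have mSF : measurable_fun setT (fun t => \sum_(n < K) F n t).
  by apply: measurable_sum => n; exact: mF.
have SG0 t : 0 <= \sum_(n < K) G n t by apply: sumr_ge0.
have SF0 t : 0 <= \sum_(n < K) F n t by apply: sumr_ge0.
have p20 : 0 <= 2 `^ p :> R by exact: powR_ge0.
have m3 := measurable_Lp_mass 3 (smooth_class_continuous Sf).
have D0 : 0 <= 2 * (6 + dyadic_const p) by rewrite mulr_ge0 ?addr_ge0 ?dyadic_const_ge0.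
apply: (@le_trans _ _ (nnint (fun t => 2 `^ p * \sum_(n < K) G n t))).
  apply: nnint_le => [|||t].
  - apply: measurable_minr; first exact: measurable_Lp_mass.
    exact: measurable_funM.
  - exact: measurable_funM.
  - by move=> t; rewrite le_min powR_ge0 mulr_ge0.
  - by rewrite ge_min lexx orbT.
rewrite nnintZ// EFinM; apply: lee_wpmul2l => //.
apply: (@le_trans _ _ (C%:E * nnint (fun t => (\sum_(n < K) F n t)%R))%E).
  rewrite !nnint_sum// ge0_sume_distrr => [|n _]; last exact: nnint_ge0.
  by apply: lee_sum => n _; exact: GF.
rewrite EFinM; apply: lee_wpmul2l; first by rewrite lee_fin.
apply: (@le_trans _ _ (nnint (fun t => 2 * (6 + dyadic_const p) * `|f (rw t)| `^ 3))).
  apply: nnint_le => // [|t]; first exact: measurable_funM.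
  exact: sum_K_pair_cutoff.
rewrite (nnintZ m3 (fun t => powR_ge0 _ _) D0) -[leRHS]mule1.
by apply: lee_wpmul2l => //; rewrite lee_fin.
Unshelve. all: by end_near. Qed.

End interpolation.

(** * Real and imaginary parts of a distribution *)

Section real_parts.
Variables (R : realType) (N : nat).
Local Notation RN := 'rV[R]_N.
Local Notation C := R[i]^o.
Local Notation normc := ComplexField.Normc.normc.
Local Notation Re := (@complex.Re R).
Local Notation Im := (@complex.Im R).
Implicit Types (f g : RN -> R) (W : tempered_distribution R N) (phi psi : schwartz R N).

Lemma schwartz_open_base (B : set (schwartz R N)) : open B -> B 0 ->
  exists A : {fset set (schwartz R N)},
   [/\ forall X, X \in A -> exists psi k s e, 0 < e /\ X = schwartz_ball psi k s e,
      forall X, X \in A -> X 0 & \bigcap_(X in [set` A]) X `<=` B].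
Proof.
move=> [D' sD' <-] [X D'X X0]; have [A sA AX] := sD' _ D'X.
exists A; split.
- by move=> Y /sA; rewrite in_setE.
- by move=> Y YA; move: X0; rewrite -AX; apply.
- by move=> f Af; exists X => //; rewrite -AX.
Qed.

Lemma seminorm_le_sup phi k s x :
  (1 + `|x|) ^+ k * normc (cpartial s phi x) <= schwartz_seminorm k s phi.
Proof.
apply: ub_le_sup; last by exists x.
have /asboolP[_ /(_ k s)[M HM]] := schwartz_valP phi.
by exists M => _ [y _ <-]; exact: HM.
Qed.

Lemma schwartz_seminorm_le phi k s B :
  (forall x, (1 + `|x|) ^+ k * normc (cpartial s phi x) <= B) ->
  schwartz_seminorm k s phi <= B.
Proof.
move=> HB; apply: ge_sup => [|_ [y _ <-]]; last exact: HB.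
by exists ((1 + `|(0 : RN)|) ^+ k * normc (cpartial s phi 0)), 0.
Qed.

Lemma schwartz_seminormD phi psi k s :
  schwartz_seminorm k s (phi + psi) <= schwartz_seminorm k s phi + schwartz_seminorm k s psi.
Proof.
apply: schwartz_seminorm_le => x.
have /asboolP[cp _] := schwartz_valP phi; have /asboolP[cq _] := schwartz_valP psi.
apply: le_trans (lerD (seminorm_le_sup phi k s x) (seminorm_le_sup psi k s x)).
rewrite -mulrDr ler_wpM2l ?exprn_ge0 ?addr_ge0//.
rewrite (_ : cpartial s (phi + psi : schwartz R N) x = cpartial s phi x + cpartial s psi x).
  exact: normcD.
exact: cpartialD.
Qed.

(** The topology is given by a subbase of balls with arbitrary centres. A ball of centre g and
    radius e containing 0 also contains the ball around 0 of radius e minus the seminorm of -g, and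
    finitely many such balls are intersected. *)
Lemma schwartz_nbhs0 (B : set (schwartz R N)) : nbhs (0 : schwartz R N) B ->
  exists (m : seq (nat * seq 'I_N)) (d : R), 0 < d /\ forall phi,
    (forall k s, (k, s) \in m -> schwartz_seminorm k s phi < d) -> B phi.
Proof.
rewrite nbhsE => -[B' [oB' B'0] B'B].
have [A [HA A0 AB]] := schwartz_open_base oB' B'0.
suff H (r : seq (set (schwartz R N))) :
    (forall X, X \in r -> X \in A) ->
    exists (m : seq (nat * seq 'I_N)) (d : R), 0 < d /\ forall phi,
    (forall k s, (k, s) \in m -> schwartz_seminorm k s phi < d) ->
    forall X, X \in r -> X phi.
  have [m [d [d0 Hd]]] := H (enum_fset A) (fun X XA => XA).
  by exists m, d; split => // phi /Hd Hphi; apply/B'B/AB => X XA; exact: Hphi.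
elim: r => [|X r IH] rA; first by exists [::], 1.
have [m [d [d0 Hd]]] := IH (fun Y Yr => rA Y (@mem_behead _ (X :: r) Y Yr)).
have XA := rA _ (mem_head _ _).
have [g [k [s [e [e0 XE]]]]] := HA _ XA.
have := A0 _ XA; rewrite XE /schwartz_ball /= sub0r => He.
pose d' := Num.min d (e - schwartz_seminorm k s (- g)).
exists ((k, s) :: m), d'; split; first by rewrite lt_min d0 subr_gt0.
move=> phi Hphi Y; rewrite inE => /orP[/eqP ->|Yr].
  rewrite /= (le_lt_trans (schwartz_seminormD _ _ _ _))//.
  rewrite -ltrBrDr (lt_le_trans (Hphi _ _ (mem_head _ _)))//.
  by rewrite /d' ge_min lexx orbT.
apply: Hd => // k' s' ksm; rewrite (lt_le_trans (Hphi k' s' _))//.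
  by rewrite inE ksm orbT.
by rewrite /d' ge_min lexx.
Qed.

Definition complexify f : RN -> C := fun x => (f x +i* 0)%C.

Lemma cpartial_complexify f s x : cpartial s (complexify f) x = (partial s f x +i* 0)%C.
Proof.
rewrite /cpartial; congr (_ +i* _)%C.
rewrite (_ : Im \o complexify f = cst 0)//.
suff -> : partial s (cst 0 : RN -> R) = cst 0 by [].
by elim: s => //= i s ->; apply/funext => y; rewrite derive_cst.
Qed.

Lemma normc_real (a : R) : normc (a +i* 0)%C = `|a|.
Proof. by rewrite /= expr0n addr0 sqrtr_sqr. Qed.

Lemma schwartz_fun_complexify f : rschwartz f -> schwartz_fun (complexify f).
Proof.
move=> Sf; split=> [|k s].
  split; first exact: smooth_class_smooth Sf.
  by have := smooth_class_smooth (@rschwartz0 R N).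
have [_ /(_ k)[M HM]] := Sf s; exists M => x.
by rewrite cpartial_complexify normc_real.
Qed.

(** Total, with default value 0 when [complexify f] is not Schwartz, so that real and imaginary
    parts of W become functionals on all real functions as [tempered] expects. *)
Definition to_schwartz f : schwartz R N := insubd 0 (complexify f).

Lemma to_schwartzE f : rschwartz f -> to_schwartz f = complexify f :> (RN -> C).
Proof.
move=> Sf; have := schwartz_fun_complexify Sf => /asboolP H.
exact: (insubdK (0 : schwartz R N) H).
Qed.

Lemma schwartz_ext phi psi : (forall x, phi x = psi x) -> phi = psi.
Proof. by move=> H; apply/val_inj/funext. Qed.

Definition re_part W f : R := Re (W (to_schwartz f)).
Definition im_part W f : R := Im (W (to_schwartz f)).

Lemma to_schwartzD f g : rschwartz f -> rschwartz g ->
  to_schwartz (f + g) = to_schwartz f + to_schwartz g.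
Proof.
move=> Sf Sg; apply: schwartz_ext => x.
rewrite -[RHS]/((to_schwartz f : RN -> C) x + (to_schwartz g : RN -> C) x).
rewrite !to_schwartzE//; last exact: rschwartzD.
by rewrite /complexify !fctE; apply/eqP; rewrite eq_complex/= eqxx addr0 eqxx.
Qed.

Lemma to_schwartzZ c f : rschwartz f ->
  to_schwartz (cst c * f) = (c +i* 0)%C *: to_schwartz f.
Proof.
move=> Sf; apply: schwartz_ext => x.
rewrite -[RHS]/((c +i* 0)%C * (to_schwartz f : RN -> C) x).
rewrite !to_schwartzE//; last exact: rschwartzZ.
rewrite /complexify !fctE; apply/eqP; rewrite eq_complex/=.
by rewrite !mulr0 mul0r subr0 addr0 !eqxx.
Qed.

(** Continuity at 0 makes W smaller than 1 on a neighbourhood given by seminorms less than d;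
    scaling [f] into that neighbourhood yields the constant 2/d. *)
Lemma distribution_bound W : exists m A, 0 <= A /\ forall f B, rschwartz f -> 0 <= B ->
  seminorm_le m f B -> normc (W (to_schwartz f)) <= A * B.
Proof.
have c0 := @tdist_continuous R N W (0 : schwartz R N).
have nb : nbhs (0 : schwartz R N) ((W : schwartz R N -> C) @^-1` ball (W 0 : C) 1).
  have b1 : nbhs (W 0 : C) (ball (W 0 : C) 1).
    apply: nbhsx_ballx.
    exact: ltr01.
  by move: (c0 _ b1); rewrite nbhs_filterE fmapE; exact.
have [m [d [d0 Hd]]] := schwartz_nbhs0 nb.
exists m, (2 / d); split; first by rewrite divr_ge0// ltW.
move=> f B Sf B0 HB; apply/ler_addgt0Pr => e e0.
(* Positive even if B = 0, and 2/d times b is 2/d times B plus e. *)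
pose b := B + e * d / 2.
have b0 : 0 < b by rewrite ltr_wpDl// divr_gt0// mulr_gt0.
pose c := d / (2 * b).
have c00 : 0 < c by rewrite divr_gt0// mulr_gt0.
have : ball (W 0 : C) 1 (W (to_schwartz (cst c * f))).
  apply: Hd => k s ksm; apply: (@le_lt_trans _ _ (d / 2)); last first.
    by rewrite ltr_pdivrMr// ltr_pMr// ltr1n.
  apply: schwartz_seminorm_le => x.
  rewrite (to_schwartzE (rschwartzZ c Sf)) cpartial_complexify normc_real.
  rewrite partial_cstM; last exact: smooth_class_smooth Sf.
  rewrite !fctE normrM (gtr0_norm c00) mulrCA.
  rewrite -ler_pdivlMl// (le_trans (HB k s ksm x))//.
  have -> : c^-1 * (d / 2) = b by rewrite /c; field; rewrite !gt_eqF.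
  by rewrite lerDl divr_ge0// mulr_ge0// ltW.
rewrite -ball_normE /= linear0 sub0r normrN to_schwartzZ// linearZ/=.
rewrite -[(c +i* 0)%C *: _]/((c +i* 0)%C * _) normrM.
have nE (z : C) : `|z| = ((normc z)%:C)%C by [].
rewrite !nE -rmorphM ltcR normc_real (gtr0_norm c00) -ltr_pdivlMl// mulr1 => /ltW/le_trans; apply.
have -> : c^-1 = 2 / d * b by rewrite /c; field; rewrite !gt_eqF.
have -> // : 2 / d * b = 2 / d * B + e.
by rewrite /b; field; rewrite gt_eqF.
Qed.

Lemma Re_le_normc (z : R[i]) : `|Re z| <= normc z.
Proof. by case: z => a b /=; rewrite -sqrtr_sqr ler_wsqrtr// lerDl sqr_ge0. Qed.

Lemma Im_le_normc (z : R[i]) : `|Im z| <= normc z.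
Proof. by case: z => a b /=; rewrite -sqrtr_sqr ler_wsqrtr// lerDr sqr_ge0. Qed.

Lemma normc_le_ReIm (z : R[i]) : normc z <= `|Re z| + `|Im z|.
Proof.
case: z => a b /=; rewrite -[leRHS]ger0_norm ?addr_ge0// -sqrtr_sqr ler_wsqrtr//.
rewrite sqrrD !real_normK ?num_real// addrAC lerDl mulrn_wge0// mulr_ge0//.
Qed.

Lemma tempered_re_part W : tempered (re_part W).
Proof.
split=> [f g Sf Sg|c f Sf|].
- by rewrite /re_part to_schwartzD// linearD; case: (W _) (W _) => [? ?] [].
- rewrite /re_part to_schwartzZ// linearZ/=; case: (W _) => a b /=.
  by rewrite mul0r subr0.
- have [m [A [A0 H]]] := distribution_bound W; exists m, A; split=> // f B Sf B0 HB.
  exact: le_trans (Re_le_normc _) (H _ _ Sf B0 HB).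
Qed.

Lemma tempered_im_part W : tempered (im_part W).
Proof.
split=> [f g Sf Sg|c f Sf|].
- by rewrite /im_part to_schwartzD// linearD; case: (W _) (W _) => [? ?] [].
- rewrite /im_part to_schwartzZ// linearZ/=; case: (W _) => a b /=.
  by rewrite mul0r addr0.
- have [m [A [A0 H]]] := distribution_bound W; exists m, A; split=> // f B Sf B0 HB.
  exact: le_trans (Im_le_normc _) (H _ _ Sf B0 HB).
Qed.

End real_parts.

(** * Complex and real multipliers *)

Section complex_multipliers.
Variables (R : realType) (N : nat).
Local Notation mR := (measurableTypeR R).
Local Notation T := (N.-tuple mR).
Local Notation mu := (lebesgue_tuple R N).
Local Notation RN := 'rV[R]_N.
Local Notation rw := (@rV_of_tuple R N).
Local Notation C := R[i]^o.
Local Notation normc := ComplexField.Normc.normc.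
Local Notation Re := (@complex.Re R).
Local Notation Im := (@complex.Im R).
Implicit Types (f g : RN -> R) (F : RN -> C) (W : tempered_distribution R N)
  (phi psi : schwartz R N).

Definition cLp_mass (p : R) F : \bar R := nnint (fun t => normc (F (rw t)) `^ p).

Lemma cLp_mass_ge0 p F : (0 <= cLp_mass p F)%E.
Proof. by apply: nnint_ge0 => t; exact: powR_ge0. Qed.

Lemma measurable_cLp_mass p F : continuous (Re \o F) -> continuous (Im \o F) ->
  measurable_fun setT (fun t : T => normc (F (rw t)) `^ p).
Proof.
move=> c1 c2; have m1 := measurable_continuous_rV c1; have m2 := measurable_continuous_rV c2.
apply: (@measurableT_comp _ _ _ _ _ _ (@powR R ^~ p)); first exact: measurable_powR.
rewrite (_ : (fun t : T => normc (F (rw t))) =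
  (fun t : T => ((Re \o F) (rw t) ^+ 2 + (Im \o F) (rw t) ^+ 2) `^ 2^-1)).
  apply: (@measurableT_comp _ _ _ _ _ _ (@powR R ^~ 2^-1)); first exact: measurable_powR.
  by apply: measurable_funD; apply: measurable_funX.
apply/funext => t; rewrite powR12_sqrt ?addr_ge0 ?sqr_ge0//=.
by case: (F _).
Qed.

Lemma Lp_normE p F : Lp_norm p F = (cLp_mass p F `^ p^-1)%E.
Proof.
rewrite /Lp_norm unlock; congr (poweR _ _); apply: eq_integral => t _.
by rewrite /= ger0_norm// normc_ge0.
Qed.

Lemma Lp_norm_le p F K : 0 < p -> 0 <= K ->
  (Lp_norm p F <= K%:E)%E <-> (cLp_mass p F <= (K `^ p)%:E)%E.
Proof.
move=> p0 K0; rewrite Lp_normE; have I0 := cLp_mass_ge0 p F.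
have mono (r : R) (x y : \bar R) : 0 <= r -> (0 <= x)%E -> (x <= y)%E ->
    (x `^ r <= y `^ r)%E.
  move=> r0 x0 xy; apply: gt0_ler_poweR => //; rewrite in_itv/= leey andbT//.
  exact: le_trans xy.
split=> H.
  have := mono p _ _ (ltW p0) (poweR_ge0 _ _) H.
  by rewrite -poweRrM mulVf ?gt_eqF// poweRe1// poweR_EFin.
have := mono p^-1 _ _ _ I0 H; rewrite invr_ge0 (ltW p0) => /(_ isT).
by rewrite poweR_EFin -powRrM divff ?gt_eqF// powRr1.
Qed.

Lemma rschwartz_Re phi : rschwartz (Re \o phi).
Proof.
have /asboolP[[s1 s2] b] := schwartz_valP phi.
move=> s; split=> [x|k]; first exact: s1.
have [M HM] := b k s; exists M => x; apply: le_trans (HM x).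
apply: ler_wpM2l; first by rewrite exprn_ge0 ?addr_ge0.
exact: (Re_le_normc (cpartial s phi x)).
Qed.

Lemma rschwartz_Im phi : rschwartz (Im \o phi).
Proof.
have /asboolP[[s1 s2] b] := schwartz_valP phi.
move=> s; split=> [x|k]; first exact: s2.
have [M HM] := b k s; exists M => x; apply: le_trans (HM x).
apply: ler_wpM2l; first by rewrite exprn_ge0 ?addr_ge0.
exact: (Im_le_normc (cpartial s phi x)).
Qed.

Lemma convolution_ReIm W phi x : convolution W phi x =
  ((rconv (re_part W) (Re \o phi) x - rconv (im_part W) (Im \o phi) x) +i*
   (rconv (im_part W) (Re \o phi) x + rconv (re_part W) (Im \o phi) x))%C.
Proof.
have S1 := rschwartz_reflect x (rschwartz_Re phi).
have S2 := rschwartz_reflect x (rschwartz_Im phi).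
rewrite /convolution.
have -> : schwartz_reflect phi x =
    to_schwartz (fun y => (Re \o phi) (x - y)) +
    (0 +i* 1)%C *: to_schwartz (fun y => (Im \o phi) (x - y)).
  apply: schwartz_ext => y.
  rewrite -[RHS]/((to_schwartz (fun y => (Re \o phi) (x - y)) : RN -> C) y +
    (0 +i* 1)%C * (to_schwartz (fun y => (Im \o phi) (x - y)) : RN -> C) y).
  rewrite !to_schwartzE// /complexify /=; case: (phi (x - y)) => a b.
  by apply/eqP; rewrite eq_complex/= !mul0r !mulr0 mul1r subr0 !addr0 !add0r !eqxx.
rewrite linearD linearZ/= /rconv /re_part /im_part.
case: (W _) => a b; case: (W _) => c d; apply/eqP; rewrite eq_complex/=.
by rewrite !mul0r !mul1r sub0r add0r !eqxx.
Qed.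

Lemma rconv0 w x : tempered w -> rconv w (0 : RN -> R) x = 0.
Proof. by move=> tw; exact: tempered0. Qed.

Lemma convolution_to_schwartz W f x : rschwartz f ->
  convolution W (to_schwartz f) x =
  (rconv (re_part W) f x +i* rconv (im_part W) f x)%C.
Proof.
move=> Sf; rewrite convolution_ReIm.
have -> : Re \o to_schwartz f = f by rewrite to_schwartzE.
have -> : Im \o to_schwartz f = 0 by rewrite to_schwartzE.
by rewrite !rconv0 ?subr0 ?addr0//; [exact: tempered_re_part|exact: tempered_im_part].
Qed.

Lemma measurable_convolution p W phi :
  measurable_fun setT (fun t : T => normc (convolution W phi (rw t)) `^ p).
Proof.
have t1 := tempered_re_part W; have t2 := tempered_im_part W.
have sr := rschwartz_Re phi; have si := rschwartz_Im phi.
apply: measurable_cLp_mass.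
  rewrite (_ : Re \o _ = rconv (re_part W) (Re \o phi) + cst (-1) * rconv (im_part W) (Im \o phi)).
    apply: (@smooth_class_continuous _ _ (@moderate R N)).
    apply: slowD; first exact: rconv_slow.
    by apply: slowM; [exact: slow_cst|exact: rconv_slow].
  by apply/funext => x /=; rewrite convolution_ReIm/= !fctE mulN1r.
rewrite (_ : Im \o _ = rconv (im_part W) (Re \o phi) + rconv (re_part W) (Im \o phi)).
  apply: (@smooth_class_continuous _ _ (@moderate R N)).
  by apply: slowD; exact: rconv_slow.
by apply/funext => x /=; rewrite convolution_ReIm.
Qed.

Lemma cLp_mass_to_schwartz p f : rschwartz f -> cLp_mass p (to_schwartz f) = Lp_mass p f.
Proof.
move=> Sf; have E := to_schwartzE Sf; congr nnint; apply/funext => t.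
by rewrite E normc_real.
Qed.

Lemma multipliers_real_multiplier p q W : 0 < p -> 0 < q -> multipliers p q W ->
  real_multiplier p q (re_part W) /\ real_multiplier p q (im_part W).
Proof.
move=> p0 q0 [M HM].
have H f : rschwartz f -> (Lp_mass p f <= 1)%E ->
    (cLp_mass q (convolution W (to_schwartz f)) <= (`|M| `^ q)%:E)%E.
  move=> Sf f1; apply/Lp_norm_le => //; apply: (le_trans (HM _)).
  have h : (Lp_norm p (to_schwartz f) <= 1%:E)%E.
    by apply/Lp_norm_le => //; rewrite powR1 cLp_mass_to_schwartz.
  apply: (@le_trans _ _ (`|M|%:E * Lp_norm p (to_schwartz f))%E).
    apply: lee_wpmul2r; last by rewrite lee_fin ler_norm.
    by rewrite Lp_normE poweR_ge0.
  by rewrite -[leRHS]mule1; apply: lee_wpmul2l.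
split; exists (`|M| `^ q) => f Sf f1; apply: le_trans (H f Sf f1);
  apply: nnint_le => [||t|t]; try exact: measurable_convolution; try exact: powR_ge0.
- apply: measurable_Lp_mass; apply: smooth_class_continuous (rconv_slow _ Sf).
  exact: tempered_re_part.
- apply: ge0_ler_powR; rewrite ?nnegrE ?normc_ge0 ?(ltW q0)//.
  by rewrite convolution_to_schwartz//; exact: (Re_le_normc (_ +i* _)%C).
- apply: measurable_Lp_mass; apply: smooth_class_continuous (rconv_slow _ Sf).
  exact: tempered_im_part.
- apply: ge0_ler_powR; rewrite ?nnegrE ?normc_ge0 ?(ltW q0)//.
  by rewrite convolution_to_schwartz//; exact: (Im_le_normc (_ +i* _)%C).
Qed.

Lemma powR_sum4 (q a b c d x : R) : 0 <= q -> 0 <= a -> 0 <= b -> 0 <= c -> 0 <= d ->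
  0 <= x -> x <= a + b + (c + d) ->
  x `^ q <= 4 `^ q * (a `^ q + b `^ q + (c `^ q + d `^ q)).
Proof.
move=> q0 a0 b0 c0 d0 x0 xs.
pose m := Num.max (Num.max a b) (Num.max c d).
have m0 : 0 <= m by rewrite !le_max a0.
have xm : x <= 4 * m.
  apply: (le_trans xs).
  have [am bm cm dm] : [/\ a <= m, b <= m, c <= m & d <= m].
    by split; rewrite /m !le_max lexx ?orbT.
  lra.
apply: (@le_trans _ _ ((4 * m) `^ q)).
  by apply: ge0_ler_powR; rewrite ?nnegrE ?mulr_ge0.
rewrite powRM// ler_wpM2l ?powR_ge0//.
have [pa pb pc pd] : [/\ 0 <= a `^ q, 0 <= b `^ q, 0 <= c `^ q & 0 <= d `^ q].
  by split; exact: powR_ge0.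
rewrite /m; case: (leP (Num.max a b) (Num.max c d)) => _.
  by case: (leP c d) => _; lra.
by case: (leP a b) => _; lra.
Qed.

Lemma real_multiplier_multipliers p q W : 0 < p -> 0 < q ->
  real_multiplier p q (re_part W) -> real_multiplier p q (im_part W) -> multipliers p q W.
Proof.
move=> p0 q0 w1 w2.
have t1 := tempered_re_part W; have t2 := tempered_im_part W.
have [C1 [C10 H1]] := real_multiplierP p0 q0 t1 w1; have [C2 [C20 H2]] := real_multiplierP p0 q0 t2 w2.
pose A := 4 `^ q * (C1 + C2 + (C2 + C1)).
have A0 : 0 < A by rewrite mulr_gt0 ?powR_gt0// !addr_gt0.
pose M := A `^ q^-1; have M0 : 0 < M by exact: powR_gt0.
have key phi (K : R) : 0 < K -> (Lp_norm p phi <= K%:E)%E ->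
    (Lp_norm q (convolution W phi) <= (M * K)%:E)%E.
  move=> K0 /(Lp_norm_le phi p0 (ltW K0)) HK.
  apply/Lp_norm_le => //; first by rewrite mulr_ge0// ltW.
  have -> : (M * K) `^ q = A * K `^ q.
    by rewrite powRM ?(ltW M0) ?(ltW K0)// -powRrM mulVf ?gt_eqF// powRr1 ?(ltW A0).
  have sr := rschwartz_Re phi; have si := rschwartz_Im phi.
  have mphi : measurable_fun setT (fun t : T => normc (phi (rw t)) `^ p).
    by apply: measurable_cLp_mass; [exact: smooth_class_continuous sr
                              |exact: smooth_class_continuous si].
  have Kr : (Lp_mass p (Re \o phi) <= (K `^ p)%:E)%E.
    apply: le_trans HK; apply: nnint_le => // [|t]; last first.
    - by apply: ge0_ler_powR; rewrite ?nnegrE ?normc_ge0 ?(ltW p0)// Re_le_normc.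
    - by apply: measurable_Lp_mass; exact: smooth_class_continuous sr.
  have Ki : (Lp_mass p (Im \o phi) <= (K `^ p)%:E)%E.
    apply: le_trans HK; apply: nnint_le => // [|t]; last first.
    - by apply: ge0_ler_powR; rewrite ?nnegrE ?normc_ge0 ?(ltW p0)// Im_le_normc.
    - by apply: measurable_Lp_mass; exact: smooth_class_continuous si.
  pose h1 := rconv (re_part W) (Re \o phi); pose h2 := rconv (im_part W) (Im \o phi).
  pose h3 := rconv (im_part W) (Re \o phi); pose h4 := rconv (re_part W) (Im \o phi).
  have m1 : measurable_fun setT (fun t : T => `|h1 (rw t)| `^ q).
    exact: measurable_Lp_mass (smooth_class_continuous (rconv_slow t1 sr)).
  have m2 : measurable_fun setT (fun t : T => `|h2 (rw t)| `^ q).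
    exact: measurable_Lp_mass (smooth_class_continuous (rconv_slow t2 si)).
  have m3 : measurable_fun setT (fun t : T => `|h3 (rw t)| `^ q).
    exact: measurable_Lp_mass (smooth_class_continuous (rconv_slow t2 sr)).
  have m4 : measurable_fun setT (fun t : T => `|h4 (rw t)| `^ q).
    exact: measurable_Lp_mass (smooth_class_continuous (rconv_slow t1 si)).
  have p00 (h : RN -> R) (t : T) : 0 <= `|h (rw t)| `^ q by exact: powR_ge0.
  have p12 t := addr_ge0 (p00 h1 t) (p00 h2 t).
  have p34 t := addr_ge0 (p00 h3 t) (p00 h4 t).
  have m12 := measurable_funD m1 m2; have m34 := measurable_funD m3 m4.
  have m1234 := measurable_funD m12 m34.
  have p1234 t := addr_ge0 (p12 t) (p34 t).
  apply: (@le_trans _ _ (nnint (fun t => 4 `^ q * (`|h1 (rw t)| `^ q + `|h2 (rw t)| `^ q +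
     (`|h3 (rw t)| `^ q + `|h4 (rw t)| `^ q))))).
    apply: nnint_le => [||t|t].
    - exact: measurable_convolution.
    - exact: measurable_funM.
    - exact: powR_ge0.
    apply: powR_sum4; rewrite ?normc_ge0 ?(ltW q0)//.
    rewrite convolution_ReIm; apply: (le_trans (normc_le_ReIm _)) => /=.
    by apply: lerD; [exact: ler_normB|exact: ler_normD].
  rewrite (nnintZ m1234 p1234 (powR_ge0 _ _)) /A -mulrA EFinM.
  apply: lee_wpmul2l; first by rewrite lee_fin powR_ge0.
  rewrite (nnintD m12 m34 p12 p34) (nnintD m1 m2 (p00 h1) (p00 h2)) (nnintD m3 m4 (p00 h3) (p00 h4)).
  rewrite !mulrDl !EFinD; apply: leeD; apply: leeD.
  - exact: H1.
  - exact: H2.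
  - exact: H2.
  - exact: H1.
exists M => phi.
have L0 : (0 <= Lp_norm p phi)%E by rewrite Lp_normE poweR_ge0.
(* An infinite norm makes the right side infinite because M > 0. For a finite norm v, adding e/M
   lets [key], stated for positive bounds, cover v = 0. *)
case E : (Lp_norm p phi) L0 => [v||//] L0; last by rewrite gt0_muley ?leey ?lte_fin.
rewrite lee_fin in L0; apply/lee_addgt0Pr => e e0.
have v0 : 0 < v + e / M by rewrite ltr_wpDl// divr_gt0.
apply: (le_trans (key phi _ v0 _)); first by rewrite E lee_fin lerDl divr_ge0// ltW.
by rewrite mulrDr mulrCA divff ?mulr1 ?gt_eqF.
Qed.

End complex_multipliers.

(** * Multipliers and condition (W) *)

Section multiplier_calculus.
Variables (R : realType) (N : nat).
Implicit Types (p q : R) (W : tempered_distribution R N).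

Lemma multipliers_dual p q p' q' W : 1 < p -> 1 < q ->
  p^-1 + p'^-1 = 1 -> q^-1 + q'^-1 = 1 ->
  multipliers p q W -> multipliers q' p' W.
Proof.
move=> p1 q1 pp' qq'.
have conj_gt0 (r r' : R) : 1 < r -> r^-1 + r'^-1 = 1 -> 0 < r'.
  move=> r1 rr'; rewrite -invr_gt0; have : r^-1 < 1 by rewrite invf_lt1//; lra.
  by move=> ?; lra.
have p0 : 0 < p by lra.
have q0 : 0 < q by lra.
have p'0 := conj_gt0 _ _ p1 pp'; have q'0 := conj_gt0 _ _ q1 qq'.
move=> /(@multipliers_real_multiplier _ _ p q W p0 q0)[w1 w2].
apply: (real_multiplier_multipliers q'0 p'0).
  exact: real_multiplier_dual p1 q1 pp' qq' (tempered_re_part W) w1.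
exact: real_multiplier_dual p1 q1 pp' qq' (tempered_im_part W) w2.
Qed.

Lemma multipliers_logconvex p q0 q1 q W : 0 < p -> 0 < q0 -> q0 <= q <= q1 ->
  multipliers p q0 W -> multipliers p q1 W -> multipliers p q W.
Proof.
move=> p0 q00 Hq; have /andP[h0 h1] := Hq.
have q'0 : 0 < q by exact: lt_le_trans h0.
have q10 : 0 < q1 by exact: lt_le_trans h1.
move=> /(@multipliers_real_multiplier _ _ p q0 W p0 q00)[w1 w2].
move=> /(@multipliers_real_multiplier _ _ p q1 W p0 q10)[w3 w4].
apply: (real_multiplier_multipliers p0 q'0).
  exact: real_multiplier_logconvex q00 Hq (tempered_re_part W) w1 w3.
exact: real_multiplier_logconvex q00 Hq (tempered_im_part W) w2 w4.
Qed.

Lemma multipliers_interpol3 p W : 3 <= p ->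
  multipliers 2 2 W -> multipliers p p W -> multipliers 3 3 W.
Proof.
rewrite le_eqVlt => /orP[/eqP <-//|p3].
have p0 : 0 < p by lra.
have p20 : 0 < 2 :> R by [].
move=> /(@multipliers_real_multiplier _ _ 2 2 W p20 p20)[w1 w2].
move=> /(@multipliers_real_multiplier _ _ p p W p0 p0)[w3 w4].
have p30 : 0 < 3 :> R by [].
apply: (real_multiplier_multipliers p30 p30).
  exact: marcinkiewicz3 p3 (tempered_re_part W) w1 w3.
exact: marcinkiewicz3 p3 (tempered_im_part W) w2 w4.
Qed.

Lemma multipliers_dual_diag p W : 1 < p -> multipliers p p W ->
  multipliers (1 - p^-1)^-1 (1 - p^-1)^-1 W.
Proof.
move=> p1; apply: multipliers_dual => //; rewrite invrK; ring.
Qed.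

Lemma W_condition_of_22_33 W : (1 <= N <= 3)%N ->
  multipliers 2 2 W -> multipliers 3 3 W -> W_condition W.
Proof.
move=> /andP[N1 N3] w2 w3.
have w32 : multipliers (3 / 2) (3 / 2) W.
  have := multipliers_dual_diag _ w3; rewrite (_ : (1 - 3^-1)^-1 = 3 / 2); last by field.
  by apply; rewrite ltr1n.
(* All four pairs are diagonal: 3/2, 3, 3, 2, with s1 = s2 = 3. The fourth is 2 because p4 < 3 is
   strict when N = 3. *)
exists (WExponents (3 / 2) 3 3 2 (3 / 2) 3 3 2 3 3); split => /=.
- by split; split; lra.
- move=> N3'; have -> : N = 3%N by apply/eqP; rewrite eqn_leq N3.
  have -> : 3 / (3 - 2) = 3 :> R by field.
  have -> : 2 * 3 / (3 - 2) = 6 :> R by field.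
  have -> : 2 * 3 / (3 + 2) = 6 / 5 :> R by field.
  by split; [lra|split; lra|lra|split; lra].
- by move=> _; split; [split; lra|lra].
- by split=> //; split.
- by split; field.
Qed.

(** On the diagonal the first identity reads 1/p2 + 1/p3 = 1/p1. Either p1 <= 3/2 and its conjugate
    is at least 3, or 1/p1 < 2/3 and one of p2, p3 is at least 3. In each case interpolation with
    the exponent 2 reaches 3. *)
Lemma diag_exponents_33 W e : W_condition_with W e -> (1 <= N <= 3)%N ->
  wp1 e = wq1 e -> wp2 e = wq2 e -> wp3 e = wq3 e -> multipliers 3 3 W.
Proof.
case=> [[[_ p2 p3 _] [q1 _ _ _] _] big small [w2 [w1 w2' w3 _]] [e1 _ _]] /andP[N1 N3].
move=> pq1 pq2 pq3; rewrite -pq1 in w1; rewrite -pq2 in w2'; rewrite -pq3 in w3.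
have [q1b [p2b p3b]] : 1 < wq1 e <= 2 /\ 2 <= wp2 e /\ 2 <= wp3 e.
  have [/andP[N12 _]|N3'] := boolP ((N <= 2)%N && true); last first.
    have /big[_ [/andP[h1 _] /andP[h2 _] _ _] /andP[h3 h4] _] : (3 <= N)%N.
      by rewrite andbT -ltnNge in N3'.
    split=> //; rewrite h4 andbT (le_lt_trans _ h3)//.
    have -> : N = 3%N by apply/eqP; rewrite eqn_leq N3/= ; rewrite andbT -ltnNge in N3'.
    (* For N = 3 the lower bound for q1 is 6/5, which gives q1 > 1 as in the lower dimensions. *)
    by have -> : 2 * 3 / (3 + 2) = 6 / 5 :> R by [field]; lra.
  have /small[[h1 h2 _ _] h3] : N = 1%N \/ N = 2%N by move: N1 N12; case: (N) => [|[|[|]]]//; [left|right].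
  by [].
have /andP[q1gt q1le] := q1b.
have q10 : 0 < wq1 e by lra.
have p20 : 0 < wp2 e by lra.
have p30 : 0 < wp3 e by lra.
have [h|h] := leP (wq1 e) (3 / 2).
  have w1' : multipliers (1 - (wp1 e)^-1)^-1 (1 - (wp1 e)^-1)^-1 W.
    by apply: multipliers_dual_diag w1; rewrite pq1.
  apply: multipliers_interpol3 w2 w1'; rewrite pq1.
  have k1 : (wq1 e)^-1 < 1 by rewrite invf_lt1.
  have k2 : 2 / 3 <= (wq1 e)^-1.
    by rewrite -(invrK (2 / 3)) lef_pV2 ?posrE// (_ : (2 / 3)^-1 = 3 / 2) //; field.
  rewrite -[leLHS]invrK lef_pV2 ?posrE ?subr_gt0//; lra.
have k : (wq1 e)^-1 < 2 / 3.
  by rewrite -(invrK (2 / 3)) ltf_pV2 ?posrE// (_ : (2 / 3)^-1 = 3 / 2) //; field.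
have [h2|h2] := leP 3 (wp2 e); first exact: multipliers_interpol3 w2 w2'.
apply: multipliers_interpol3 w2 w3.
have k2 : 3^-1 < (wp2 e)^-1 by rewrite ltf_pV2 ?posrE.
have k3 : (wp3 e)^-1 < 3^-1 by rewrite -pq2 in e1; lra.
by rewrite ltf_pV2 ?posrE// in k3; exact: ltW.
Qed.

Lemma W_condition_of_strip W : (4 <= N)%N ->
  (forall r : R, 1 < r -> multipliers r r W) ->
  (exists rbar : R, N%:R / 4 < rbar /\
     forall p q : R, 1 - rbar^-1 < p^-1 < 1 ->
       q^-1 = p^-1 + rbar^-1 - 1 -> multipliers p q W) ->
  W_condition W.
Proof.
move=> N4 wr [rbar [rN ws]]; pose n : R := N%:R; pose c := rbar^-1.
have n4 : 4 <= n by rewrite /n ler_nat.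
have n0 : 0 < n by lra.
have r0 : 0 < rbar by move: rN; rewrite -/n; lra.
have c0 : 0 < c by rewrite invr_gt0.
pose i := n^-1; have i0 : 0 < i by rewrite invr_gt0.
have i4 : i <= 4^-1 by rewrite lef_pV2 ?posrE.
have ni : n * i = 1 by rewrite divff// gt_eqF.
have c4 : c < 4 * i.
  rewrite (_ : 4 * i = (n / 4)^-1); last by rewrite invfM invrK mulrC.
  by rewrite ltf_pV2 ?posrE// divr_gt0.
(* Coordinates u = 1/p and v = 1/q: for fixed u, the diagonal v = u and the line v = u + c - 1 are
   the two hypotheses, and [multipliers_logconvex] fills the segment between them. *)
have strip u v : 1 - c < u < 1 -> 0 < v -> u + c - 1 <= v <= u -> multipliers u^-1 v^-1 W.
  move=> /andP[u1 u2] v0 /andP[v1 v2].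
  have u0 : 0 < u by lra.
  have k0 : 0 < u + c - 1 by lra.
  apply: (@multipliers_logconvex _ u^-1 (u + c - 1)^-1); rewrite ?invr_gt0//.
  - by rewrite !lef_pV2 ?posrE// v1 v2.
  - by apply: wr; rewrite invf_gt1.
  - by apply: ws; rewrite !invrK// u1 u2.
(* 2x < c places u = 1 - 2x to the right of 1 - c, and c - 1/2 <= 2x places v = 1/2 above the lower
   line there. The conditions are compatible since c < 4/N and N >= 4 give c - 1/2 < 2/N. *)
have [x [x0 xi xc xc']] : exists x, [/\ 0 < x, x < i, 2 * x < c & c - 2^-1 <= 2 * x].
  pose a := Num.max 0 ((c - 2^-1) / 2); pose b := Num.min i (c / 2).
  have a1 : 0 <= a by rewrite le_max lexx.
  have a2 : (c - 2^-1) / 2 <= a by rewrite le_max lexx orbT.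
  have b1 : b <= i by rewrite ge_min lexx.
  have b2 : b <= c / 2 by rewrite ge_min lexx orbT.
  have ab : a < b by rewrite lt_min !gt_max; apply/andP; split; apply/andP; split; lra.
  by exists ((a + b) / 2); split; lra.
(* 1/p4 for the fourth pair, taken on the lower line; c < 4/N makes the second and fourth conditions
   compatible. *)
have [u [u1 u2 u3 u4]] : exists u, [/\ 1 - c < u, 1 - 2 * i < u, u < 1 & u < 2 * i + 1 - c].
  pose a := Num.max (1 - c) (1 - 2 * i); pose b := Num.min 1 (2 * i + 1 - c).
  have a1 : 1 - c <= a by rewrite le_max lexx.
  have a2 : 1 - 2 * i <= a by rewrite le_max lexx orbT.
  have b1 : b <= 1 by rewrite ge_min lexx.
  have b2 : b <= 2 * i + 1 - c by rewrite ge_min lexx orbT.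
  have ab : a < b by rewrite lt_min !gt_max; apply/andP; split; apply/andP; split; lra.
  by exists ((a + b) / 2); split; lra.
have hx : 0 < 2^-1 - x by lra.
have h2x : 0 < 1 - 2 * x by lra.
have u0 : 0 < u by lra.
have uc0 : 0 < u + c - 1 by lra.
have ge1 (y : R) : 0 < y -> y <= 1 -> 1 <= y^-1 by move=> y0 y1; rewrite invf_ge1.
have w1 : multipliers (1 - 2 * x)^-1 2 W.
  by rewrite -[X in multipliers _ X](invrK 2); apply: strip; lra.
have w2 : multipliers (2^-1 - x)^-1 x^-1 W.
  (* The point (1/2 - x, x) need not satisfy 1/p > 1 - c, but its dual does lie in the strip; x <
     1/N <= 1/4 keeps the dual below the diagonal. *)
  have w : multipliers (1 - x)^-1 (2^-1 + x)^-1 W by apply: strip; lra.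
  apply: (multipliers_dual _ _ _ _ w); rewrite ?invrK.
  - by rewrite invf_gt1; lra.
  - by rewrite invf_gt1; lra.
  - by ring.
  - by field.
have w4 : multipliers u^-1 (u + c - 1)^-1 W by apply: strip; lra.
have n2 : 0 < n - 2 by lra.
have big y : 2^-1 - i < y -> y^-1 < 2 * n / (n - 2).
  move=> yi; have y0 : 0 < y by lra.
  rewrite -[ltRHS]invrK ltf_pV2 ?posrE ?invr_gt0 ?divr_gt0 ?mulr_gt0//.
  rewrite (_ : (2 * n / (n - 2))^-1 = 2^-1 - i)// /i.
  by field; rewrite !gt_eqF.
exists (WExponents (1 - 2 * x)^-1 (2^-1 - x)^-1 (2^-1 - x)^-1 u^-1
  2 x^-1 x^-1 (u + c - 1)^-1 (2^-1 - x)^-1 (2^-1 - x)^-1); split => /=.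
- by split; split; rewrite ?ge1//; lra.
- have two : 2 <= (2^-1 - x)^-1.
    by rewrite -[leLHS]invrK lef_pV2 ?posrE//; lra.
  have bx : (2^-1 - x)^-1 < 2 * n / (n - 2) by apply: big; lra.
  move=> _; rewrite -/n two bx; split=> //.
  + rewrite -[ltRHS]invrK ltf_pV2 ?posrE ?invr_gt0 ?divr_gt0//.
    by rewrite invfM invrK mulrC mulrBl ni.
  + by rewrite lexx andbT ltr_pdivrMr; lra.
  + have half : n / 2 = (2 * i)^-1 by rewrite invfM invrK mulrC.
    by rewrite half !ltf_pV2 ?posrE// ?mulr_gt0//; split; lra.
- by case=> NE; rewrite NE in N4.
- by split; [apply: wr; lra|split].
- by rewrite !invrK; split; field.
Qed.

End multiplier_calculus.

Theorem proposition1p3 (R : realType) (N : nat) (W : tempered_distribution R N) :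
  ((1 <= N <= 3)%N ->
    (multipliers 2 2 W /\ multipliers 3 3 W -> W_condition W) /\
    (forall e : W_exponents R, W_condition_with W e ->
       wp1 e = wq1 e -> wp2 e = wq2 e -> wp3 e = wq3 e ->
       multipliers 2 2 W /\ multipliers 3 3 W)) /\
  ((4 <= N)%N ->
    (forall r : R, 1 < r -> multipliers r r W) ->
    (exists rbar : R, N%:R / 4 < rbar /\
       forall p q : R, 1 - rbar^-1 < p^-1 < 1 ->
         q^-1 = p^-1 + rbar^-1 - 1 -> multipliers p q W) ->
    W_condition W).
Proof.
split=> [N13|N4 wr ws]; last exact: W_condition_of_strip.
split=> [[w2 w3]|e We e1 e2 e3]; first exact: W_condition_of_22_33.
split; first by case: We => _ _ _ [].
exact: diag_exponents_33 We N13 e1 e2 e3.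
Qed.
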